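(* For all $L\in\{2,3,\ldots\}$, $d\in\mathbb{N}$ and $a>1$ there exist $q\in(0,1)$ and $N_0,N_1\in\mathbb{N}$ such that site-bond percolation on $\mathbb{H}^d_L$ with the kernel \[J(e)=\begin{cases}\dfrac{aL^d\log\log(|e|)}{|e|^{2d}}&\text{if }|e|\ge N_1,\\ N_0&\text{if }|e|<N_1\end{cases}\] satisfies $\mathbb{P}_{q,J}(|K_0|=\infty)>0$.
   Context: The hierarchical lattice $\mathbb{H}^d_L$ is the group $\bigoplus_{i=1}^\infty(\mathbb{Z}/L\mathbb{Z})^d$ with ultrametric $\|x-y\|=L^{\max\{i:x_i\neq y_i\}}$ for $x\neq y$; edges are unordered pairs $e=\{x,y\}$ of distinct vertices with $|e|=\|x-y\|$. For $q\in[0,1]$ and a kernel $J:E\to[0,\infty)$, $\mathbb{P}_{q,J}$ is the law of the random graph in which each vertex is open independently with probability $q$ and, independently, each edge between two open vertices is open independently with probability $1-\exp(-J(e))$. $K_0$ denotes the open cluster of the origin. *)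

(* Defs.v *)
From HB Require Import structures.
From mathcomp Require Import all_boot all_order all_algebra finmap.
From mathcomp Require Import all_classical all_reals all_analysis.
From Stdlib Require Import Relation_Operators.
Set Implicit Arguments. Unset Strict Implicit. Unset Printing Implicit Defensive.
Import Order.TTheory GRing.Theory Num.Theory.
Local Open Scope classical_set_scope.
Local Open Scope fset_scope.
Local Open Scope ring_scope.

(* A vertex x = (x_1, x_2, ...) in (+)_{i>=1} (Z/LZ)^d is encoded as the finite
   list of its blocks [x_1; ...; x_n] (each block a list of d naturals < L),
   normalised so that the last block is non-zero (trailing zero blocks are
   dropped).  The origin is the empty list. *)
Definition hwf (L d : nat) (s : seq (seq nat)) : bool :=
  all (fun b => (size b == d)%N && all (fun c : nat => (c < L)%N) b) s &&
  ((s == [::]) || (last [::] s != nseq d 0%N)).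

Definition hvert (L d : nat) := {s : seq (seq nat) | hwf L d s}.

Lemma hwf_nil (L d : nat) : hwf L d [::]. Proof. by []. Qed.

Definition horigin (L d : nat) : hvert L d := exist _ [::] (hwf_nil L d).

(* i-th block (0-based list index, i.e. x_{i+1} in the paper) *)
Definition hblock (L d : nat) (x : hvert L d) (i : nat) : seq nat :=
  nth (nseq d 0) (proj1_sig x) i.

Definition hlevel (L d : nat) (x y : hvert L d) : nat :=
  \max_(i < maxn (size (proj1_sig x)) (size (proj1_sig y))
          | hblock x i != hblock y i) i.+1.

Definition hnorm (L d : nat) (x y : hvert L d) : nat := L ^ hlevel x y.

Definition hedge (L d : nat) := {e : {fset hvert L d} | #|` e| == 2}.

(* |e| = ||x - y|| for e = {x,y} *)
Definition hedge_len (L d : nat) (e : hedge L d) : nat :=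
  \max_(x <- enum_fset (proj1_sig e)) \max_(y <- enum_fset (proj1_sig e)) hnorm x y.

Definition kernel15 (R : realType) (L d : nat) (a : R) (N0 N1 : nat)
  (e : hedge L d) : R :=
  let n := hedge_len e in
  if (N1 <= n)%N then
    a * (L ^ d)%:R * ln (ln (n%:R)) / ((n ^ (2 * d))%:R)
  else N0%:R.

Definition mutually_independent (R : realType) (dT : measure_display)
  (T : measurableType dT) (P : probability T R) (I : eqType) (A : I -> set T) :=
  forall s : seq I, uniq s ->
    P (\bigcap_(i in [set` s]) A i) = (\prod_(i <- s) P (A i))%E.

(* site x t : vertex x is open in outcome t;  bond e t : the edge variable of e.
   The edge e = {x,y} is open iff x, y are open and bond e holds. *)
Definition open_adj (L d : nat) (T : Type) (site : hvert L d -> set T)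
  (bond : hedge L d -> set T) (t : T) (x y : hvert L d) : Prop :=
  exists e : hedge L d,
    [/\ x \in proj1_sig e, y \in proj1_sig e, x != y,
        site x t /\ site y t & bond e t].

Definition cluster0 (L d : nat) (T : Type) (site : hvert L d -> set T)
  (bond : hedge L d -> set T) (t : T) : set (hvert L d) :=
  [set y | site (horigin L d) t /\
           @clos_refl_trans _ (open_adj site bond t) (horigin L d) y].

Definition site_bond_model (R : realType) (L d : nat) (dT : measure_display)
  (T : measurableType dT) (P : probability T R) (q : R) (J : hedge L d -> R)
  (site : hvert L d -> set T) (bond : hedge L d -> set T) : Prop :=
  [/\ (forall x, measurable (site x)),
      (forall e, measurable (bond e)),
      (forall x, P (site x) = q%:E),
      (forall e, P (bond e) = (1 - expR (- J e))%:E) &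
      mutually_independent P
        (fun i : (hvert L d + hedge L d)%type =>
           match i with inl x => site x | inr e => bond e end)].

(* Main.v *)
Require Import Defs.
From HB Require Import structures.
From mathcomp Require Import all_boot all_order all_algebra finmap.
From mathcomp Require Import all_classical all_reals all_analysis.
From mathcomp Require Import ring lra zify.
From Stdlib Require Import Relation_Operators.

(* With M = L^d, a block of level n is fine if it has a cluster (its main cluster) filling a
   fraction at least 1 - M^-e of it.  If e is large compared with k, the main clusters of
   nested fine blocks whose levels differ by at most 2 k intersect, so they are nested.
   A block splits at its top level with probability about n^(-a/2), which need not be
   summable, but the probability that k consecutive ancestors of a block all fail to be fine
   is at most n^-alpha with alpha > 1: either two independent failures occur, or some union
   of sub-blocks of the smallest block is separated from the rest of the largest one, and
   such a cut has total weight close to a log n, whereas the weight of an arbitrary cut is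
   only guaranteed to be about (a/2) log n.  By Borel-Cantelli summation, with positive
   probability the origin lies in the main cluster of one of any k consecutive levels, and
   its cluster is infinite.
   The two estimates are proved by simultaneous induction on n.  A block is viewed as a tree
   of fixed depth over leaves of level n - h, whose main clusters are joined by fresh edges.
   That the vertices outside these main clusters have small density follows from a large
   deviation bound over about n^(1/4) independent sub-blocks for old failures, and from
   independence of the leaves for recent ones.  The induction starts because, for N0 large
   and q close to 1, all blocks of low level are fully open up to an arbitrarily small
   probability. *)

(** A cut whose smaller side has density D weighs at least 1 - D. So a cut can be as light as 1/2
    only when it splits its block about evenly, which for M = 2 happens when the top level separates
    the two halves. Seen from higher ancestors, the same set either has become sparse or has gained
    weight at every level. This is why failures are counted over k consecutive ancestors and not one
    by one. The exponents close with slack. Put alpha = 1 + 2 sigma, beta = (1 + 3 sigma) / 2, and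
    let gamma be the exponent of a cut of weight 1. Two failed leaves cost 2 beta > alpha, a failed
    leaf with a cut of the others costs beta + gamma / 2 > alpha, and a double cut costs gamma (1 -
    s) > alpha. A term that already carries the full inductive bound n^-alpha or n^-beta needs only
    some extra negative power of n, so the crude cut bound left after dropping a leaf, with its
    factor M^(-2 h), is enough. The depth h is fixed, hence the numbers of leaves and of cuts are
    constants absorbed by large n. Everything is estimated in a finite block with bounds uniform in
    its level N, and only then transferred to the lattice. *)

Set Implicit Arguments. Unset Strict Implicit. Unset Printing Implicit Defensive.
Import Order.TTheory GRing.Theory Num.Theory.
Local Open Scope ring_scope.

(** * Product Bernoulli measures *)

Section ProductBernoulli.
Variables (R : realFieldType) (C : finType) (p : C -> R).
Hypothesis p01 : forall c, 0 <= p c <= 1.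
Implicit Types (A B D : pred {ffun C -> bool}) (S : pred C).

Definition wt (w : {ffun C -> bool}) : R :=
  \prod_c (if w c then p c else 1 - p c).

Definition Pr A : R := \sum_(w | A w) wt w.

Definition dep S A := forall w w' : {ffun C -> bool},
  (forall c, S c -> w c = w' c) -> A w = A w'.

Lemma wt_ge0 w : 0 <= wt w.
Proof.
apply: prodr_ge0 => c _; have /andP[p0 p1] := p01 c.
by case: (w c) => //; rewrite subr_ge0.
Qed.

Lemma Pr_ge0 A : 0 <= Pr A.
Proof. by apply: sumr_ge0 => w _; exact: wt_ge0. Qed.

Lemma Pr_le A B : (forall w, A w -> B w) -> Pr A <= Pr B.
Proof.
move=> AB; rewrite /Pr big_mkcond [leRHS]big_mkcond /=.
apply: ler_sum => w _; have := AB w; case: (A w) => [->//|_].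
by case: (B w) => //; exact: wt_ge0.
Qed.

Lemma Pr_eq A B : A =1 B -> Pr A = Pr B.
Proof. by move=> AB; apply: eq_bigl. Qed.

Lemma Pr_predT : Pr predT = 1.
Proof.
rewrite /Pr /wt.
rewrite -(bigA_distr_bigA (fun c (b : bool) => if b then p c else 1 - p c)).
by rewrite big1 // => c _; rewrite big_bool /= addrC subrK.
Qed.

Lemma Pr_compl A : Pr (fun w => ~~ A w) = 1 - Pr A.
Proof. by rewrite -Pr_predT /Pr [in RHS](bigID A) /= addrAC subrr add0r. Qed.

Lemma Pr_le1 A : Pr A <= 1.
Proof. by rewrite -Pr_predT; exact: Pr_le. Qed.

Lemma Pr_or A B : Pr (fun w => A w || B w) <= Pr A + Pr B.
Proof.
rewrite /Pr big_mkcond [X in X + _]big_mkcond [X in _ + X]big_mkcond -big_split /=.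
by apply: ler_sum => w _; have := wt_ge0 w;
  case: (A w); case: (B w); rewrite /= ?addr0 ?add0r // => ?; rewrite lerDl.
Qed.

Lemma Pr_exists (I : finType) (Q : pred I) (A : I -> pred {ffun C -> bool}) :
  Pr (fun w => [exists i, Q i && A i w]) <= \sum_(i | Q i) Pr (A i).
Proof.
rewrite /Pr; under [leRHS]eq_bigr do rewrite big_mkcond.
rewrite exchange_big big_mkcond /=; apply: ler_sum => w _.
case: existsP => [[i /andP[Qi Ai]]|_].
  by rewrite (bigD1 i) //= Ai lerDl sumr_ge0 // => j _; case: ifP => // _; exact: wt_ge0.
by apply: sumr_ge0 => j _; case: ifP => // _; exact: wt_ge0.
Qed.

Lemma dep_sub S S' A : (forall c, S c -> S' c) -> dep S A -> dep S' A.
Proof. by move=> sub dA w w' ww'; apply: dA => c /sub; exact: ww'. Qed.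

(* Exchanging the coordinates in [S] between two independent copies preserves
   the product weight, so the pair of copies behaves like a single one. *)
Lemma Pr_indep S A B : dep S A -> dep (predC S) B ->
  Pr (fun w => A w && B w) = Pr A * Pr B.
Proof.
move=> dA dB.
pose mix (w w' : {ffun C -> bool}) := [ffun c => if S c then w c else w' c].
pose sw (u : {ffun C -> bool} * {ffun C -> bool}) := (mix u.1 u.2, mix u.2 u.1).
have swK : involutive sw.
  by case=> w w'; congr pair; apply/ffunP => c; rewrite !ffunE; case: (S c).
have A1 w w' : A (mix w w') = A w.
  by apply: dA => c Sc; rewrite ffunE Sc.
have B1 w w' : B (mix w w') = B w'.
  by apply: dB => c /negbTE Sc; rewrite ffunE Sc.
have wtsw w w' : wt (mix w w') * wt (mix w' w) = wt w * wt w'.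
  rewrite /wt -!big_split /=; apply: eq_bigr => c _; rewrite !ffunE.
  by case: (S c) => //; rewrite mulrC.
rewrite -[LHS]mulr1 -Pr_predT /Pr !big_distrlr /= !pair_big_dep /=.
rewrite [RHS](reindex_inj (inv_inj swK)) /=.
apply: eq_big => [[w w']|[w w'] _] /=; last by rewrite wtsw.
by rewrite A1 B1 andbT.
Qed.

Lemma Pr_indep_all (I : eqType) (r : seq I) (S : I -> pred C)
    (A : I -> pred {ffun C -> bool}) : uniq r ->
  (forall i, i \in r -> dep (S i) (A i)) ->
  (forall i j c, i \in r -> j \in r -> i != j -> S i c -> ~~ S j c) ->
  Pr (fun w => all (fun i => A i w) r) = \prod_(i <- r) Pr (A i).
Proof.
elim: r => [_ _ _|i r IH /= /andP[ir ur] dA disj].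
  by rewrite big_nil -Pr_predT; exact: Pr_eq.
rewrite big_cons -IH //; last 2 first.
- by move=> j jr; apply: dA; rewrite inE jr orbT.
- by move=> j l c jr lr; apply: disj; rewrite inE ?jr ?lr orbT.
rewrite (@Pr_indep (S i)) //; first by apply: dA; rewrite mem_head.
move=> w w' ww'; apply: eq_in_all => j jr.
apply: (dA j); first by rewrite inE jr orbT.
move=> c Sjc; apply: ww'; apply: contraL Sjc => Sic.
apply: (disj i) => //; rewrite ?mem_head ?inE ?jr ?orbT //.
by apply: contraNneq ir => ->.
Qed.

Lemma Pr_closed (F : {set C}) :
  Pr (fun w => [forall (c | c \in F), ~~ w c]) = \prod_(c in F) (1 - p c).
Proof.
pose G c (b : bool) : R :=
  (if (c \in F) ==> ~~ b then (if b then p c else 1 - p c) else 0).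
have -> : \prod_(c in F) (1 - p c) = \prod_c \sum_b G c b.
  rewrite big_mkcond /=; apply: eq_bigr => c _; rewrite big_bool /G /=.
  by case: (c \in F); rewrite /= ?add0r // addrC subrK.
rewrite bigA_distr_bigA /= /Pr big_mkcond /=; apply: eq_bigr => w _.
case: forallP => [wF|/forallP].
  by rewrite /wt; apply: eq_bigr => c _; rewrite /G wF.
rewrite negb_forall => /existsP[c]; rewrite negb_imply negbK => /andP[cF wc].
by rewrite (bigD1 c) //= {1}/G cF wc /= mul0r.
Qed.

(** Conditioning on the coordinates in [S] fixes the set [F w], whose own coordinates are still
    fresh. This permits exploring the main clusters before testing the bonds between them. *)
Lemma Pr_random_closed S D (F : {ffun C -> bool} -> {set C}) (beta : R) :
  dep S D ->
  (forall w w' : {ffun C -> bool}, (forall c, S c -> w c = w' c) -> F w = F w') ->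
  (forall w c, c \in F w -> ~~ S c) ->
  (forall w, D w -> \prod_(c in F w) (1 - p c) <= beta) ->
  Pr (fun w => D w && [forall (c | c \in F w), ~~ w c]) <= Pr D * beta.
Proof.
move=> dD dF FS Fb.
rewrite {1}/Pr (partition_big F predT) //= [Pr D](partition_big F predT) //=.
rewrite mulr_suml; apply: ler_sum => F0 _.
have -> : \sum_(i | D i && [forall (c | c \in F i), ~~ i c] && (F i == F0)) wt i =
    Pr (fun w => (D w && (F w == F0)) && [forall (c | c \in F0), ~~ w c]).
  apply: eq_bigl => w; case: (F w =P F0) => [->|_]; by rewrite ?andbT ?andbF.
case: (pickP (fun w => D w && (F w == F0))) => [w0 /andP[Dw0 /eqP Fw0]|D0]; last first.
  rewrite {1}/Pr !big_pred0 ?mul0r // => w; last by rewrite D0.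
rewrite (@Pr_indep S).
- apply: ler_wpM2l; first exact: Pr_ge0.
  by rewrite Pr_closed -Fw0 Fb.
- by move=> w w' ww'; rewrite (dD w w') // (dF w w').
- move=> w w' ww'; apply: eq_forallb_in => c cF0; rewrite ww' //=.
  by apply: (FS w0); rewrite Fw0.
Qed.

(** Markov's inequality for the number of events that occur. *)
Lemma Pr_markov (I : finType) (Q : pred I) (A : I -> pred {ffun C -> bool}) (t : nat) :
  t%:R * Pr (fun w => (t <= #|[set i | Q i && A i w]|)%N) <= \sum_(i | Q i) Pr (A i).
Proof.
rewrite /Pr; under [leRHS]eq_bigr do rewrite big_mkcond.
rewrite exchange_big big_distrr big_mkcond /=; apply: ler_sum => w _.
rewrite -big_mkcondr /= sumr_const.
have -> : #|[pred i | Q i & A i w]| = #|[set i | Q i && A i w]|.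
  by apply: eq_card => i; rewrite !inE.
case: ifP => tn; last by rewrite mulrn_wge0 // wt_ge0.
by rewrite -[leRHS]mulr_natl ler_wpM2r ?wt_ge0 // ler_nat.
Qed.

(** A union bound over all index sets with at least [t] elements. The crude factor [2 ^+ #|I|] is
    later cancelled by the choice of [rho]. *)
Lemma Pr_many (I : finType) (S : I -> pred C) (A : I -> pred {ffun C -> bool})
    (rho : R) (t : nat) :
  (forall i, dep (S i) (A i)) ->
  (forall i j c, i != j -> S i c -> ~~ S j c) ->
  (forall i, Pr (A i) <= rho) -> 0 <= rho <= 1 ->
  Pr (fun w => (t <= #|[set i | A i w]|)%N) <= 2 ^+ #|I| * rho ^+ t.
Proof.
move=> dA disj Arho /andP[rho0 rho1].
have -> : 2 ^+ #|I| = #|{set I}|%:R :> R by rewrite -(cardsT I) -natrX -card_powerset powersetT cardsT.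
apply: (@le_trans _ _ (\sum_(J : {set I} | (t <= #|J|)%N)
    Pr (fun w => all (fun i => A i w) (enum J)))).
  apply: le_trans (@Pr_exists _ _ _); apply: Pr_le => w tw.
  apply/existsP; exists [set i | A i w]; rewrite tw /=.
  by apply/allP => i; rewrite mem_enum inE.
apply: (@le_trans _ _ (\sum_(J : {set I} | (t <= #|J|)%N) rho ^+ t)); last first.
  rewrite sumr_const -[leLHS]mulr_natl ler_wpM2r ?exprn_ge0 // ler_nat.
  exact: max_card.
apply: ler_sum => J tJ; rewrite (@Pr_indep_all _ _ S) ?enum_uniq //; last first.
  by move=> i j c _ _; exact: disj.
apply: (@le_trans _ _ (\prod_(i <- enum J) rho)).
  by apply: ler_prod => i _; rewrite Pr_ge0 Arho.
rewrite big_const_seq count_predT -cardE iter_mulr_1.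
exact: ler_wiXn2l.
Qed.

End ProductBernoulli.

(** * Cuts of the hierarchical tree *)

Section HierarchicalCut.
Variables (R : realFieldType) (M : nat).
Hypothesis M2 : (2 <= M)%N.
Implicit Types (Q : pred nat) (i b t : nat).

(* Density of [Q] among the leaves of the tree of depth [i] whose root has index [b];
   the children of the node [b] are the nodes [b * M + j] with [j < M]. *)
Fixpoint dn Q i b : R :=
  if i is i'.+1 then (\sum_(j < M) dn Q i' (b * M + j)%N) / M%:R else (Q b)%:R.

(* The total weight of the pairs of leaves separated by [Q], a pair of leaves at
   hierarchical distance j having weight M^(1 - 2 j). *)
Fixpoint ct Q i b : R :=
  if i is i'.+1 then
    \sum_(j < M) ct Q i' (b * M + j)%N +
    (\sum_(j < M) \sum_(j' < M | j' != j)
       dn Q i' (b * M + j)%N * (1 - dn Q i' (b * M + j')%N)) / M%:R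
  else 0.

Let M0 : 0 < M%:R :> R. Proof. by rewrite ltr0n; lia. Qed.

Lemma dn_ge0 Q i b : 0 <= dn Q i b.
Proof.
elim: i b => [|i IH] b /=; first by rewrite ler0n.
by apply: divr_ge0; [apply: sumr_ge0 | exact: ltW].
Qed.

Lemma dn_predC Q i b : dn (predC Q) i b = 1 - dn Q i b.
Proof.
elim: i b => [|i IH] b /=; first by case: (Q b) => /=; rewrite ?subrr ?subr0.
under eq_bigr do rewrite IH.
rewrite sumrB sumr_const card_ord mulrBl -[1 *+ M]/(M%:R) divff ?gt_eqF //.
Qed.

Lemma dn_le1 Q i b : dn Q i b <= 1.
Proof. by rewrite -subr_ge0 -dn_predC dn_ge0. Qed.

Lemma ct_ge0 Q i b : 0 <= ct Q i b.
Proof.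
elim: i b => [|i IH] b //=; rewrite addr_ge0 ?sumr_ge0 //.
rewrite divr_ge0 ?(ltW M0) // sumr_ge0 // => j _; rewrite sumr_ge0 // => j' _.
by rewrite mulr_ge0 ?dn_ge0 // subr_ge0 dn_le1.
Qed.

Lemma ct_predC Q i b : ct (predC Q) i b = ct Q i b.
Proof.
elim: i b => [|i IH] b //=; congr (_ + _ / _); first by apply: eq_bigr => j _.
rewrite (exchange_big_dep predT) //=; apply: eq_bigr => j _.
apply: eq_big => [j'|j' _]; first by rewrite eq_sym.
by rewrite !dn_predC subKr mulrC.
Qed.

(** Some child [j0] also has density below 1, so by induction the cut inside it weighs at least
    [D j0]. The pairs between another child [j] and [j0] contribute [D j * (1 - D j0)], and together
    these are at least [D j]. Averaging over [j] gives the density of the parent. *)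
Lemma ct_ge_dn Q i b : dn Q i b < 1 -> dn Q i b <= ct Q i b.
Proof.
elim: i b => [|i IH] b /=; first by case: (Q b); rewrite ?ltxx.
set D := fun j : 'I_M => dn Q i (b * M + j)%N.
rewrite ltr_pdivrMr // mul1r => D1.
have /existsP[j0 Dj0] : [exists j, D j < 1].
  apply: contraLR D1; rewrite negb_exists => /forallP D1; rewrite -leNgt.
  rewrite -[M in M%:R]card_ord -sumr_const; apply: ler_sum => j _.
  by rewrite leNgt D1.
have ctj0 : D j0 <= ct Q i (b * M + j0)%N by exact: IH.
rewrite ler_pdivrMr // mulrDl divfK ?gt_eqF //.
have M1 : D j0 *+ M <= (\sum_(j < M) ct Q i (b * M + j)%N) * M%:R.
  rewrite mulr_natr ler_wMn2r // (bigD1 j0) //= (le_trans ctj0) // lerDl.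
  by rewrite sumr_ge0 // => j _; exact: ct_ge0.
apply: (@le_trans _ _ (\sum_(j < M) D j0 + \sum_(j < M | j != j0) D j * (1 - D j0))).
  rewrite [leLHS](bigD1 j0) //= [X in _ <= X + _](bigD1 j0) //= -addrA lerD2l.
  rewrite -big_split /=; apply: ler_sum => j _.
  have := dn_le1 Q i (b * M + j); have := dn_ge0 Q i (b * M + j0).
  by rewrite -/(D j) -/(D j0) => *; nra.
rewrite sumr_const card_ord lerD //.
rewrite (exchange_big_dep predT) //= [leRHS](bigD1 j0) //=.
rewrite [leLHS](eq_bigl (fun j => j0 != j)); last by move=> j; rewrite eq_sym.
rewrite lerDl sumr_ge0 // => j _; rewrite sumr_ge0 // => j' _.
by rewrite mulr_ge0 ?dn_ge0 // subr_ge0 dn_le1.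
Qed.

Lemma ct_ge_dnC Q i b : 0 < dn Q i b -> 1 - dn Q i b <= ct Q i b.
Proof.
by move=> D0; rewrite -dn_predC -ct_predC ct_ge_dn // dn_predC ltrBlDr ltrDl.
Qed.

(** The two sides of a cut have total density 1, so one of the two preceding bounds gives 1/2. For a
    general cut this is all that is guaranteed. *)
Lemma ct_ge_half Q i b : 0 < dn Q i b < 1 -> 2^-1 <= ct Q i b.
Proof.
by case/andP=> /ct_ge_dnC ? /ct_ge_dn ?; lra.
Qed.

Lemma dn_parent Q i b : 0 < dn Q i b < 1 -> 0 < dn Q i.+1 (b %/ M) < 1.
Proof.
case/andP => D0 D1 /=; set b' := (b %/ M)%N.
have bM : (b %% M < M)%N by rewrite ltn_pmod; lia.
have be : b = (b' * M + Ordinal bM)%N by rewrite /= -divn_eq.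
rewrite divr_gt0 //=; last first.
  rewrite (bigD1 (Ordinal bM)) //= -be ltr_wpDr // sumr_ge0 // => j _.
  exact: dn_ge0.
rewrite ltr_pdivrMr // mul1r -[M in M%:R]card_ord -sumr_const.
rewrite (bigD1 (Ordinal bM)) //= [ltRHS](bigD1 (Ordinal bM)) //=.
rewrite -be ltr_leD // ler_sum // => j _; exact: dn_le1.
Qed.

(** Each sibling of density D' contributes [D0 * (1 - D') + D' * (1 - D0)], where [D0] is the
    density at [b]. This is an average of [D0] and [1 - D0], hence at least [m]. *)
Lemma ct_parent Q i b (m : R) : 0 <= m -> m <= dn Q i b <= 1 - m ->
  ct Q i b + m / 2 <= ct Q i.+1 (b %/ M).
Proof.
move=> m0 /andP[D0 D1] /=; set b' := (b %/ M)%N.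
have bM : (b %% M < M)%N by rewrite ltn_pmod; lia.
pose j0 := Ordinal bM.
have be : b = (b' * M + j0)%N by rewrite /= -divn_eq.
set D := fun j : 'I_M => dn Q i (b' * M + j)%N.
have Dj0 : D j0 = dn Q i b by rewrite /D -be.
have D01 j : 0 <= D j <= 1 by rewrite dn_ge0 dn_le1.
rewrite lerD //.
  rewrite (bigD1 j0) //= -[(_ * _ + _ %% _)%N]be lerDl.
  by rewrite sumr_ge0 // => j _; exact: ct_ge0.
(* There are M - 1 siblings and the weight is divided by M; as M is at least 2, half of [m]
   survives. *)
have m1 : m / 2 <= \sum_(j < M | j != j0) m / M%:R.
  rewrite sumr_const cardC1 card_ord -[leRHS]mulr_natr mulrAC ler_pdivlMr //.
  have -> : M%:R = M.-1%:R + 1 :> R by rewrite natr1 prednK //; lia.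
  have : 1 <= M.-1%:R :> R by rewrite ler1n; lia.
  by nra.
apply: (le_trans m1); rewrite -mulr_suml ler_pM2r ?invr_gt0 //.
rewrite [leRHS](bigD1 j0) //= -/(D j0).
apply: (@le_trans _ _ (\sum_(j < M | j != j0) (D j0 * (1 - D j) + D j * (1 - D j0)))).
  apply: ler_sum => j _; have := D01 j; rewrite Dj0 => /andP[? ?]; nra.
rewrite big_split /= lerD //; apply: ler_sum => j jj0.
rewrite (bigD1 j0) 1?eq_sym //= -/(D j) -/(D j0) lerDl sumr_ge0 // => j' _.
by case/andP: (D01 j) (D01 j') => ? ? /andP[? ?]; rewrite mulr_ge0 // subr_ge0.
Qed.

(* Passing to the parent adds at least half of the smaller density m of [Q] and its
   complement, and a cut has weight at least 1 - m: either m drops below [s] at some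
   ancestor, or the gains add up. *)
Lemma ct_ancestor Q i b t (s : R) : 0 < dn Q i b < 1 -> 0 <= s -> 1 <= t%:R * (s / 2) ->
  1 - s <= ct Q (i + t) (b %/ M ^ t).
Proof.
move=> D01 s0 ts.
(* The minimum expresses that weight [1 - s], once reached, persists in all later ancestors. *)
suff : 0 < dn Q (i + t) (b %/ M ^ t) < 1 /\
    Num.min (1 - s) (t%:R * (s / 2)) <= ct Q (i + t) (b %/ M ^ t).
  by case=> _; rewrite ge_min => /orP[] // /(le_trans ts) /(le_trans _); apply; lra.
elim: t {ts} => [|t [D01t IH]].
  by rewrite addn0 expn0 divn1; split=> //; rewrite ge_min mul0r ct_ge0 orbT.
rewrite addnS expnSr divnMA; split; first exact: dn_parent.
set D := dn Q _ _ in D01t; set c := (b %/ M ^ t)%N.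
case/andP: (D01t) => D0 D1.
have [c1 c2] := (ct_ge_dnC D0, ct_ge_dn D1); rewrite -/D -/c in c1 c2.
have mono : ct Q (i + t) c <= ct Q (i + t).+1 (c %/ M).
  have := @ct_parent Q (i + t) c 0 (lexx 0).
  by rewrite mul0r addr0; apply; rewrite -/D; lra.
have [Ds|sD] := leP D s.
  by rewrite ge_min (le_trans _ mono) // (le_trans _ c1) // lerB.
have [Ds|Ds] := leP (1 - s) D.
  by rewrite ge_min (le_trans _ mono) // (le_trans Ds).
have sp : ct Q (i + t) c + s / 2 <= ct Q (i + t).+1 (c %/ M).
  by apply: ct_parent => //; rewrite -/D; lra.
rewrite ge_min; move: IH; rewrite ge_min => /orP[IH|IH]; apply/orP.
  by left; apply: le_trans mono.
by right; rewrite -natr1 mulrDl mul1r (le_trans _ sp) // lerD2r.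
Qed.

End HierarchicalCut.

(** * Clusters in blocks *)

Section Clusters.
Variables (M N e k : nat).
Hypothesis M2 : (2 <= M)%N.
Local Open Scope nat_scope.

Local Notation V := 'I_(M ^ N).
Local Notation config := {ffun (V * V) -> bool}.
Implicit Types (w : config) (x y z : V) (n i b : nat).

Let M_gt0 : (0 < M)%N. Proof. by lia. Qed.
Let Mn_gt0 n : (0 < M ^ n)%N. Proof. by rewrite expn_gt0 M_gt0. Qed.

(* Vertices are the numbers below M^N, and the block of level [n] of [x] has index
   [x %/ M ^ n]. *)
Definition blk n b : {set V} := [set x : V | (x %/ M ^ n == b)%N].

Lemma blk_ancestor n i x : (x %/ M ^ (n + i) = x %/ M ^ n %/ M ^ i)%N.
Proof. by rewrite expnD divnMA. Qed.

Lemma child_ancestor i b j : (j < M ^ i)%N -> ((b * M ^ i + j) %/ M ^ i = b)%N.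
Proof. by move=> ji; rewrite divnMDl // divn_small ?addn0. Qed.

Lemma leq_div_blk n x y : x %/ M ^ n = y %/ M ^ n ->
  forall n', (n <= n')%N -> x %/ M ^ n' = y %/ M ^ n'.
Proof. by move=> xy n' /subnKC <-; rewrite !blk_ancestor xy. Qed.

Lemma card_blk n b : (n <= N)%N -> (b < M ^ (N - n))%N -> #|blk n b| = (M ^ n)%N.
Proof.
move=> nN bN.
have lt (j : 'I_(M ^ n)) : (b * M ^ n + j < M ^ N)%N.
  rewrite -(subnK nN) expnD; apply: (@leq_trans (b * M ^ n + M ^ n)).
    by rewrite ltn_add2l.
  by rewrite -mulSnr leq_mul2r bN orbT.
have -> : blk n b = [set Ordinal (lt j) | j in 'I_(M ^ n)].
  apply/setP => x; rewrite inE; apply/eqP/imsetP => [xb|[j _ ->]]; last first.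
    by rewrite child_ancestor.
  have jn : (x %% M ^ n < M ^ n)%N by rewrite ltn_pmod.
  by exists (Ordinal jn) => //; apply: val_inj; rewrite /= -xb -divn_eq.
by rewrite card_imset ?card_ord // => i j [] /addnI /val_inj.
Qed.

Lemma blk_lt n x : (n <= N)%N -> (x %/ M ^ n < M ^ (N - n))%N.
Proof. by move=> nN; rewrite ltn_divLR // -expnD subnK. Qed.

Lemma child_lt n i b j : (n + i <= N)%N -> (b < M ^ (N - (n + i)))%N ->
  (j < M ^ i)%N -> (b * M ^ i + j < M ^ (N - n))%N.
Proof.
move=> nN bN ji; have -> : (N - n = N - (n + i) + i)%N by lia.
rewrite expnD; apply: (@leq_trans (b * M ^ i + M ^ i)); first by rewrite ltn_add2l.
by rewrite -mulSnr leq_mul2r bN orbT.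
Qed.

Lemma ancestor_lt n i b : (n + i <= N)%N -> (b < M ^ (N - n))%N ->
  (b %/ M ^ i < M ^ (N - (n + i)))%N.
Proof.
by move=> nN bN; rewrite ltn_divLR // -expnD; congr (_ < M ^ _)%N : bN; lia.
Qed.

Lemma sum_blk (R : nmodType) n i b (F : V -> R) :
  (\sum_(x in blk (n + i) b) F x =
   \sum_(j < M ^ i) \sum_(x in blk n (b * M ^ i + j)) F x)%R.
Proof.
have lt x : (x %/ M ^ n %% M ^ i < M ^ i)%N by rewrite ltn_pmod.
rewrite (partition_big (fun x => Ordinal (lt x)) predT) //=.
apply: eq_bigr => j _; apply: eq_bigl => x; rewrite !inE blk_ancestor.
rewrite -val_eqE /=; apply/andP/eqP => [[/eqP <- /eqP <-]|->].
  exact: divn_eq.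
by rewrite child_ancestor // modnMDl modn_small.
Qed.

(* The coordinate [(x, x)] is the state of the site [x]; for [x < y] the coordinate
   [(x, y)] is the state of the bond, and [(y, x)] is never read. *)
Definition bond_of x y : V * V := if (x < y)%N then (x, y) else (y, x).

Lemma bond_ofC x y : bond_of x y = bond_of y x.
Proof.
by rewrite /bond_of; case: (ltngtP x y) => // /val_inj ->.
Qed.

Definition adj w x y := [&& x != y, w (x, x), w (y, y) & w (bond_of x y)].

Lemma adjC w x y : adj w x y = adj w y x.
Proof. by rewrite /adj eq_sym bond_ofC; congr (_ && _); rewrite andbCA. Qed.

Definition adjn n w x y := (x %/ M ^ n == y %/ M ^ n)%N && adj w x y.

Lemma adjnC n w : symmetric (adjn n w).
Proof. by move=> x y; rewrite /adjn eq_sym adjC. Qed.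

Lemma adjn_connect_sym n w : connect_sym (adjn n w).
Proof. exact/sym_connect_sym/adjnC. Qed.

Definition cl n w x : {set V} := [set y | connect (adjn n w) x y].

Lemma cl_refl n w x : x \in cl n w x.
Proof. by rewrite inE. Qed.

Lemma cl_sym n w x y : (x \in cl n w y) = (y \in cl n w x).
Proof. by rewrite !inE adjn_connect_sym. Qed.

Lemma cl_trans n w x y z : y \in cl n w x -> z \in cl n w y -> z \in cl n w x.
Proof. by rewrite !inE; exact: connect_trans. Qed.

Lemma cl_blk n w x y : y \in cl n w x -> (y %/ M ^ n = x %/ M ^ n)%N.
Proof.
rewrite inE => /connectP[p]; elim: p x => [x _ -> //|z p IH x /=].
by case/andP => /andP[/eqP -> _] /IH; apply.
Qed.

Lemma cl_mono n n' w x : (n <= n')%N -> cl n w x \subset cl n' w x.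
Proof.
move=> nn'; apply/fintype.subsetP => y; rewrite !inE; apply: connect_sub => u v.
case/andP => /eqP uv auv; apply: connect1; rewrite /adjn auv andbT.
by apply/eqP/(leq_div_blk uv).
Qed.

Lemma cl_adj n w x y : adj w x y -> (x %/ M ^ n = y %/ M ^ n)%N -> y \in cl n w x.
Proof. by move=> xy nxy; rewrite inE connect1 // /adjn nxy eqxx. Qed.

(* Clusters with at least a fraction [1 - M^-e] of the vertices of their block;
   there is at most one of them in every block. *)
Definition big n w x := (M ^ n * M ^ e <= #|cl n w x| * M ^ e + M ^ n)%N.

Definition fine n w b := [exists x : V, (x %/ M ^ n == b)%N && big n w x].

Definition NF n w b := [forall i : 'I_k, ~~ fine (n + i) w (b %/ M ^ i)].

Definition inb n b : pred (V * V) :=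
  fun c => (c.1 %/ M ^ n == b)%N && (c.2 %/ M ^ n == b)%N.

Lemma inb_sub n i b c : inb n b c -> inb (n + i) (b %/ M ^ i) c.
Proof.
by rewrite /inb !blk_ancestor => /andP[/eqP -> /eqP ->]; rewrite eqxx.
Qed.

Lemma connect_inb n b w w' x y : (forall c, inb n b c -> w c = w' c) ->
  (x %/ M ^ n = b)%N -> connect (adjn n w) x y -> connect (adjn n w') x y.
Proof.
move=> ww' xb /connectP[p]; elim: p x xb => [x _ _ -> //|z p IH x xb /=].
case/andP => /andP[/eqP xz xzw] pz yp.
have zb : (z %/ M ^ n = b)%N by rewrite -xz.
apply: connect_trans (IH z zb pz yp); apply: connect1; move: xzw.
rewrite /adjn xz eqxx /= /adj /bond_of.
by rewrite (ww' (x, x)) ?(ww' (z, z)) ?(ww' (if _ then _ else _)) //; rewrite /inb /=;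
  try case: ifP => _; rewrite /= ?xb ?zb eqxx.
Qed.

Lemma cl_inb n b w w' x : (forall c, inb n b c -> w c = w' c) ->
  (x %/ M ^ n = b)%N -> cl n w x = cl n w' x.
Proof.
move=> ww' xb; apply/setP => y; rewrite !inE.
by apply/idP/idP; apply: connect_inb xb => // c /ww'.
Qed.

Lemma big_inb n b w w' x : (forall c, inb n b c -> w c = w' c) ->
  (x %/ M ^ n = b)%N -> big n w x = big n w' x.
Proof. by move=> ww' xb; rewrite /big (cl_inb ww' xb). Qed.

Lemma dep_fine n b : dep (inb n b) (fun w => fine n w b).
Proof.
move=> w w' ww'; apply: eq_existsb => x; case: eqP => //= xb.
exact: big_inb ww' xb.
Qed.

Lemma dep_NF n b : (0 < k)%N -> dep (inb (n + k.-1) (b %/ M ^ k.-1)) (fun w => NF n w b).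
Proof.
move=> k0 w w' ww'; apply: eq_forallb => i; congr (~~ _).
apply: dep_fine => c ci; apply: ww'.
have ik : (i <= k.-1)%N by rewrite -ltnS prednK.
have := inb_sub (k.-1 - i) ci.
by rewrite -addnA -divnMA -expnD subnKC.
Qed.

(** The two big clusters miss at most M^(n - e) and M^(n + i - e) vertices of their blocks. For i +
    2 <= e this is fewer than M^n in total, so they meet inside the smaller block. *)
Lemma big_up n i w x : (n + i <= N)%N -> (i + 2 <= e)%N -> big n w x ->
  fine (n + i) w (x %/ M ^ (n + i)) -> big (n + i) w x.
Proof.
move=> nN ie bx /existsP[y /andP[/eqP yb by_]].
have /set0Pn[z /setIP[zx zy]] : cl n w x :&: cl (n + i) w y != finset.set0.
  apply: contraTneq isT => I0.
  have := cardsUI (cl n w x) (cl (n + i) w y); rewrite I0 cards0 addn0 => U.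
  have : (#|cl n w x :|: cl (n + i) w y| <= M ^ (n + i))%N.
    rewrite -(@card_blk (n + i) (x %/ M ^ (n + i))) ?blk_lt //.
    apply/subset_leq_card/fintype.subsetP => u; rewrite finset.in_setU [_ \in blk _ _]inE => /orP[|].
      move/(fun h => fintype.subsetP (cl_mono _ _ (leq_addr i n)) u h).
      by move/cl_blk => ->.
    by move/cl_blk => ->; rewrite yb.
  rewrite U; move: bx by_; rewrite /big.
  have -> : (M ^ e = M ^ 2 * M ^ i * M ^ (e - i - 2))%N.
    by rewrite -!expnD; congr (_ ^ _)%N; lia.
  have M4 : (4 <= M ^ 2)%N by rewrite (@leq_exp2r 2 M 2).
  rewrite expnD; move: (Mn_gt0 n) (Mn_gt0 i) (Mn_gt0 (e - i - 2)).
  move: (M ^ n)%N (M ^ i)%N (M ^ (e - i - 2))%N (M ^ 2)%N M4 => A B D F F4 A0 B0 D0.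
  move: #|_| #|_| => X Y h1 h2 h3.
  have h4 : (A * (F * B * D) + A * B * (F * B * D) <= A * B * (F * B * D) + A + A * B)%N.
    apply: (@leq_trans ((Y + X) * (F * B * D) + (A + A * B))); first by rewrite mulnDl; lia.
    by rewrite -addnA leq_add2r leq_mul2r h3 orbT.
  have h5 : (A * (F * B * D) <= A + A * B)%N by lia.
  have h6 : (4 * B <= F * B * D)%N.
    by rewrite -[leqLHS]muln1 leq_mul // leq_mul2r F4 orbT.
  have : (A * (4 * B) <= A + A * B)%N by apply: leq_trans h5; rewrite leq_mul2l h6 orbT.
  by nia.
have clx : y \in cl (n + i) w x.
  apply: (@cl_trans _ _ _ z); last by rewrite cl_sym.
  exact: (fintype.subsetP (cl_mono _ _ (leq_addr i n))).
apply: (leq_trans by_); rewrite leq_add2r leq_mul2r subset_leq_card ?orbT //.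
by apply/fintype.subsetP => u; exact: cl_trans.
Qed.

(** Two disjoint big clusters would each fill at least three quarters of the block. *)
Lemma big_same n w x y : (n <= N)%N -> (2 <= e)%N -> big n w x -> big n w y ->
  (x %/ M ^ n = y %/ M ^ n)%N -> y \in cl n w x.
Proof.
move=> nN e2 bx by_ xy.
have /set0Pn[z /setIP[zx zy]] : cl n w x :&: cl n w y != finset.set0.
  apply: contraTneq isT => I0.
  have := cardsUI (cl n w x) (cl n w y); rewrite I0 cards0 addn0 => U.
  have : (#|cl n w x :|: cl n w y| <= M ^ n)%N.
    rewrite -(@card_blk n (x %/ M ^ n)) ?blk_lt //.
    apply/subset_leq_card/fintype.subsetP => u; rewrite finset.in_setU [_ \in blk _ _]inE => /orP[|].
      by move/cl_blk => ->.
    by move/cl_blk => ->; rewrite xy.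
  rewrite U; move: bx by_; rewrite /big.
  have : (4 <= M ^ e)%N.
    by apply: (@leq_trans (M ^ 2)); [rewrite (@leq_exp2r 2 M 2)|rewrite leq_exp2l].
  by move: (Mn_gt0 n); move: (M ^ n)%N (M ^ e)%N #|_| #|_| => A B X Y ? ? ? ?; nia.
by apply: (@cl_trans _ _ _ z); last by rewrite cl_sym.
Qed.

Lemma big_cl n w x y : y \in cl n w x -> big n w x -> big n w y.
Proof.
move=> yx /leq_trans; apply; rewrite leq_add2r leq_mul2r subset_leq_card ?orbT //.
apply/fintype.subsetP => z; apply: cl_trans; by rewrite cl_sym.
Qed.

(** A singleton, open or not, fills its block of level 0, because [connect] is reflexive. This is
    the start of the chain of main clusters. *)
Lemma big0 w x : (2 <= e)%N -> big 0 w x.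
Proof.
move=> e2; rewrite /big expn0 mul1n (@leq_trans (#|cl 0 w x| * M ^ e)) ?leq_addr //.
by rewrite leq_pmull // card_gt0; apply/set0Pn; exists x; exact: cl_refl.
Qed.

(* A big cluster of positive level has more than one vertex, and every vertex of a
   non-trivial cluster is open. *)
Lemma big_site n w x : (0 < n <= N)%N -> (2 <= e)%N -> big n w x -> w (x, x).
Proof.
move=> /andP[n0 nN] e2 bx.
have /set0Pn[y /setD1P[yx]] : cl n w x :\ x != finset.set0.
  apply: contraTneq bx => cl0; rewrite /big.
  have -> : cl n w x = [set x]%SET.
    apply/eqP; rewrite finset.eqEsubset finset.sub1set cl_refl andbT.
    apply/fintype.subsetP => y yx; rewrite !inE.
    have /finset.setP/(_ y) := cl0; rewrite !inE => /negbT.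
    by rewrite negb_and negbK; move: yx; rewrite inE => ->; rewrite orbF.
  rewrite cards1 mul1n -ltnNge.
  have : (4 <= M ^ e)%N.
    by apply: (@leq_trans (M ^ 2)); [rewrite (@leq_exp2r 2 M 2)|rewrite leq_exp2l].
  have : (2 <= M ^ n)%N by rewrite (leq_trans M2) // -{1}(expn1 M) leq_exp2l.
  by move: (M ^ n)%N (M ^ e)%N => A B; nia.
rewrite inE => /connectP[[|z p] /=]; first by move=> _ yx'; rewrite yx' eqxx in yx.
by case/andP => /andP[_ /and4P[]].
Qed.

End Clusters.

(** * Blocks as trees of sub-blocks *)

Section Renormalization.
Variables (M N e k : nat).
Hypothesis M2 : (2 <= M)%N.
Hypothesis k2 : (2 <= k)%N.
Hypothesis ke : (2 * k <= e)%N.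
Hypothesis e2 : (2 <= e)%N.
Local Open Scope nat_scope.

Local Notation V := 'I_(M ^ N).
Local Notation config := {ffun (V * V) -> bool}.
Implicit Types (w : config) (x y z : V) (n i b : nat).

Let k0 : 0 < k. Proof. exact: ltnW k2. Qed.
Let Mn_gt0 n : 0 < M ^ n. Proof. by rewrite expn_gt0 (ltnW M2). Qed.

(** If [x] lies in the main cluster at level [m], the absence of [NF] at [m + 1] supplies a fine
    ancestor at most [k] levels higher, and [big_up] carries [x] into its main cluster. If the main
    cluster is at a higher level, the window simply moves up by one. *)
Lemma NF_chain w x m : m + k <= N.+1 ->
  (forall m', 0 < m' <= m -> ~~ NF e k m' w (x %/ M ^ m')) ->
  [exists j : 'I_k, big e (m + j) w x].
Proof.
elim: m => [_ _|m IH mN nNF].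
  by apply/existsP; exists (Ordinal k0); rewrite big0.
have /existsP[j bj] : [exists j : 'I_k, big e (m + j) w x].
  apply: IH; first by lia.
  by move=> m' ?; apply: nNF; lia.
case: (posnP j) => [j0|j0]; last first.
  have jk : j.-1 < k by have := ltn_ord j; lia.
  apply/existsP; exists (Ordinal jk); congr (big _ _ _ _) : bj => /=; lia.
have := nNF m.+1; rewrite ltn0Sn leqnn => /(_ isT).
rewrite negb_forall => /existsP[i]; rewrite negbK -divnMA -expnD => fi.
apply/existsP; exists i; rewrite addSnnS in fi *.
by have ik := ltn_ord i; apply: big_up => //; [lia | lia | rewrite j0 addn0 in bj].
Qed.

Section Units.
Variables (U : finType) (un : V -> U) (X : {set V}) (w : config).

(** A witness that [X] is disconnected: the units are split into [Q] and the rest, [X] meets both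
    sides, and no edge joins vertices of [X] across. *)
Definition cut (Q : {set U}) :=
  [&& [exists x in X, un x \in Q], [exists x in X, un x \notin Q] &
      [forall x in X, [forall y in X,
         (un x \in Q) && (un y \notin Q) ==> ~~ adj w x y]]].

Lemma no_cut_connected n b : X \subset blk M N n b ->
  (forall x y, x \in X -> y \in X -> un x = un y -> y \in cl n w x) ->
  ~~ [exists Q, cut Q] ->
  forall x y, x \in X -> y \in X -> y \in cl n w x.
Proof.
move=> XP Xun ncut x y xX yX; apply: contraNT ncut => yx.
(* If [y] is not reached from [x], the units that meet the cluster of [x] form a cut. *)
apply/existsP; exists [set c | [exists z in X, (un z == c) && (z \in cl n w x)]]%SET.
have inQ z : z \in X ->
    (un z \in [set c | [exists z in X, (un z == c) && (z \in cl n w x)]]%SET) =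
    (z \in cl n w x).
  move=> zX; rewrite inE; apply/existsP/idP => [[z' /and3P[z'X /eqP zz' z'x]]|zx].
    by apply: cl_trans z'x _; apply: Xun.
  by exists z; rewrite zX eqxx.
apply/and3P; split.
- by apply/existsP; exists x; rewrite xX inQ // cl_refl.
- by apply/existsP; exists y; rewrite yX inQ.
- apply/forall_inP => u uX; apply/forall_inP => v vX; rewrite !inQ //.
  apply/implyP => /andP[ux vx]; apply: contra vx => uv.
  apply: cl_trans ux _; apply: cl_adj => //.
  by move: (fintype.subsetP XP _ uX) (fintype.subsetP XP _ vX); rewrite !inE => /eqP -> /eqP ->.
Qed.

Lemma connected_fine n b : n <= N -> b < M ^ (N - n) -> X \subset blk M N n b ->
  (forall x y, x \in X -> y \in X -> y \in cl n w x) ->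
  #|blk M N n b :\: X| * M ^ e <= M ^ n -> fine e n w b.
Proof.
move=> nN bN XP Xc small.
have := cardsID X (blk M N n b); rewrite card_blk // (finset.setIidPr XP) => cX.
have /set0Pn[x xX] : X != finset.set0.
  apply: contraTneq small => X0; move: cX; rewrite X0 cards0 add0n => ->.
  rewrite -ltnNge -{1}(muln1 (M ^ n)) ltn_pmul2l // -{1}(expn0 M).
  by rewrite ltn_exp2l // (leq_trans _ e2).
apply/existsP; exists x; move: (fintype.subsetP XP _ xX); rewrite inE => -> /=.
rewrite /big -{1}cX mulnDl leq_add //.
by rewrite leq_mul2r subset_leq_card ?orbT //; apply/fintype.subsetP => y; apply: Xc.
Qed.

End Units.

Definition leaf_of (h c : nat) : 'I_(M ^ h) := Ordinal (ltn_pmod c (Mn_gt0 h)).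

Section Tree.
(* A tree of depth [h] over the block [(l + h, b)] with leaves of level [l]; all
   leaves inside the block [(l + j, a)] are merged into one, which is dropped
   unless [keep] holds. *)
Variables (l h b j a : nat) (keep : bool).

Definition inA (x : nat) := x %/ M ^ (l + j) == a.

(** The merged block is represented by its first leaf [a * M ^ j]. *)
Definition unit_of (x : nat) : 'I_(M ^ h) :=
  leaf_of h (if inA x then a * M ^ j else x %/ M ^ l).

(** The union of the main clusters of the retained units, that is, the vertices that fresh edges
    have to connect. *)
Definition core w : {set V} :=
  [set x in blk M N (l + h) b | if inA x then keep && big e (l + j) w x else big e l w x]%SET.

Definition leaves_fine w := (keep ==> fine e (l + j) w a) &&
  [forall q : 'I_(M ^ h), ((b * M ^ h + q) %/ M ^ j != a) ==> fine e l w (b * M ^ h + q)].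

Hypothesis jh : j <= h.
Hypothesis ab : a %/ M ^ (h - j) = b.

Lemma inA_blk x : inA x -> x %/ M ^ (l + h) = b.
Proof. by move=> /eqP xa; rewrite -(subnKC jh) addnA blk_ancestor xa. Qed.

Lemma leaf_of_inj c c' : c %/ M ^ h = b -> c' %/ M ^ h = b ->
  leaf_of h c = leaf_of h c' -> c = c'.
Proof.
move=> cb c'b [] cc'; by rewrite (divn_eq c (M ^ h)) (divn_eq c' (M ^ h)) cb c'b cc'.
Qed.

Let aM_b : a * M ^ j %/ M ^ h = b.
Proof. by rewrite -ab -(subnKC jh) expnD divnMA mulnK // addKn. Qed.

Lemma unit_of_eq x y : x %/ M ^ (l + h) = b -> y %/ M ^ (l + h) = b ->
  unit_of x = unit_of y ->
  (inA x && inA y) || [&& ~~ inA x, ~~ inA y & x %/ M ^ l == y %/ M ^ l].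
Proof.
rewrite /unit_of !blk_ancestor => xb yb.
case: ifP => xA; case: ifP => yA //= /leaf_of_inj; last first.
- by move=> /(_ xb yb) ->.
- rewrite aM_b => /(_ xb erefl) xy; move/negP: xA; case.
  by rewrite /inA blk_ancestor xy mulnK.
- rewrite aM_b => /(_ erefl yb) xy; move/negP: yA; case.
  by rewrite /inA blk_ancestor -xy mulnK.
Qed.

(** The explored coordinates. [core] and [leaves_fine] depend on these alone, so the bonds between
    different units remain independent of them. *)
Definition unit_coord : pred (V * V) := fun c =>
  [&& c.1 %/ M ^ (l + h) == b, c.2 %/ M ^ (l + h) == b & unit_of c.1 == unit_of c.2].

Lemma unit_coordA (c : V * V) : inb (l + j) a c -> unit_coord c.
Proof.
case/andP => c1 c2; rewrite /unit_coord (inA_blk c1) (inA_blk c2) eqxx /=.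
by rewrite /unit_of /inA c1 c2.
Qed.

Lemma unit_coord_leaf q (c : V * V) : q %/ M ^ h = b -> q %/ M ^ j != a ->
  inb l q c -> unit_coord c.
Proof.
move=> qb qa /andP[/eqP c1 /eqP c2].
by rewrite /unit_coord !blk_ancestor c1 c2 qb eqxx /unit_of /inA !blk_ancestor c1 c2 !eqxx.
Qed.

Lemma core_unit w w' : (forall c, unit_coord c -> w c = w' c) -> core w = core w'.
Proof.
move=> ww'; apply/setP => x; rewrite !inE; case: eqP => //= xb.
case: ifP => xA.
  congr (_ && _); apply: (big_inb e _ (eqP xA)) => c /unit_coordA; exact: ww'.
apply: (big_inb e _ erefl) => c cx; apply: ww'; apply: unit_coord_leaf cx.
  by rewrite -blk_ancestor.
by rewrite -blk_ancestor -/(inA x) xA.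
Qed.

Lemma dep_leaves_fine : dep unit_coord leaves_fine.
Proof.
move=> w w' ww'; congr (_ && _).
  congr (_ ==> _); apply: dep_fine => c /unit_coordA; exact: ww'.
apply: eq_forallb => q; case: eqP => //= qa; apply: dep_fine => c cq; apply: ww'.
apply: unit_coord_leaf cq; last exact/eqP.
by rewrite child_ancestor.
Qed.

Definition uncovered m w : {set V} := [set x | [forall i : 'I_k, ~~ big e (m + i) w x]]%SET.

(** A vertex covered at one of the levels m, ..., m + k - 1 belongs to the main cluster of its unit
    as soon as that unit is fine. Hence [core] misses only uncovered vertices and the dropped block,
    each at most half of the allowed M^-e fraction. If [core] were connected, the block would be
    fine. *)
Lemma not_fine_cut m w : l = m + k.-1 -> j < k -> l + h <= N -> b < M ^ (N - (l + h)) ->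
  leaves_fine w -> #|blk M N (l + h) b :&: uncovered m w| * M ^ e * 2 <= M ^ (l + h) ->
  keep || (j + e + 1 <= h) ->
  ~~ fine e (l + h) w b -> [exists Q, cut unit_of (core w) w Q].
Proof.
move=> lm jk nN bN /andP[fA fl] U2 kh; apply: contraNT => ncut.
have lN : l <= N by apply: leq_trans nN; exact: leq_addr.
have ljN : l + j <= N by apply: leq_trans nN; rewrite leq_add2l.
(* The lift crosses at most 2 (k - 1) levels; this is where [2 * k <= e] is used. *)
have up i : i < k -> [/\ m + i + (l - (m + i)) = l, l - (m + i) + 2 <= e,
    m + i + (l + j - (m + i)) = l + j & l + j - (m + i) + 2 <= e].
  by move: lm jk k2 ke e2; clear; move=> ? ? ? ? ? ?; split; lia.
have coreP : core w \subset blk M N (l + h) b.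
  by apply/fintype.subsetP => x; rewrite !inE => /andP[].
have leaf_fine x : x %/ M ^ (l + h) = b -> ~~ inA x -> fine e l w (x %/ M ^ l).
  rewrite blk_ancestor => xb xA; have qh : x %/ M ^ l %% M ^ h < M ^ h by rewrite ltn_pmod.
  have /forallP/(_ (Ordinal qh)) := fl; rewrite /= -xb -divn_eq -blk_ancestor.
  by rewrite -/(inA x) xA.
apply: (@connected_fine (core w)) => //.
  apply: no_cut_connected coreP _ ncut => x y.
  rewrite ![_ \in core _]inE ![_ \in blk _ _ _ _]inE.
  move=> /andP[/eqP xb xX] /andP[/eqP yb yX] /(unit_of_eq xb yb) /orP[/andP[xA yA]|].
    rewrite xA yA in xX yX; case/andP: xX => _ xX; case/andP: yX => _ yX.
    apply: (fintype.subsetP (cl_mono _ _ (leq_add (leqnn l) jh))).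
    apply: (big_same M2 _ _ xX yX) => //.
    by rewrite (eqP xA) (eqP yA).
  case/and3P => /negbTE xA /negbTE yA /eqP xy; rewrite xA yA in xX yX.
  apply: (fintype.subsetP (cl_mono _ _ (leq_addr h l))).
  by apply: (big_same M2 _ _ xX yX xy).
have aN : a < M ^ (N - (l + j)).
  have := ltn_pmod a (Mn_gt0 (h - j)).
  have -> : N - (l + j) = N - (l + h) + (h - j) by move: nN jh; clear; lia.
  rewrite expnD => a1; rewrite (divn_eq a (M ^ (h - j))) ab.
  apply: (@leq_trans (b * M ^ (h - j) + M ^ (h - j))); first by rewrite ltn_add2l.
  by rewrite -mulSnr leq_mul2r bN orbT.
have sub : blk M N (l + h) b :\: core w \subset
    (blk M N (l + h) b :&: uncovered m w) :|: (if keep then finset.set0 else blk M N (l + j) a).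
  apply/fintype.subsetP => x; rewrite finset.in_setD [x \in core w]inE => /andP[xX xP].
  rewrite xP /= in xX; rewrite finset.in_setU finset.in_setI xP /= [x \in uncovered _ _]inE.
  case: forallP => //= /forallP; rewrite negb_forall => /existsP[i]; rewrite negbK => bi.
  rewrite inE in xP; have [up1 up2 up3 up4] := up i (ltn_ord i).
  case: ifP xX => xA; last first.
    case/negP; rewrite -{1}up1; apply: (big_up M2 _ _ bi) => //; rewrite up1 //.
    by apply: leaf_fine; [exact/eqP|rewrite xA].
  case: keep fA => /= [fA|_ _]; last by rewrite inE.
  by case/negP; rewrite -{1}up3; apply: (big_up M2 _ _ bi) => //; rewrite up3 // (eqP xA).
have A2 : #|if keep then finset.set0 else blk M N (l + j) a| * M ^ e * 2 <= M ^ (l + h).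
  case: keep kh => /= [_|jeh]; first by rewrite cards0 !mul0n.
  rewrite card_blk //.
  apply: (@leq_trans (M ^ (l + j) * M ^ e * M)); first by rewrite leq_mul2l M2 orbT.
  by rewrite -{3}(expn1 M) -!expnD leq_exp2l //; move: jeh; clear; lia.
rewrite -(leq_pmul2r (isT : 0 < 2)) [leqRHS]muln2 -addnn.
apply: leq_trans (leq_add U2 A2); rewrite -!mulnDl !leq_mul2r.
by rewrite (leq_trans (subset_leq_card sub)) ?orbT // leq_card_setU.
Qed.

End Tree.
End Renormalization.

(** * Weights of cuts between vertices *)

Section Weights.
Variables (R : realType) (M N : nat).
Hypothesis M2 : (2 <= M)%N.

Local Notation V := 'I_(M ^ N).
Local Notation config := {ffun (V * V) -> bool}.
Implicit Types (w : config) (x y : V) (X : {set V}) (Q : pred nat).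

Lemma sum_blkS (n b : nat) (F : V -> R) :
  \sum_(x in blk M N n.+1 b) F x =
  \sum_(j < M) \sum_(x in blk M N n (b * M + j)) F x.
Proof. by have := sum_blk M2 n 1 b F; rewrite addn1 expn1. Qed.

Section Cut.
Variables (J : V -> V -> R) (l : nat) (X : {set V}) (kappa Lam : R).
Hypothesis kappa0 : 0 <= kappa.
Hypothesis Lam0 : 0 <= Lam.

Let M0 : 0 < M%:R :> R. Proof. by rewrite ltr0n; lia. Qed.

Let sub_leaf i b c j : (forall c, (c %/ M ^ i.+1 = b)%N ->
    kappa * (M ^ l)%:R <= #|X :&: blk M N l c|%:R :> R) ->
  (j < M)%N -> (c %/ M ^ i = b * M + j)%N ->
  kappa * (M ^ l)%:R <= #|X :&: blk M N l c|%:R :> R.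
Proof.
move=> dens jM ci; apply: dens.
by rewrite expnSr divnMA ci divnMDl ?divn_small ?addn0 //; lia.
Qed.

Lemma mass_ge_dn Q i b :
  (forall c, (c %/ M ^ i = b)%N ->
    kappa * (M ^ l)%:R <= #|X :&: blk M N l c|%:R :> R) ->
  kappa * (M ^ (l + i))%:R * dn R M Q i b <=
  \sum_(x in blk M N (l + i) b) ((x \in X) && Q (x %/ M ^ l)%N)%:R.
Proof.
elim: i b => [|i IH] b dens.
  rewrite addn0 /=; apply: (@le_trans _ _ (#|X :&: blk M N l b|%:R * (Q b)%:R)).
    by rewrite ler_wpM2r ?ler0n // dens // expn0 divn1.
  rewrite -sum1_card natr_sum mulr_suml big_mkcond [leRHS]big_mkcond /=.
  apply: ler_sum => x _; rewrite !inE.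
  by case: eqP => [->|_]; case: (x \in X); rewrite /= ?mul1r.
rewrite addnS sum_blkS /= mulrA mulr_sumr mulr_suml; apply: ler_sum => j _.
apply: le_trans (IH _ _); last by move=> c; apply: sub_leaf dens (ltn_ord j).
rewrite -mulrA -[X in _ <= X]mulr1 le_eqVlt; apply/orP; left; apply/eqP.
by rewrite expnS natrM; field; rewrite gt_eqF.
Qed.

(** The kernel is scale invariant: the masses of two children of level l + i have product of order
    M^(2 (l + i)), and multiplied by Lam M / M^(2 (l + i + 1)) this leaves Lam / M, the factor in
    the recursion of [ct]. *)
Lemma weight_ge_ct Q i b :
  (forall c, (c %/ M ^ i = b)%N ->
    kappa * (M ^ l)%:R <= #|X :&: blk M N l c|%:R :> R) ->
  (forall i' x y, (i' < i)%N -> (x %/ M ^ (l + i') != y %/ M ^ (l + i'))%N ->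
    (x %/ M ^ (l + i'.+1) = y %/ M ^ (l + i'.+1))%N ->
    Lam * M%:R / (M ^ (2 * (l + i'.+1)))%:R <= J x y) ->
  kappa ^+ 2 * Lam * ct R M Q i b <=
  \sum_(x in blk M N (l + i) b) \sum_(y in blk M N (l + i) b)
    (if [&& x \in X, y \in X, Q (x %/ M ^ l)%N & ~~ Q (y %/ M ^ l)%N] then J x y else 0).
Proof.
elim: i b => [|i IH] b dens HJ.
  rewrite /= mulr0 addn0 big1 // => x xb; rewrite big1 // => y yb.
  by move: xb yb; rewrite !inE => /eqP -> /eqP ->; case: (Q b); rewrite ?andbF.
rewrite addnS sum_blkS.
under eq_bigr => j _ do under eq_bigr => x _ do rewrite sum_blkS.
under eq_bigr => j _ do rewrite exchange_big /=.
rewrite /= mulrDr mulr_suml !mulr_sumr -big_split /=; apply: ler_sum => j _.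
rewrite [leRHS](bigD1 j) //= lerD //.
  apply: IH; first by move=> c; apply: sub_leaf dens (ltn_ord j).
  by move=> i' x y ii'; apply: HJ; exact: leqW.
rewrite mulr_suml mulr_sumr; apply: ler_sum => j' jj'.
have mj := @mass_ge_dn Q i (b * M + j)%N (fun c => sub_leaf dens (ltn_ord j)).
have mj' := @mass_ge_dn (predC Q) i (b * M + j')%N (fun c => sub_leaf dens (ltn_ord j')).
rewrite dn_predC // in mj'.
set A := \sum_(x in _) _ in mj; set A' := \sum_(x in _) _ in mj'.
apply: (@le_trans _ _ (A * A' * (Lam * M%:R / (M ^ (2 * (l + i.+1)))%:R))).
  have -> : kappa ^+ 2 * Lam * (dn R M Q i (b * M + j) * (1 - dn R M Q i (b * M + j')) / M%:R)
    = (kappa * (M ^ (l + i))%:R * dn R M Q i (b * M + j)) *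
      (kappa * (M ^ (l + i))%:R * (1 - dn R M Q i (b * M + j'))) *
      (Lam * M%:R / (M ^ (2 * (l + i.+1)))%:R).
    rewrite addnS mulnS mul2n -addnn !expnD !natrM; field.
    by rewrite !natrX !expf_neq0 ?gt_eqF.
  have d0 := dn_ge0 R M2 Q i (b * M + j); have d1 := dn_le1 R M2 Q i (b * M + j').
  have K0 : 0 <= kappa * (M ^ (l + i))%:R by rewrite mulr_ge0.
  apply: ler_wpM2r; first by rewrite divr_ge0 // mulr_ge0 // ltW.
  by apply: ler_pM => //; rewrite mulr_ge0 // subr_ge0.
rewrite /A mulr_suml mulr_suml.
apply: ler_sum => x xj; rewrite mulr_sumr mulr_suml; apply: ler_sum => y yj'.
case xX : (x \in X) => /=; last by rewrite !mul0r.
case Qx : (Q _) => /=; last by rewrite !mul0r andbF.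
case yX : (y \in X) => /=; last by rewrite mulr0 mul0r.
case Qy : (Q _) => /=; first by rewrite mulr0 mul0r.
rewrite !mul1r HJ //.
  move: xj yj'; rewrite !inE => /eqP -> /eqP ->; rewrite eqn_add2l.
  by rewrite eq_sym.
move: xj yj'; rewrite !inE addnS !expnSr !divnMA => /eqP -> /eqP ->.
by rewrite !divnMDl ?divn_small //; lia.
Qed.

End Cut.

Section Separation.
Variable (p : V * V -> R) (J : V -> V -> R).
Hypothesis p01 : forall c, 0 <= p c <= 1.
Hypothesis pJ : forall x y, x != y -> 1 - p (bond_of x y) <= expR (- J x y).

(** Once [X w] is revealed through [S], its sites are open, so separation forces every bond between
    related pairs to be closed. The product of the closing probabilities is the exponential of minus
    the total weight. *)
Lemma Pr_sep (S : pred (V * V)) (D : pred config) (X : config -> {set V})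
    (r : rel V) (s : R) :
  dep S D -> (forall w w', (forall c, S c -> w c = w' c) -> X w = X w') ->
  (forall x y, r x y -> ~~ r y x) -> (forall x y, r x y -> ~~ S (bond_of x y)) ->
  (forall w, D w -> forall x, x \in X w -> w (x, x)) ->
  (forall w, D w -> s <= \sum_(c | [&& c.1 \in X w, c.2 \in X w & r c.1 c.2]) J c.1 c.2) ->
  Pr p (fun w => D w &&
    [forall x in X w, [forall y in X w, r x y ==> ~~ adj w x y]]) <= Pr p D * expR (- s).
Proof.
move=> dD dX rasym rS sites Js.
pose E w := [set c : V * V | [&& c.1 \in X w, c.2 \in X w & r c.1 c.2]]%SET.
pose F w := [set bond_of c.1 c.2 | c in E w]%SET.
have r_neq x y : r x y -> x != y.
  by move=> rxy; apply: contraTneq (rxy) => xy; rewrite xy in rxy *; exact: rasym.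
apply: le_trans (@Pr_random_closed _ _ _ p01 S D F _ dD _ _ _).
- apply: Pr_le => // w /andP[Dw sep]; rewrite Dw /=.
  apply/forall_inP => c /imsetP[[x y]]; rewrite inE /= => /and3P[xX yX rxy] ->.
  move/forall_inP: sep => /(_ _ xX) /forall_inP/(_ _ yX); rewrite rxy /=.
  by rewrite /adj r_neq // (sites w Dw x xX) (sites w Dw y yX).
- by move=> w w' ww'; rewrite /F /E (dX w w').
- by move=> w c /imsetP[[x y]]; rewrite inE /= => /and3P[_ _ rxy] ->; exact: rS.
(* Asymmetry of [r] makes [bond_of] injective on the related pairs, so no bond is counted twice. *)
- move=> w Dw; rewrite big_imset /=; last first.
    move=> [x y] [x' y']; rewrite !inE /= /bond_of => /and3P[_ _ rxy] /and3P[_ _ rxy'].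
    case: ifP => _; case: ifP => _ [] => xx yy; subst => //.
      by have := rasym _ _ rxy; rewrite rxy'.
    by have := rasym _ _ rxy; rewrite rxy'.
  apply: (@le_trans _ _ (\prod_(c in E w) expR (- J c.1 c.2))).
    apply: ler_prod => -[x y]; rewrite inE /= => /and3P[_ _ rxy].
    by rewrite pJ ?r_neq // andbT subr_ge0; case/andP: (p01 (bond_of x y)).
  rewrite -expR_sum ler_expR sumrN lerN2 (le_trans (Js w Dw)) //.
  by rewrite le_eqVlt; apply/orP; left; apply/eqP; apply: eq_bigl => c; rewrite inE.
Qed.

End Separation.
End Weights.

(** * Probabilities of cuts in a tree of sub-blocks *)

Section CutProbabilities.
Variables (R : realType) (M N e k : nat).
Hypothesis M2 : (2 <= M)%N.
Hypothesis k2 : (2 <= k)%N.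
Hypothesis ke : (2 * k <= e)%N.

Local Notation V := 'I_(M ^ N).
Local Notation config := {ffun (V * V) -> bool}.
Implicit Types (w : config) (x y : V).

Let e2 : (2 <= e)%N. Proof. by lia. Qed.
Let M0 : 0 < M%:R :> R. Proof. by rewrite ltr0n; lia. Qed.
Let Mn_gt0 n : (0 < M ^ n)%N. Proof. by rewrite expn_gt0; lia. Qed.

Lemma dn_gt0 (Q : pred nat) i c : Q c -> 0 < dn R M Q i (c %/ M ^ i)%N.
Proof.
move=> Qc; elim: i => [|i IH]; first by rewrite expn0 divn1 /= Qc.
rewrite expnSr divnMA /= divr_gt0 //; set c' := (c %/ M ^ i)%N in IH *.
have cM : (c' %% M < M)%N by rewrite ltn_pmod; lia.
rewrite (bigD1 (Ordinal cM)) //= -divn_eq ltr_wpDr // sumr_ge0 // => j _.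
exact: dn_ge0.
Qed.

Lemma dn_lt1 (Q : pred nat) i c : ~~ Q c -> dn R M Q i (c %/ M ^ i)%N < 1.
Proof.
by move=> Qc; rewrite -subr_gt0 -dn_predC //; apply: dn_gt0.
Qed.

(* Lower bound for the density in every leaf of the union of the main clusters; it is
   [k] levels weaker than the density of a big cluster because a leaf may have to rely
   on the main cluster of one of its first [k - 1] ancestors. *)
Definition kap : R := 1 - (M ^ (e - k))%:R^-1.

Lemma kap_ge0 : 0 <= kap.
Proof. by rewrite subr_ge0 invf_le1 ?ltr0n ?ler1n. Qed.

Lemma kap_dens (s : nat) : (s <= M ^ k)%N -> forall n c,
  (n * M ^ e <= c * M ^ e + n * s)%N -> kap * n%:R <= c%:R.
Proof.
move=> sk n c nc; rewrite /kap mulrBl mul1r lerBlDr.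
have Me : (M ^ e = M ^ (e - k) * M ^ k)%N by rewrite -expnD; congr (_ ^ _)%N; lia.
have := Mn_gt0 (e - k); rewrite -(ltr0n R) => E0.
have := Mn_gt0 k; rewrite -(ltr0n R) => K0.
rewrite -(ler_pM2r E0) mulrDl mulrAC mulVf ?gt_eqF // mul1r.
rewrite -(ler_pM2r K0) mulrDl -!mulrA -natrM -Me -!natrM -natrD ler_nat.
by apply: leq_trans nc _; rewrite leq_add2l leq_mul2l sk orbT.
Qed.

Section Tree.
Variables (l h b j a : nat).
Hypothesis l0 : (0 < l)%N.
Hypothesis lhN : (l + h <= N)%N.
Hypothesis bN : (b < M ^ (N - (l + h)))%N.
Hypothesis jk : (j < k)%N.
Hypothesis jh : (j <= h)%N.
Hypothesis ab : (a %/ M ^ (h - j) = b)%N.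
Implicit Type keep : bool.

Let lN : (l <= N)%N. Proof. by move: lhN; clear; lia. Qed.
Let ljN : (l + j <= N)%N. Proof. by move: lhN jh; clear; lia. Qed.

Lemma core_blk keep w : core e l h b j a keep w \subset blk M N (l + h) b.
Proof. by apply/fintype.subsetP => x; rewrite !inE => /andP[]. Qed.

Lemma core_site keep w x : x \in core e l h b j a keep w -> w (x, x).
Proof.
rewrite !inE => /andP[_]; case: ifP => _ => [/andP[_]|]; apply: big_site => //.
  by rewrite ljN andbT; move: l0; clear; lia.
by rewrite l0 lN.
Qed.

Lemma leaf_lt c : (c %/ M ^ h = b)%N -> (c < M ^ (N - l))%N.
Proof.
move=> cb; have -> : (N - l = N - (l + h) + h)%N by move: lhN; clear; lia.
by rewrite expnD -ltn_divLR // cb.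
Qed.

(** For a leaf inside the merged block, the main cluster of that block misses at most M^(l + j - e)
    vertices in total, hence at most a fraction M^(j - e) of the leaf. *)
Lemma core_dens keep w c : leaves_fine e l h b j a keep w -> (c %/ M ^ h = b)%N ->
  keep || (c %/ M ^ j != a)%N ->
  kap * (M ^ l)%:R <= #|core e l h b j a keep w :&: blk M N l c|%:R :> R.
Proof.
move=> /andP[fA fl] cb; have cN := leaf_lt cb.
case: (altP (c %/ M ^ j =P a)%N) => ca => [|_].
  rewrite orbF => kp; move: fA; rewrite kp /= => /existsP[x /andP[/eqP xa bx]].
  have sub : cl (l + j) w x :&: blk M N l c \subset core e l h b j a true w :&: blk M N l c.
    apply/fintype.subsetP => y; rewrite finset.in_setI => /andP[yx yc].
    rewrite finset.in_setI yc andbT; rewrite !inE in yc; have ya := cl_blk yx.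
    rewrite !inE /inA ya xa eqxx blk_ancestor (eqP yc) cb eqxx /=.
    exact: big_cl yx bx.
  apply: (@le_trans _ _ #|cl (l + j) w x :&: blk M N l c|%:R); last first.
    by rewrite ler_nat; exact: subset_leq_card sub.
  have clA : cl (l + j) w x \subset blk M N (l + j) a.
    by apply/fintype.subsetP => y /cl_blk; rewrite inE xa => ->.
  have cA : blk M N l c \subset blk M N (l + j) a.
    by apply/fintype.subsetP => y; rewrite !inE blk_ancestor => /eqP ->; rewrite ca.
  have d1 := cardsID (cl (l + j) w x) (blk M N l c).
  have d2 := cardsID (cl (l + j) w x) (blk M N (l + j) a).
  have aN : (a < M ^ (N - (l + j)))%N by rewrite -ca; apply: ancestor_lt.
  rewrite !card_blk // in d1 d2; rewrite (finset.setIidPr clA) in d2.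
  have d3 := subset_leq_card (finset.setSD (cl (l + j) w x) cA).
  move: bx; rewrite /big -{1}d2 mulnDl leq_add2l => d4.
  apply: (@kap_dens (M ^ j)); first by rewrite leq_exp2l //; exact: ltnW.
  rewrite -{1}d1 mulnDl finset.setIC leq_add2l.
  by apply: leq_trans (leq_trans d4 _); [rewrite leq_mul2r d3 orbT | rewrite expnD].
have qh : (c %% M ^ h < M ^ h)%N by rewrite ltn_pmod.
have /forallP/(_ (Ordinal qh)) := fl; rewrite /= -cb -divn_eq ca /=.
case/existsP => x /andP[/eqP xc bx].
apply: (@le_trans _ _ #|cl l w x|%:R); first by apply: (@kap_dens 1); rewrite ?muln1.
rewrite ler_nat; apply: subset_leq_card; apply/fintype.subsetP => y yx.
have yc := cl_blk yx; rewrite !inE yc xc eqxx !blk_ancestor yc xc cb eqxx /=.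
by rewrite /inA !blk_ancestor yc xc (negbTE ca) /= (big_cl yx bx).
Qed.

End Tree.

Variables (p : V * V -> R) (J : V -> V -> R) (Lam : R).
Hypothesis p01 : forall c, 0 <= p c <= 1.
Hypothesis pJ : forall x y, x != y -> 1 - p (bond_of x y) <= expR (- J x y).
Hypothesis Lam0 : 0 <= Lam.

Variables (l h : nat).
Hypothesis HJ : forall i x y, (i < h)%N -> (x %/ M ^ (l + i) != y %/ M ^ (l + i))%N ->
  (x %/ M ^ (l + i.+1) = y %/ M ^ (l + i.+1))%N ->
  Lam * M%:R / (M ^ (2 * (l + i.+1)))%:R <= J x y.
Hypothesis l0 : (0 < l)%N.
Hypothesis lhN : (l + h <= N)%N.

Lemma sumJ_ge_ct i b (X : {set V}) (Q : pred nat) : (i <= h)%N ->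
  (forall c, (c %/ M ^ i = b)%N -> kap * (M ^ l)%:R <= #|X :&: blk M N l c|%:R) ->
  kap ^+ 2 * Lam * ct R M Q i b <=
  \sum_(c | [&& c.1 \in X :&: blk M N (l + i) b, c.2 \in X :&: blk M N (l + i) b,
               Q (c.1 %/ M ^ l)%N & ~~ Q (c.2 %/ M ^ l)%N]) J c.1 c.2.
Proof.
move=> ih dens; apply: le_trans (@weight_ge_ct R M N M2 J l X kap Lam kap_ge0 Lam0 Q i b _ _) _.
- exact: dens.
- by move=> i' x y ii'; apply: HJ; exact: leq_trans ih.
rewrite pair_big_dep /= [leLHS]big_mkcond [leRHS]big_mkcond /=.
apply: ler_sum => -[x y] _; rewrite /= !finset.in_setI.
by case: (x \in X); case: (x \in blk _ _ _ _); case: (y \in X);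
  case: (y \in blk _ _ _ _); rewrite //= ?andbF //=; case: (Q _ && _).
Qed.


Lemma J_ge b x y : (x %/ M ^ (l + h) = b)%N -> (y %/ M ^ (l + h) = b)%N ->
  (x %/ M ^ l != y %/ M ^ l)%N -> Lam / (M ^ (2 * (l + h)))%:R <= J x y.
Proof.
move=> xb yb xyl.
have ex : exists i, (x %/ M ^ (l + i) == y %/ M ^ (l + i))%N.
  by exists h; rewrite xb yb.
case: (ex_minnP ex) => -[|i] /eqP xyi imin; first by rewrite addn0 in xyi; rewrite xyi eqxx in xyl.
have ih : (i < h)%N by apply: imin; rewrite xb yb.
apply: le_trans (HJ ih _ xyi); last by apply: contraTN (ltnSn i) => /imin; rewrite -leqNgt.
rewrite -mulrA ler_wpM2l // ler_pdivlMr ?ltr0n // mulrC ler_pdivrMr ?ltr0n //.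
rewrite -natrM ler_nat -{1}[(M ^ _)%N]mul1n leq_mul //; first by lia.
by rewrite leq_exp2l // leq_mul2l leq_add2l ih.
Qed.

(** The unit as a function of the leaf index: it pulls a set of units back to a set of leaves, to
    which [dn] and [ct] apply. *)
Definition unit_leaf j a c := leaf_of M2 h (if (c %/ M ^ j == a)%N then (a * M ^ j)%N else c).

Lemma unit_of_leaf j a x : unit_of M2 l h j a x = unit_leaf j a (x %/ M ^ l)%N.
Proof. by rewrite /unit_of /inA /unit_leaf blk_ancestor. Qed.

Section Tree2.
Variables (b j a : nat).
Hypothesis bN : (b < M ^ (N - (l + h)))%N.
Hypothesis jk : (j < k)%N.
Hypothesis jh : (j <= h)%N.
Hypothesis ab : (a %/ M ^ (h - j) = b)%N.
Implicit Type keep : bool.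

Let un x := unit_of M2 l h j a x.
Let X keep w := @core M N e l h b j a keep w.

(** A union bound over the sets of units, whose number depends on [h] only. The event [D] may be
    anything decided inside units, such as the failure of one leaf, and enters as a factor. *)
Lemma Pr_cut keep (D : pred config) (s : R) :
  dep (@unit_coord M N M2 l h b j a) D ->
  (forall w (Q : {set 'I_(M ^ h)}), leaves_fine e l h b j a keep w ->
    [exists x in X keep w, un x \in Q] -> [exists x in X keep w, un x \notin Q] ->
    s <= \sum_(c | [&& c.1 \in X keep w, c.2 \in X keep w &
                      (un c.1 \in Q) && (un c.2 \notin Q)]) J c.1 c.2) ->
  Pr p (fun w => [&& D w, leaves_fine e l h b j a keep w &
                  [exists Q, cut un (X keep w) w Q]]) <=
  Pr p D * 2 ^+ (M ^ h) * expR (- s).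
Proof.
move=> dD Js.
pose DQ (Q : {set 'I_(M ^ h)}) : pred config := fun w =>
  (D w && leaves_fine e l h b j a keep w) &&
  ([exists x in X keep w, un x \in Q] && [exists x in X keep w, un x \notin Q]).
pose r (Q : {set 'I_(M ^ h)}) : rel V := fun x y => (un x \in Q) && (un y \notin Q).
have bound Q : Pr p (fun w => DQ Q w &&
    [forall x in X keep w, [forall y in X keep w, r Q x y ==> ~~ adj w x y]])
    <= Pr p D * expR (- s).
  apply: le_trans (Pr_sep p01 pJ (S := unit_coord M2 l h b j a) (s := s) _ _ _ _ _ _) _.
  - move=> w w' ww'; rewrite /DQ /X (dD w w') // (core_unit e keep jh ab ww').
    by rewrite (dep_leaves_fine e keep jh ab ww').
  - by move=> w w' ww'; rewrite /X (core_unit e keep jh ab ww').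
  - by move=> x y /andP[xQ yQ]; rewrite /r negb_and xQ orbT.
  - move=> x y /andP[xQ yQ]; rewrite /unit_coord !negb_and.
    by rewrite /bond_of; case: ifP => _ /=; apply/orP; right; apply/orP; right;
      [apply: contraNneq yQ => E; rewrite /un -E | apply: contraNneq yQ => E; rewrite /un E].
  - by move=> w _ x; apply: core_site.
  - by move=> w /andP[/andP[_ fw] /andP[n1 n2]]; apply: Js.
  apply: ler_wpM2r; first exact: expR_ge0.
  by apply: Pr_le => // w /andP[/andP[]].
apply: (@le_trans _ _ (\sum_(Q : {set 'I_(M ^ h)}) Pr p D * expR (- s))); last first.
  by rewrite sumr_const -cardsT -powersetT card_powerset cardsT card_ord
    -[leLHS]mulr_natr natrX mulrAC.
apply: le_trans (ler_sum _ (fun Q _ => bound Q)).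
apply: le_trans (Pr_exists p01 _ _); apply: Pr_le => // w /and3P[Dw fw /existsP[Q]].
case/and3P => n1 n2 cQ; apply/existsP; exists Q; rewrite /DQ Dw fw n1 n2 /=.
exact: cQ.
Qed.

Let exists_leaf keep w (P : pred 'I_(M ^ h)) : [exists x in X keep w, P (un x)] ->
  exists2 c, (c %/ M ^ h = b)%N & P (unit_leaf j a c).
Proof.
case/existsP => x /andP[/(fintype.subsetP (core_blk _ _ _ _ _ _ _))].
rewrite inE blk_ancestor => /eqP xb Px; exists (x %/ M ^ l)%N => //.
by rewrite -unit_of_leaf.
Qed.

(** All leaves, including those of the merged block, have core density at least [kap], so a cut of
    units is a nontrivial cut of leaves and weighs at least one half. *)
Lemma Pr_keep (D : pred config) : dep (@unit_coord M N M2 l h b j a) D ->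
  Pr p (fun w => [&& D w, leaves_fine e l h b j a true w &
                  [exists Q, cut un (X true w) w Q]]) <=
  Pr p D * 2 ^+ (M ^ h) * expR (- (kap ^+ 2 * Lam * 2^-1)).
Proof.
move=> dD; apply: Pr_cut => // w Q fw n1 n2.
pose Qn c := unit_leaf j a c \in Q.
have [c1 c1b Q1] := @exists_leaf _ _ (fun u => u \in Q) n1.
have [c2 c2b Q2] := @exists_leaf _ _ (fun u => u \notin Q) n2.
have Dn : 0 < dn R M Qn h b < 1.
  by rewrite -{1}c1b dn_gt0 //= -c2b dn_lt1.
apply: (@le_trans _ _ (kap ^+ 2 * Lam * ct R M Qn h b)).
  by rewrite ler_wpM2l ?ct_ge_half // mulr_ge0 // sqr_ge0.
apply: le_trans (@sumJ_ge_ct h b (X true w) Qn (leqnn h) _) _.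
  by move=> c cb; apply: core_dens fw cb _.
rewrite (finset.setIidPl (core_blk _ _ _ _ _ _ _)).
rewrite le_eqVlt; apply/orP; left; apply/eqP; apply: eq_bigl => c.
by rewrite /un !unit_of_leaf.
Qed.

Lemma Pr_lost (D : pred config) : dep (@unit_coord M N M2 l h b j a) D ->
  Pr p (fun w => [&& D w, leaves_fine e l h b j a false w &
                  [exists Q, cut un (X false w) w Q]]) <=
  Pr p D * 2 ^+ (M ^ h) * expR (- (kap ^+ 2 * Lam / (M ^ (2 * h))%:R)).
Proof.
move=> dD; apply: Pr_cut => // w Q fw /existsP[x0 /andP[x0X x0Q]] /existsP[y0 /andP[y0X y0Q]].
have XE z : z \in X false w -> (z %/ M ^ (l + h) == b)%N && ((z %/ M ^ l) %/ M ^ j != a)%N.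
  by rewrite !inE /inA => /andP[->]; case: ifP => //; rewrite -blk_ancestor => ->.
have unE z : z \in X false w -> un z = leaf_of M2 h (z %/ M ^ l)%N.
  by case/XE/andP => _ /negbTE za; rewrite /un unit_of_leaf /unit_leaf za.
have uny z z' : z \in X false w -> z' \in X false w ->
    (z %/ M ^ l = z' %/ M ^ l)%N -> un z = un z'.
  by move=> zX z'X zz'; rewrite !unE // zz'.
pose B (z : V) := X false w :&: blk M N l (z %/ M ^ l)%N.
have Bk z : z \in X false w -> kap * (M ^ l)%:R <= #|B z|%:R.
  case/XE/andP => /eqP; rewrite blk_ancestor => zb za.
  by apply: core_dens fw zb _.
apply: (@le_trans _ _ (\sum_(c in finset.setX (B x0) (B y0)) Lam / (M ^ (2 * (l + h)))%:R)).
  rewrite sumr_const cardsX -[leRHS]mulr_natl natrM.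
  apply: (@le_trans _ _ (kap * (M ^ l)%:R * (kap * (M ^ l)%:R) *
     (Lam / (M ^ (2 * (l + h)))%:R))).
    rewrite le_eqVlt; apply/orP; left; apply/eqP.
    rewrite !mul2n -!addnn !expnD !natrM; field.
    by rewrite !natrX !expf_neq0 // gt_eqF.
  apply: ler_wpM2r; first by rewrite divr_ge0.
  by apply: ler_pM; rewrite ?mulr_ge0 ?kap_ge0 // Bk.
have Jge0 c : [&& c.1 \in X false w, c.2 \in X false w &
    (un c.1 \in Q) && (un c.2 \notin Q)] -> Lam / (M ^ (2 * (l + h)))%:R <= J c.1 c.2.
  case/and3P => c1 c2 /andP[q1 q2]; have /andP[/eqP b1 _] := XE _ c1.
  have /andP[/eqP b2 _] := XE _ c2; apply: J_ge b1 b2 _.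
  by apply: contraNneq q2 => /(uny _ _ c1 c2) <-.
rewrite [leLHS]big_mkcond [leRHS]big_mkcond /=; apply: ler_sum => -[x y] _.
rewrite finset.in_setX /=; case: ifP => [/andP[]|_].
  rewrite !finset.in_setI ![_ \in blk _ _ _ _]inE.
  move=> /andP[xX /eqP xx0] /andP[yX /eqP yy0].
  have cnd : [&& x \in X false w, y \in X false w & (un x \in Q) && (un y \notin Q)].
    by rewrite xX yX (uny x x0) // (uny y y0) // x0Q.
  by rewrite cnd (Jge0 (x, y)).
case: ifP => // /(Jge0 (x, y)); apply: le_trans; by rewrite divr_ge0.
Qed.

End Tree2.

(** For [j = 0] the merged block is a single leaf, so with [keep] true the tree is the plain tree of
    leaves. *)
Lemma unit_of0 h' a x : unit_of M2 l h' 0 a x = leaf_of M2 h' (x %/ M ^ l)%N.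
Proof. by rewrite /unit_of /inA addn0 expn0 muln1; case: eqP => // ->. Qed.

Lemma core0 h' b a w x : (x \in core e l h' b 0 a true w) =
  (x \in blk M N (l + h') b) && big e l w x.
Proof. by rewrite inE /inA addn0; case: ifP. Qed.

Section TwoCuts.
Variables (b bz hz t : nat) (s : R).
Hypothesis bN : (b < M ^ (N - (l + h)))%N.
Hypothesis hzt : (hz + t = h)%N.
Hypothesis bzb : (bz %/ M ^ t = b)%N.
Hypothesis s01 : 0 <= s <= 1.
Hypothesis ts : 1 <= t%:R * (s / 2).

Let a := (b * M ^ h)%N.
Let ab : (a %/ M ^ (h - 0) = b)%N. Proof. by rewrite subn0 /a mulnK. Qed.
Let X w := @core M N e l h b 0 a true w.
Let az := (bz * M ^ hz)%N.
Let Xz w := @core M N e l hz bz 0 az true w.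
Let un x := unit_of M2 l h 0 a x.
Let unz x := unit_of M2 l hz 0 az x.

Let z_sub x : (x %/ M ^ (l + hz) = bz)%N -> (x %/ M ^ (l + h) = b)%N.
Proof. by move=> xz; rewrite -hzt addnA blk_ancestor xz. Qed.

Let un_leaf x y : (x %/ M ^ (l + h) = b)%N -> (y %/ M ^ (l + h) = b)%N ->
  un x = un y -> (x %/ M ^ l = y %/ M ^ l)%N.
Proof.
by rewrite !blk_ancestor /un !unit_of0 => xb yb /(leaf_of_inj xb yb).
Qed.

Let lhzN : (l + hz <= N)%N. Proof. by move: lhN hzt; clear; lia. Qed.

Let bzN : (bz < M ^ (N - (l + hz)))%N.
Proof.
have -> : (N - (l + hz) = N - (l + h) + t)%N by move: lhN hzt; clear; lia.
by rewrite expnD -ltn_divLR // bzb.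
Qed.

Let Xz_unit w w' : (forall c, unit_coord M2 l h b 0 a c -> w c = w' c) -> Xz w = Xz w'.
Proof.
move=> ww'; apply/setP => x; rewrite !core0 ![_ \in blk _ _ _ _]inE.
case: eqP => //= xz; apply: (big_inb e _ erefl) => c /andP[/eqP c1 /eqP c2]; apply: ww'.
have xb := z_sub xz.
rewrite /unit_coord !blk_ancestor c1 c2 -blk_ancestor xb eqxx.
by rewrite /unit_of /inA addn0 c1 c2 eqxx.
Qed.

Let fz w : leaves_fine e l h b 0 a true w -> leaves_fine e l hz bz 0 az true w.
Proof.
case/andP => fa /forallP fl.
have all_fine c : (c %/ M ^ h = b)%N -> fine e l w c.
  move=> cb; have qh : (c %% M ^ h < M ^ h)%N by rewrite ltn_pmod.
  have := fl (Ordinal qh); rewrite /= -cb -divn_eq expn0 divn1.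
  by case: eqP => //= -> _; move: fa; rewrite /= addn0.
have hE : (M ^ h = M ^ hz * M ^ t)%N by rewrite -expnD hzt.
apply/andP; split; first by rewrite /= addn0 all_fine // /az hE divnMA mulnK.
apply/forallP => q; apply/implyP => _; apply: all_fine.
by rewrite hE divnMA child_ancestor // ltn_ord.
Qed.

Let cut_weight w (Q : {set 'I_(M ^ h)}) : leaves_fine e l h b 0 a true w ->
  kap ^+ 2 * Lam * ct R M (fun c => leaf_of M2 h c \in Q) h b <=
  \sum_(c | [&& c.1 \in X w, c.2 \in X w & (un c.1 \in Q) && (un c.2 \notin Q)]) J c.1 c.2.
Proof.
move=> fw; apply: le_trans (@sumJ_ge_ct h b (X w) _ (leqnn h) _) _.
  by move=> c cb; apply: core_dens fw cb _ => //; lia.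
rewrite (finset.setIidPl (core_blk _ _ _ _ _ _ _)).
by rewrite le_eqVlt; apply/orP; left; apply/eqP; apply: eq_bigl => c; rewrite /un !unit_of0.
Qed.

Let cutz_weight w (S : {set 'I_(M ^ hz)}) : leaves_fine e l h b 0 a true w ->
  kap ^+ 2 * Lam * ct R M (fun c => leaf_of M2 hz c \in S) hz bz <=
  \sum_(c | [&& c.1 \in Xz w, c.2 \in Xz w & (unz c.1 \in S) && (unz c.2 \notin S)]) J c.1 c.2.
Proof.
move=> /fz fw; have hzh : (hz <= h)%N by rewrite -hzt leq_addr.
apply: le_trans (@sumJ_ge_ct hz bz (Xz w) _ hzh _) _.
  move=> c cb; apply: core_dens fw cb _ => //; first by lia.
rewrite (finset.setIidPl (core_blk _ _ _ _ _ _ _)).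
by rewrite le_eqVlt; apply/orP; left; apply/eqP; apply: eq_bigl => c; rewrite /unz !unit_of0.
Qed.

(** If [Q] splits the small block, which lies [t] levels below the root, then [ct_ancestor] gives
    the cut [Q] alone the weight 1 - s. Otherwise [Q] separates no pair inside the small block, so
    the two cuts use disjoint bonds and their weights, at least one half each, add up. *)
Let Pr_two_cuts1 (Q : {set 'I_(M ^ h)}) (S : {set 'I_(M ^ hz)}) :
  Pr p (fun w => [&& leaves_fine e l h b 0 a true w, cut un (X w) w Q & cut unz (Xz w) w S])
  <= expR (- (kap ^+ 2 * Lam * (1 - s))).
Proof.
pose Qn c := leaf_of M2 h c \in Q; pose Sn c := leaf_of M2 hz c \in S.
pose D : pred config := fun w => leaves_fine e l h b 0 a true w &&
  [&& [exists x in X w, un x \in Q], [exists x in X w, un x \notin Q],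
      [exists x in Xz w, unz x \in S] & [exists x in Xz w, unz x \notin S]].
have nt h' b' a' w (T : {set 'I_(M ^ h')}) :
    [exists x in core e l h' b' 0 a' true w, unit_of M2 l h' 0 a' x \in T] ->
    [exists x in core e l h' b' 0 a' true w, unit_of M2 l h' 0 a' x \notin T] ->
    0 < dn R M (fun c => leaf_of M2 h' c \in T) h' b' < 1.
  case/existsP => x /andP[]; rewrite core0 inE blk_ancestor unit_of0.
  case/andP => /eqP xb _ xT /existsP[y /andP[]]; rewrite core0 inE blk_ancestor unit_of0.
  by case/andP => /eqP yb _ yT; rewrite -{1}xb dn_gt0 //= -yb dn_lt1.
have dD : dep (unit_coord M2 l h b 0 a) D.
  move=> w w' ww'; rewrite /D (dep_leaves_fine e true (leq0n h) ab ww').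
  by rewrite /X (core_unit e true (leq0n h) ab ww') (Xz_unit ww').
have dX w w' : (forall c, unit_coord M2 l h b 0 a c -> w c = w' c) -> X w = X w'.
  by move=> ww'; rewrite /X (core_unit e true (leq0n h) ab ww').
have KL : 0 <= kap ^+ 2 * Lam by rewrite mulr_ge0 // sqr_ge0.
have coord x y : un x != un y -> ~~ unit_coord M2 l h b 0 a (bond_of x y).
  rewrite /un => xy; rewrite /unit_coord !negb_and /bond_of; case: ifP => _ /=; apply/or3P; apply: Or33.
    exact: xy.
  by rewrite eq_sym; exact: xy.
have site w : D w -> forall x, x \in X w -> w (x, x) by move=> _ x; apply: core_site.
have bound (r : rel V) : (forall x y, r x y -> ~~ r y x) -> (forall x y, r x y -> un x != un y) ->
    (forall w, D w -> kap ^+ 2 * Lam * (1 - s) <=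
       \sum_(c | [&& c.1 \in X w, c.2 \in X w & r c.1 c.2]) J c.1 c.2) ->
    Pr p (fun w => D w && [forall x in X w, [forall y in X w, r x y ==> ~~ adj w x y]])
      <= expR (- (kap ^+ 2 * Lam * (1 - s))).
  move=> rasym rP Js; apply: le_trans (Pr_sep p01 pJ dD dX rasym _ site Js) _.
    by move=> x y /rP; exact: coord.
  by rewrite -[leRHS]mul1r ler_wpM2r ?expR_ge0 ?Pr_le1.
have [Dz|Dz] := boolP (0 < dn R M Qn hz bz < 1).
  pose r : rel V := fun x y => (un x \in Q) && (un y \notin Q).
  have rP x y : r x y -> un x != un y by case/andP => xQ; apply: contraNneq => <-.
  apply: le_trans (bound r _ rP _).
  - apply: Pr_le => // w /and3P[fw /and3P[n1 n2 c1] /and3P[n3 n4 _]].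
    by rewrite /D fw n1 n2 n3 n4.
  - by move=> x y /andP[xQ yQ]; rewrite /r negb_and xQ orbT.
  - move=> w /andP[fw _]; apply: le_trans (cut_weight Q fw).
    have := @ct_ancestor R M M2 Qn hz bz t s Dz; rewrite hzt bzb => cts.
    by rewrite ler_wpM2l //; apply: cts => //; case/andP: s01.
have Qz x y : (x %/ M ^ (l + hz) = bz)%N -> (y %/ M ^ (l + hz) = bz)%N ->
    (un x \in Q) && (un y \notin Q) = false.
  rewrite !blk_ancestor /un !unit_of0 => xz yz; apply: contraNF Dz => /andP[xQ yQ].
  by rewrite -{1}xz (dn_gt0 (Q := Qn)) //= -yz (dn_lt1 (Q := Qn)).
pose inz (x : V) := (x %/ M ^ (l + hz) == bz)%N.
(* Restricting the second cut to pairs inside the small block keeps the union of the two relations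
   asymmetric. *)
pose r2 : rel V := fun x y => [&& inz x, inz y, unz x \in S & unz y \notin S].
pose r : rel V := fun x y => (un x \in Q) && (un y \notin Q) || r2 x y.
have r2P x y : r2 x y -> un x != un y.
  case/and4P => /eqP xz /eqP yz xS; apply: contraNneq => /un_leaf.
  by move=> /(_ (z_sub xz) (z_sub yz)) xy; rewrite /unz unit_of0 -xy -(unit_of0 _ az).
have rP x y : r x y -> un x != un y.
  by case/orP => [/andP[xQ]|/r2P //]; apply: contraNneq => <-.
apply: le_trans (bound r _ rP _).
- apply: Pr_le => // w /and3P[fw /and3P[n1 n2 c1] /and3P[n3 n4 c2]].
  rewrite /D fw n1 n2 n3 n4 /=; apply/forall_inP => x xX; apply/forall_inP => y yX.
  apply/implyP => /orP[rxy|/and4P[xz yz xS yS]].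
    by move/forall_inP: c1 => /(_ _ xX)/forall_inP/(_ _ yX); rewrite rxy.
  have toz u : inz u -> u \in X w -> u \in Xz w.
    by move=> uz; rewrite !core0 ![_ \in blk _ _ _ _]inE -/(inz u) uz => /andP[].
  move/forall_inP: c2 => /(_ _ (toz _ xz xX))/forall_inP/(_ _ (toz _ yz yX)).
  by rewrite xS yS.
- move=> x y /orP[rxy|r2xy]; rewrite /r negb_or.
    case/andP: (rxy) => xQ yQ; rewrite negb_and xQ orbT /=; apply/negP.
    by case/and4P => /eqP yz /eqP xz _ _; rewrite Qz in rxy.
  case/and4P: r2xy => /eqP xz /eqP yz xS yS.
  by rewrite Qz //= /r2 xS !andbF.
- move=> w /andP[fw /and4P[n1 n2 n3 n4]].
  apply: (@le_trans _ _ (kap ^+ 2 * Lam * 2^-1 + kap ^+ 2 * Lam * 2^-1)).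
    rewrite -mulrDr ler_wpM2l //; case/andP: s01; lra.
  apply: le_trans (lerD (le_trans _ (cut_weight Q fw)) (le_trans _ (cutz_weight S fw))) _.
  - by rewrite ler_wpM2l // ct_ge_half //; apply: nt n1 n2.
  - by rewrite ler_wpM2l // ct_ge_half //; apply: nt n3 n4.
  rewrite [X in X + _]big_mkcond [X in _ + X]big_mkcond [leRHS]big_mkcond -big_split /=.
  rewrite le_eqVlt; apply/orP; left; apply/eqP; apply: eq_bigr => -[x y] _ /=.
  rewrite /r /r2.
  have XzE u : u \in Xz w = inz u && (u \in X w).
    rewrite !core0 ![_ \in blk _ _ _ _]inE -/(inz u).
    by case: (boolP (inz u)) => //= /eqP /z_sub ->; rewrite eqxx.
  rewrite !XzE; case xz : (inz x) => /=; last by rewrite orbF addr0.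
  case yz : (inz y) => /=; last by rewrite !andbF orbF addr0.
  by rewrite (Qz x y) ?(eqP xz) ?(eqP yz) //= !andbF add0r.
Qed.

Lemma Pr_two_cuts :
  Pr p (fun w => [&& leaves_fine e l h b 0 a true w, [exists Q, cut un (X w) w Q] &
                  [exists S, cut unz (Xz w) w S]])
  <= 2 ^+ (M ^ h) * 2 ^+ (M ^ hz) * expR (- (kap ^+ 2 * Lam * (1 - s))).
Proof.
apply: (@le_trans _ _ (\sum_(QS : {set 'I_(M ^ h)} * {set 'I_(M ^ hz)})
    expR (- (kap ^+ 2 * Lam * (1 - s))))); last first.
  rewrite sumr_const card_prod -!cardsT -!powersetT !card_powerset !cardsT !card_ord.
  by rewrite -[leLHS]mulr_natl natrM !natrX.
apply: le_trans (ler_sum _ (fun QS _ => Pr_two_cuts1 QS.1 QS.2)).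
apply: le_trans (Pr_exists p01 _ _); apply: Pr_le => // w.
case/and3P => fw /existsP[Q cQ] /existsP[S cS]; apply/existsP; exists (Q, S) => /=.
by rewrite fw cQ cS.
Qed.

End TwoCuts.
End CutProbabilities.

(** * Vertices outside all main clusters *)

Section Uncovered.
Variables (R : realType) (M N e k : nat).
Hypothesis M2 : (2 <= M)%N.
Hypothesis k2 : (2 <= k)%N.
Hypothesis ke : (2 * k <= e)%N.

Local Notation V := 'I_(M ^ N).
Local Notation config := {ffun (V * V) -> bool}.
Implicit Types (w : config) (x y : V).

Let Mn_gt0 n : (0 < M ^ n)%N. Proof. by rewrite expn_gt0 (ltnW M2). Qed.

Variables (p : V * V -> R).
Hypothesis p01 : forall c, 0 <= p c <= 1.

Variables (m h b v kk g E : nat).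
Local Notation l := (m + k.-1)%N.
Hypothesis lhN : (l + h <= N)%N.
Hypothesis bN : (b < M ^ (N - (l + h)))%N.
Hypothesis vkk : (v + kk = l + h)%N.
Hypothesis gv : (g <= v)%N.
Hypothesis gkk : (g <= kk)%N.
Hypothesis Eg : (E + 2 <= g)%N.
Hypothesis Eh : (E + 1 <= h)%N.

Variables (hb : nat -> R) (rho lam : R).
Hypothesis hbP : forall m' c, (0 < m' <= m)%N -> (c < M ^ (N - m'))%N ->
  Pr p (fun w => NF e k m' w c) <= hb m'.
Hypothesis rhoP : (M ^ g)%:R * \sum_(1 <= m' < m.+1) hb m' <= rho.
Hypothesis rho1 : rho <= 1.
Hypothesis lamP : \sum_(1 <= m' < m.+1 | (v < m' + k.-1)%N) (M ^ (l - m'))%:R * hb m' <= lam.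

(* Early failures are localised in the blocks of level [v], of which there are enough for
   a large deviation bound; late ones in the leaves of level [l], and two leaves with a
   late failure are independent. *)
Definition early w x := [exists m' : 'I_m.+1,
  [&& (0 < m')%N, (m' + k.-1 <= v)%N & NF e k m' w (x %/ M ^ m')%N]].

Definition late w x := [exists m' : 'I_m.+1,
  [&& (0 < m')%N, (v < m' + k.-1)%N & NF e k m' w (x %/ M ^ m')%N]].

Let k0 : (0 < k)%N. Proof. exact: ltnW k2. Qed.
Let lN : (l <= N)%N. Proof. by apply: leq_trans lhN; exact: leq_addr. Qed.
Let vN : (v <= N)%N. Proof. by apply: leq_trans lhN; rewrite -vkk leq_addr. Qed.
Let mN : (m <= N)%N. Proof. by apply: leq_trans lN; exact: leq_addr. Qed.

Lemma uncovered_early_late w x : x \in uncovered e k m w -> early w x || late w x.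
Proof.
rewrite inE -negb_exists; apply: contraNT => nel.
apply: NF_chain => //; first by move: ke k2; clear; lia.
  by move: lN k2; clear; lia.
move=> m' /andP[m'0 m'm]; apply: contra nel => nf.
have m'm1 : (m' < m.+1)%N by [].
case: (leqP (m' + k.-1) v) => m'v; apply/orP; [left|right];
  by apply/existsP; exists (Ordinal m'm1); rewrite /= m'0 m'v.
Qed.

Let NF_inb m' n c w w' x : (m' + k.-1 <= n)%N -> (x %/ M ^ n = c)%N ->
  (forall cc, inb n c cc -> w cc = w' cc) ->
  NF e k m' w (x %/ M ^ m')%N = NF e k m' w' (x %/ M ^ m')%N.
Proof.
move=> m'n xc ww'; apply: (dep_NF e k0) => cc cci; apply: ww'.
have := inb_sub (n - (m' + k.-1)) cci.
by rewrite -!blk_ancestor subnKC // xc.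
Qed.

Lemma dep_early c : dep (inb v c) (fun w => (M ^ (v - g) <= #|[set x | (x \in blk M N v c) && early w x]|)%N).
Proof.
move=> w w' ww'; suff -> : [set x | (x \in blk M N v c) && early w x]%SET =
    [set x | (x \in blk M N v c) && early w' x]%SET by [].
apply/setP => x; rewrite !inE; apply: andb_id2l => /eqP xc; apply: eq_existsb => m'.
by apply: andb_id2l => _; apply: andb_id2l => m'v; exact: NF_inb m'v xc ww'.
Qed.

Let hb_ge0 m' : (0 < m' <= m)%N -> 0 <= hb m'.
Proof.
move=> m'm; apply: le_trans (hbP m'm (_ : (0 < M ^ (N - m'))%N)); first exact: Pr_ge0.
exact: Mn_gt0.
Qed.

Lemma Pr_early x : Pr p (early^~ x) <= \sum_(1 <= m' < m.+1) hb m'.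
Proof.
apply: (@le_trans _ _ (\sum_(m' < m.+1 | (0 < m')%N) hb m')); last first.
  rewrite big_mkcond big_ord_recl /= add0r big_add1 /= big_mkord.
  by apply: ler_sum => i _.
apply: (@le_trans _ _ (\sum_(m' < m.+1 | (0 < m')%N) Pr p (fun w => NF e k m' w (x %/ M ^ m')%N))).
  apply: le_trans (Pr_exists p01 _ _); apply: Pr_le => // w /existsP[m' /and3P[m0 _ nf]].
  by apply/existsP; exists m'; rewrite m0.
apply: ler_sum => m' m0; apply: hbP; first by rewrite m0 -ltnS ltn_ord.
by apply: blk_lt => //; apply: leq_trans mN; rewrite -ltnS.
Qed.

Let child_v (q : 'I_(M ^ kk)) : (b * M ^ kk + q < M ^ (N - v))%N.
Proof. by apply: child_lt => //; rewrite vkk. Qed.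

(** Markov's inequality: the threshold is a fraction M^-g of the block, which accounts for the
    factor M^g in [rhoP]. *)
Lemma Pr_bad_block (q : 'I_(M ^ kk)) :
  Pr p (fun w => (M ^ (v - g) <=
    #|[set x | (x \in blk M N v (b * M ^ kk + q)) && early w x]|)%N) <= rho.
Proof.
have t0 : 0 < (M ^ (v - g))%:R :> R by rewrite ltr0n.
rewrite -(ler_pM2l t0); apply: le_trans (Pr_markov p01 _ _ _) _.
apply: le_trans (ler_sum _ (fun x _ => Pr_early x)) _.
rewrite sumr_const card_blk // ?child_v // -[leLHS]mulr_natl.
rewrite -{1}(subnK gv) expnD natrM -mulrA ler_wpM2l //.
Qed.

(** A union bound over the M^(l - m') sub-blocks of level m' in a leaf. *)
Lemma Pr_late (c : nat) : (c < M ^ (N - l))%N ->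
  Pr p (fun w => [exists x in blk M N l c, late w x]) <= lam.
Proof.
move=> cN; apply: le_trans lamP.
rewrite big_mkcond big_add1 /= big_mkord -(big_mkcond (fun m' : 'I_m => v < m'.+1 + k.-1)%N
  (fun m' : 'I_m => (M ^ (l - m'.+1))%:R * hb m'.+1)).
apply: (@le_trans _ _ (\sum_(m' < m | (v < m'.+1 + k.-1)%N)
    Pr p (fun w => [exists r : 'I_(M ^ (l - m'.+1)), NF e k m'.+1 w (c * M ^ (l - m'.+1) + r)]))).
  apply: le_trans (Pr_exists p01 _ _); apply: Pr_le => // w.
  case/existsP => x /andP[]; rewrite inE => /eqP xc /existsP[[[|m'] m'm] //= /andP[vm nf]].
  have m'm1 : (m' < m)%N by [].
  apply/existsP; exists (Ordinal m'm1); rewrite vm /=; apply/existsP.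
  have rl : (x %/ M ^ m'.+1 %% M ^ (l - m'.+1) < M ^ (l - m'.+1))%N by rewrite ltn_pmod.
  exists (Ordinal rl) => /=; congr (NF _ _ _ _ _) : nf.
  rewrite {1}(divn_eq (x %/ M ^ m'.+1) (M ^ (l - m'.+1))) -blk_ancestor subnKC ?xc //.
  by apply: (leq_trans m'm1); exact: leq_addr.
apply: ler_sum => m' _; have m'l : (m'.+1 <= l)%N.
  by apply: (leq_trans (ltn_ord m')); exact: leq_addr.
apply: (@le_trans _ _ (\sum_(r < M ^ (l - m'.+1)) hb m'.+1)); last first.
  by rewrite sumr_const card_ord -[leLHS]mulr_natl.
apply: (@le_trans _ _ (\sum_(r < M ^ (l - m'.+1)) Pr p (fun w => NF e k m'.+1 w (c * M ^ (l - m'.+1) + r)))).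
  by apply: le_trans (Pr_exists p01 _ _); apply: Pr_le => // w /existsP[r nf]; apply/existsP; exists r.
apply: ler_sum => r _; apply: hbP; first by rewrite /= ltn_ord.
by apply: child_lt => //; rewrite subnKC.
Qed.

(** Since m' <= m, the k ancestors involved in [NF] have level at most m + k - 1 = l. This is what
    fixes the level of the leaves relative to [m]. *)
Lemma dep_late c : dep (inb l c) (fun w => [exists x in blk M N l c, late w x]).
Proof.
move=> w w' ww'; apply: eq_existsb => x; rewrite inE; apply: andb_id2l => /eqP xc.
apply: eq_existsb => m'; apply: andb_id2l => _; apply: andb_id2l => _; apply: NF_inb xc ww'.
by rewrite leq_add2r -ltnS ltn_ord.
Qed.

Let inb_disj n c c' (cc : V * V) : c != c' -> inb n c cc -> ~~ inb n c' cc.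
Proof.
move=> cc' /andP[/eqP c1 _]; apply: contra cc' => /andP[/eqP c2 _].
by rewrite -c1 -c2.
Qed.

Lemma Pr_late_pair :
  Pr p (fun w => [exists q : 'I_(M ^ h) * 'I_(M ^ h), [&& q.1 != q.2,
     [exists x in blk M N l (b * M ^ h + q.1), late w x] &
     [exists x in blk M N l (b * M ^ h + q.2), late w x]]])
  <= (M ^ (2 * h))%:R * lam ^+ 2.
Proof.
have qN (q : 'I_(M ^ h)) : (b * M ^ h + q < M ^ (N - l))%N by apply: child_lt.
apply: (@le_trans _ _ (\sum_(q : 'I_(M ^ h) * 'I_(M ^ h)) lam ^+ 2)); last first.
  by rewrite sumr_const card_prod !card_ord -[leLHS]mulr_natl mul2n -addnn expnD.
rewrite [leRHS](bigID (fun q => q.1 != q.2)) /= -[leLHS]addr0 lerD //; last first.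
  by rewrite sumr_ge0 // => q _; exact: sqr_ge0.
apply: le_trans (Pr_exists p01 _ _) _; apply: ler_sum => -[q1 q2] /= q12.
rewrite (@Pr_indep _ _ _ (inb l (b * M ^ h + q1))).
- rewrite expr2; apply: ler_pM; rewrite ?Pr_ge0 //; apply: Pr_late; exact: qN.
- exact: dep_late.
- apply: dep_sub (@dep_late _) => c; apply: inb_disj.
  by rewrite eqn_add2l eq_sym.
Qed.

(** Outside the two exceptional events, fewer than M^(kk - g) blocks of level [v] contain many early
    vertices, and all late vertices lie in one leaf, which is a fraction M^-h of the block. *)
Lemma Pr_uncovered :
  Pr p (fun w => ~~ (#|blk M N (l + h) b :&: uncovered e k m w| * M ^ E <= M ^ (l + h))%N)
  <= 2 ^+ (M ^ kk) * rho ^+ (M ^ (kk - g)) + (M ^ (2 * h))%:R * lam ^+ 2.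
Proof.
have rho0 : 0 <= rho.
  apply: le_trans rhoP; rewrite mulr_ge0 // big_nat sumr_ge0 // => i; exact: hb_ge0.
pose T q w := [set x | (x \in blk M N v (b * M ^ kk + q)) && early w x]%SET.
pose Bad w := [set q : 'I_(M ^ kk) | (M ^ (v - g) <= #|T q w|)%N]%SET.
pose Lt w (q : nat) := [exists x in blk M N l (b * M ^ h + q), late w x].
apply: (@le_trans _ _ (Pr p (fun w => (M ^ (kk - g) <= #|Bad w|)%N) +
   Pr p (fun w => [exists q : 'I_(M ^ h) * 'I_(M ^ h), [&& q.1 != q.2, Lt w q.1 & Lt w q.2]]))); last first.
  apply: lerD; last exact: Pr_late_pair.
  have := @Pr_many _ _ _ p01 _ (fun q : 'I_(M ^ kk) => inb v (b * M ^ kk + q))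
    (fun q w => (M ^ (v - g) <= #|T q w|)%N) rho (M ^ (kk - g)).
  rewrite card_ord; apply.
  - by move=> q; exact: dep_early.
  - by move=> i j c ij; apply: inb_disj; rewrite eqn_add2l.
  - by move=> q; exact: Pr_bad_block.
  - by rewrite rho0.
apply: le_trans (Pr_or p01 _ _); apply: Pr_le => // w; apply: contraNT.
rewrite negb_or -ltnNge => /andP[fewbad nopair].
have cover : blk M N (l + h) b :&: uncovered e k m w \subset
   [set x | (x \in blk M N (l + h) b) && early w x]%SET :|:
   [set x | (x \in blk M N (l + h) b) && late w x]%SET.
  apply/fintype.subsetP => x /finset.setIP[xb /uncovered_early_late xu].
  by move: xb; rewrite finset.in_setU !inE => ->.
have cearly : (#|[set x | (x \in blk M N (l + h) b) && early w x]%SET| <= 2 * M ^ (l + h - g))%N.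
  have -> : #|[set x | (x \in blk M N (l + h) b) && early w x]%SET| =
      \sum_(q < M ^ kk) #|T q w|.
    have cE n c : #|[set x | (x \in blk M N n c) && early w x]%SET| =
        (\sum_(x in blk M N n c) (early w x : nat))%R.
      rewrite -sum1_card big_mkcond [RHS]big_mkcond /=; apply: eq_bigr => x _.
      by rewrite inE; case: (x \in blk _ _ _ _); case: (early w x).
    by rewrite cE -vkk sum_blk //; apply: eq_bigr => q _; rewrite /T cE.
  (* A bad block is counted with all its vertices, any other block with at most M^(v - g) of
     them. *)
  apply: (@leq_trans (\sum_(q < M ^ kk) ((q \in Bad w) * M ^ v + M ^ (v - g)))).
    apply: leq_sum => q _; rewrite inE; case: (leqP (M ^ (v - g)) #|T q w|) => /= [_|/ltnW]; last first.
      by rewrite mul0n add0n.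
    rewrite mul1n (@leq_trans (M ^ v)) ?leq_addr // -(@card_blk M N M2 v (b * M ^ kk + q)) ?child_v //.
    by apply/subset_leq_card/fintype.subsetP => x; rewrite ![_ \in finset.finset _]inE => /andP[].
  rewrite big_split /= sum_nat_const card_ord -big_distrl /= -big_mkcond /= sum1_card.
  rewrite -vkk mul2n -addnn leq_add //.
    rewrite [(v + kk - g)%N](_ : _ = kk - g + v)%N; last by move: gkk; clear; lia.
    by rewrite expnD leq_mul2r ltnW ?orbT.
  by rewrite -expnD leq_exp2l //; move: gv; clear; lia.
have clate : (#|[set x | (x \in blk M N (l + h) b) && late w x]%SET| <= M ^ l)%N.
  case: (finset.set_0Vmem [set x | (x \in blk M N (l + h) b) && late w x]%SET) => [->|[x0]].
    by rewrite cards0.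
  rewrite inE inE => /andP[/eqP x0b x0l].
  rewrite -(@card_blk M N M2 l (x0 %/ M ^ l)) ?blk_lt //.
  apply/subset_leq_card/fintype.subsetP => x; rewrite inE inE => /andP[/eqP xb xl].
  (* A late vertex outside the leaf of [x0] would produce a pair of leaves with late failures. *)
  rewrite inE; apply: contraNT nopair => xx0.
  have qh (y : V) : (y %/ M ^ l %% M ^ h < M ^ h)%N by rewrite ltn_pmod.
  have qE (y : V) : (y %/ M ^ (l + h) = b)%N -> (y %/ M ^ l = b * M ^ h + Ordinal (qh y))%N.
    by rewrite blk_ancestor => <-; rewrite -divn_eq.
  apply/existsP; exists (Ordinal (qh x), Ordinal (qh x0)) => /=; apply/and3P; split.
  - by apply: contra xx0 => /eqP[] xx0; rewrite (qE x) // (qE x0) //= xx0.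
  - by rewrite /Lt; apply/existsP; exists x; rewrite xl andbT inE; apply/eqP/qE.
  - by rewrite /Lt; apply/existsP; exists x0; rewrite x0l andbT inE; apply/eqP/qE.
have := leq_trans (subset_leq_card cover) (leq_trans (leq_card_setU _ _) (leq_add cearly clate)).
move=> cU; apply: (@leq_trans ((2 * M ^ (l + h - g) + M ^ l) * M ^ E)); first by rewrite leq_mul2r cU orbT.
rewrite mulnDl -mulnA -!expnD.
have h1 : (2 * M ^ (l + h - g + E) <= M ^ (l + h).-1)%N.
  apply: (@leq_trans (M ^ 1 * M ^ (l + h - g + E))); first by rewrite leq_mul2r M2 orbT.
  by rewrite -expnD leq_exp2l //; move: Eg gv vkk; clear; lia.
have h2 : (M ^ (l + E) <= M ^ (l + h).-1)%N by rewrite leq_exp2l //; move: Eh; clear; lia.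
apply: leq_trans (leq_add h1 h2) _; rewrite addnn -mul2n.
apply: (@leq_trans (M ^ 1 * M ^ (l + h).-1)); first by rewrite leq_mul2r M2 orbT.
by rewrite -expnD leq_exp2l //; move: Eh; clear; lia.
Qed.

End Uncovered.

(** * The recursive inequalities *)

Section OneStep.
Variables (R : realType) (M N e k : nat).
Hypothesis M2 : (2 <= M)%N.
Hypothesis k2 : (2 <= k)%N.
Hypothesis ke : (2 * k <= e)%N.

Local Notation V := 'I_(M ^ N).
Local Notation config := {ffun (V * V) -> bool}.
Implicit Types (w : config) (x y : V).

Let Mn_gt0 n : (0 < M ^ n)%N. Proof. by rewrite expn_gt0 (ltnW M2). Qed.
Let k0 : (0 < k)%N. Proof. exact: ltnW k2. Qed.
Let e2 : (2 <= e)%N. Proof. by move: k2 ke; clear; lia. Qed.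

Variables (p : V * V -> R) (J : V -> V -> R) (Lam : R).
Hypothesis p01 : forall c, 0 <= p c <= 1.
Hypothesis pJ : forall x y, x != y -> 1 - p (bond_of x y) <= expR (- J x y).
Hypothesis Lam0 : 0 <= Lam.

Variables (m h E b : nat).
Local Notation l := (m + k.-1)%N.
Hypothesis HJ : forall i x y, (i < h)%N -> (x %/ M ^ (l + i) != y %/ M ^ (l + i))%N ->
  (x %/ M ^ (l + i.+1) = y %/ M ^ (l + i.+1))%N ->
  Lam * M%:R / (M ^ (2 * (l + i.+1)))%:R <= J x y.
Hypothesis lhN : (l + h <= N)%N.
Hypothesis bN : (b < M ^ (N - (l + h)))%N.
Hypothesis Ee : (e + k <= E)%N.
Hypothesis he : (e + k <= h)%N.

Variables (Ub F H : R).
Hypothesis UbP : Pr p (fun w =>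
  ~~ (#|blk M N (l + h) b :&: uncovered e k m w| * M ^ E <= M ^ (l + h))%N) <= Ub.
Hypothesis FP : forall c, (c < M ^ (N - l))%N -> Pr p (fun w => ~~ fine e l w c) <= F.
Hypothesis HP : forall c, (c < M ^ (N - l))%N -> Pr p (fun w => NF e k l w c) <= H.

Let l0 : (0 < l)%N. Proof. by move: k2; clear; lia. Qed.
Let kh : (k <= h)%N. Proof. by apply: leq_trans he; exact: leq_addl. Qed.

Local Notation K := (kap R M e k).
Local Notation lf q := (b * M ^ h + q)%N.

Let lfN (q : 'I_(M ^ h)) : (lf q < M ^ (N - l))%N.
Proof. by apply: child_lt. Qed.

Let lfb (q : 'I_(M ^ h)) : (lf q %/ M ^ h = b)%N.
Proof. by apply: child_ancestor. Qed.

Let lfj (q : 'I_(M ^ h)) j : (j <= h)%N -> (lf q %/ M ^ j %/ M ^ (h - j) = b)%N.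
Proof. by move=> jh; rewrite -divnMA -expnD subnKC. Qed.

Let bj : (b * M ^ h %/ M ^ (h - 0) = b)%N.
Proof. by rewrite subn0 mulnK. Qed.

Let F0 : 0 <= F.
Proof.
by apply: le_trans (FP (_ : (0 < M ^ (N - l))%N)); rewrite ?Mn_gt0 // Pr_ge0.
Qed.

Let H0 : 0 <= H.
Proof.
by apply: le_trans (HP (_ : (0 < M ^ (N - l))%N)); rewrite ?Mn_gt0 // Pr_ge0.
Qed.

Let Usmall w := (#|blk M N (l + h) b :&: uncovered e k m w| * M ^ E <= M ^ (l + h))%N.

Let two_bad w := [exists q : 'I_(M ^ h) * 'I_(M ^ h),
  (q.1 != q.2) && (~~ fine e l w (lf q.1) && ~~ fine e l w (lf q.2))].

Let cutA w j a keep := [exists Q, cut (unit_of M2 l h j a) (@core M N e l h b j a keep w) w Q].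

Let Usmall2 w : Usmall w ->
  (#|blk M N (l + h) b :&: uncovered e k m w| * M ^ e * 2 <= M ^ (l + h))%N.
Proof.
apply: leq_trans; rewrite -mulnA leq_mul2l; apply/orP; right.
apply: (@leq_trans (M ^ e * M ^ 1)); first by rewrite leq_mul2l M2 orbT.
by rewrite -expnD leq_exp2l //; move: Ee k2; clear; lia.
Qed.

Let Pr_two_bad : Pr p two_bad <= (M ^ (2 * h))%:R * F ^+ 2.
Proof.
apply: (@le_trans _ _ (\sum_(q : 'I_(M ^ h) * 'I_(M ^ h)) F ^+ 2)); last first.
  by rewrite sumr_const card_prod !card_ord -[leLHS]mulr_natl mul2n -addnn expnD.
rewrite [leRHS](bigID (fun q => q.1 != q.2)) /= -[leLHS]addr0 lerD //; last first.
  by rewrite sumr_ge0 // => q _; exact: sqr_ge0.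
apply: le_trans (Pr_exists p01 _ _) _; apply: ler_sum => -[q1 q2] /= q12.
rewrite (@Pr_indep _ _ _ (inb l (lf q1))).
- by rewrite expr2; apply: ler_pM; rewrite ?Pr_ge0 //; apply: FP; exact: lfN.
- by move=> w w' ww'; congr (~~ _); exact: dep_fine.
- move=> w w' ww'; congr (~~ _); apply: dep_fine => c cq; apply: ww'.
  apply: contra q12 => /andP[/eqP c1 _]; move/andP: cq; rewrite c1 => -[/eqP + _].
  by move/addnI/val_inj ->.
Qed.

Let not_two w (q : 'I_(M ^ h)) : ~~ two_bad w -> ~~ fine e l w (lf q) ->
  forall q' : 'I_(M ^ h), q' != q -> fine e l w (lf q').
Proof.
move=> ntwo qbad q' q'q; apply: contraNT ntwo => q'bad.
by apply/existsP; exists (q, q'); rewrite /= eq_sym q'q qbad.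
Qed.

Let others_fine w (q : 'I_(M ^ h)) j (keep : bool) : (forall q' : 'I_(M ^ h), q' != q -> fine e l w (lf q')) ->
  (keep -> fine e (l + j) w (lf q %/ M ^ j)%N) ->
  leaves_fine e l h b j (lf q %/ M ^ j)%N keep w.
Proof.
move=> oth fA; apply/andP; split; first exact/implyP.
apply/forallP => q'; apply/implyP => q'A; apply: oth.
by apply: contraNneq q'A => ->.
Qed.

Let dep_A j a (D : pred config) : (j <= h)%N -> (a %/ M ^ (h - j) = b)%N ->
  dep (inb (l + j) a) D -> dep (unit_coord M2 l h b j a) D.
Proof. by move=> jh ab; apply: dep_sub => c; exact: unit_coordA. Qed.

Let B_ge0 (n : nat) (x : R) : 0 <= 2 ^+ n * expR x.
Proof. by rewrite mulr_ge0 ?exprn_ge0 ?expR_ge0. Qed.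

(* Two leaves without main cluster, one such leaf together with a cut between the others,
   or a cut through main clusters in all leaves. *)
Lemma Pr_not_fine_step :
  Pr p (fun w => ~~ fine e (l + h) w b) <=
  Ub + (M ^ (2 * h))%:R * F ^+ 2 +
  (M ^ h)%:R * (F * (2 ^+ (M ^ h) * expR (- (K ^+ 2 * Lam / (M ^ (2 * h))%:R)))) +
  2 ^+ (M ^ h) * expR (- (K ^+ 2 * Lam * 2^-1)).
Proof.
pose one (q : 'I_(M ^ h)) w := [&& ~~ fine e l w (lf q),
   leaves_fine e l h b 0 (lf q) false w & cutA w 0 (lf q) false].
pose none w := [&& true, leaves_fine e l h b 0 (b * M ^ h) true w & cutA w 0 (b * M ^ h) true].
apply: (@le_trans _ _ (Pr p (fun w => ~~ Usmall w || two_bad w || [exists q, one q w] || none w))).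
  apply: Pr_le => // w nf; case: (boolP (Usmall w)) => //= Us.
  case: (boolP (two_bad w)) => //= ntwo.
  case: (boolP [exists q : 'I_(M ^ h), ~~ fine e l w (lf q)]) => [/existsP[q qbad]|allf].
    apply/orP; left; apply/existsP; exists q; rewrite /one qbad /=.
    have fl : leaves_fine e l h b 0 (lf q) false w.
      by have := @others_fine w q 0 false (not_two ntwo qbad); rewrite expn0 divn1; apply.
    rewrite fl /=; apply: (not_fine_cut M2 k2 ke e2 _ _ (erefl l) k0 lhN bN fl (Usmall2 Us) _ nf) => //.
    - by rewrite subn0.
    - by rewrite /= add0n; move: he k2; clear; lia.
  apply/orP; right; rewrite /none /=; rewrite negb_exists in allf.
  have fl : leaves_fine e l h b 0 (b * M ^ h) true w.
    apply/andP; split.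
      have /forallP/(_ (Ordinal (Mn_gt0 h))) := allf; rewrite negbK /= !addn0.
      by [].
    by apply/forallP => q; apply/implyP => _; have := forallP allf q; rewrite negbK.
  by rewrite fl /=; apply: (not_fine_cut M2 k2 ke e2 _ _ (erefl l) k0 lhN bN fl (Usmall2 Us) _ nf).
apply: le_trans (Pr_or p01 _ _) _; apply: lerD; last first.
  have := @Pr_keep R M N e k M2 k2 ke p J Lam p01 pJ Lam0 l h HJ l0 lhN b 0 (b * M ^ h) bN k0
    (leq0n h) bj predT (fun w w' _ => erefl).
  by rewrite Pr_predT mul1r.
apply: le_trans (Pr_or p01 _ _) _; apply: lerD; last first.
  apply: (@le_trans _ _ (\sum_(q < M ^ h) F * (2 ^+ (M ^ h) * expR (- (K ^+ 2 * Lam / (M ^ (2 * h))%:R))))); last first.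
    by rewrite sumr_const card_ord -[leLHS]mulr_natl.
  apply: (@le_trans _ _ (\sum_(q < M ^ h) Pr p (one q))).
    by apply: le_trans (Pr_exists p01 _ _); apply: Pr_le => // w /existsP[q oq]; apply/existsP; exists q.
  apply: ler_sum => q _.
  have ab : (lf q %/ M ^ (h - 0) = b)%N by rewrite subn0.
  apply: le_trans (@Pr_lost R M N e k M2 k2 ke p J Lam p01 pJ Lam0 l h HJ l0 lhN b 0 (lf q) bN k0
    (leq0n h) ab (fun w => ~~ fine e l w (lf q)) _) _.
    apply: dep_A => //; move=> w w' ww'; congr (~~ _); rewrite addn0 in ww'; exact: dep_fine.
  by rewrite -mulrA ler_wpM2r // FP.
by apply: le_trans (Pr_or p01 _ _) _; apply: lerD.
Qed.

(* If exactly one leaf [q] has no main cluster, then either [NF] holds at [q] and the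
   complement of its [k - 1]st ancestor is cut, or a fine ancestor of [q] replaces it as
   a leaf and the resulting tree is cut.  If all leaves have main clusters, both the block
   and its [k - 1]st ancestor are cut. *)
Lemma Pr_NF_step hz bz (s : R) : (hz + k.-1 = h)%N -> (bz %/ M ^ k.-1 = b)%N ->
  0 <= s <= 1 -> 1 <= (k.-1)%:R * (s / 2) ->
  Pr p (fun w => NF e k (l + hz) w bz) <=
  Ub + (M ^ (2 * h))%:R * F ^+ 2 +
  (M ^ h)%:R * (H * (2 ^+ (M ^ h) * expR (- (K ^+ 2 * Lam / (M ^ (2 * h))%:R)))) +
  (M ^ h)%:R * (k%:R * (F * (2 ^+ (M ^ h) * expR (- (K ^+ 2 * Lam * 2^-1))))) +
  2 ^+ (M ^ h) * 2 ^+ (M ^ hz) * expR (- (K ^+ 2 * Lam * (1 - s))).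
Proof.
move=> hzh bzb s01 ts.
pose Aj (q : 'I_(M ^ h)) j := (lf q %/ M ^ j)%N.
pose lost (q : 'I_(M ^ h)) w := [&& NF e k l w (lf q),
   leaves_fine e l h b k.-1 (Aj q k.-1) false w & cutA w k.-1 (Aj q k.-1) false].
pose kept (q : 'I_(M ^ h)) (i : 'I_k) w := [&& ~~ fine e l w (lf q),
   leaves_fine e l h b i (Aj q i) true w & cutA w i (Aj q i) true].
pose none w := [&& leaves_fine e l h b 0 (b * M ^ h) true w, cutA w 0 (b * M ^ h) true &
  [exists S, cut (unit_of M2 l hz 0 (bz * M ^ hz)) (@core M N e l hz bz 0 (bz * M ^ hz) true w) w S]].
have kk : (k.-1 < k)%N by rewrite prednK.
have k1h : (k.-1 <= h)%N by apply: leq_trans kh; exact: leq_pred.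
apply: (@le_trans _ _ (Pr p (fun w => ~~ Usmall w || two_bad w || [exists q, lost q w] ||
    [exists q, [exists i, kept q i w]] || none w))).
  apply: Pr_le => // w /forallP nf.
  have nfz : ~~ fine e (l + hz) w bz by have := nf (Ordinal k0); rewrite /= addn0 expn0 divn1.
  have nfP : ~~ fine e (l + h) w b.
    by have := nf (Ordinal kk); rewrite /= -(addnA l) hzh bzb.
  case: (boolP (Usmall w)) => //= Us; case: (boolP (two_bad w)) => //= ntwo.
  case: (boolP [exists q : 'I_(M ^ h), ~~ fine e l w (lf q)]) => [/existsP[q qbad]|allf].
    apply/orP; left; have oth := not_two ntwo qbad.
    case: (boolP (NF e k l w (lf q))) => [nfq|].
      apply/orP; left; apply/existsP; exists q; rewrite /lost nfq /=.
      have fl : leaves_fine e l h b k.-1 (Aj q k.-1) false w by exact: others_fine.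
      rewrite fl /=; apply: (not_fine_cut M2 k2 ke e2 _ _ (erefl l) kk lhN bN fl (Usmall2 Us) _ nfP) => //.
      - exact: lfj.
      - by rewrite /=; move: he k2; clear; lia.
    rewrite /NF negb_forall => /existsP[i]; rewrite negbK => fi.
    apply/orP; right; apply/existsP; exists q; apply/existsP; exists i; rewrite /kept qbad /=.
    have ih : (i <= h)%N by apply: leq_trans kh; exact: ltnW.
    have fl : leaves_fine e l h b i (Aj q i) true w by exact: others_fine.
    by rewrite fl /=; apply: (not_fine_cut M2 k2 ke e2 _ _ (erefl l) (ltn_ord i) lhN bN fl (Usmall2 Us) _ nfP) => //; exact: lfj.
  apply/orP; right; rewrite /none /=; rewrite negb_exists in allf.
  have fall c : (c %/ M ^ h = b)%N -> fine e l w c.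
    move=> cb; have qh : (c %% M ^ h < M ^ h)%N by rewrite ltn_pmod.
    by have /forallP/(_ (Ordinal qh)) := allf; rewrite negbK /= -cb -divn_eq.
  have fl : leaves_fine e l h b 0 (b * M ^ h) true w.
    apply/andP; split; first by rewrite /= addn0 fall // mulnK.
    by apply/forallP => q; apply/implyP => _; apply: fall.
  have hE : (M ^ h = M ^ hz * M ^ k.-1)%N by rewrite -expnD hzh.
  have flz : leaves_fine e l hz bz 0 (bz * M ^ hz) true w.
    apply/andP; split; first by rewrite /= addn0 fall // hE divnMA mulnK.
    apply/forallP => q; apply/implyP => _; apply: fall.
    by rewrite hE divnMA child_ancestor.
  rewrite fl /=; apply/andP; split.
    by apply: (not_fine_cut M2 k2 ke e2 _ _ (erefl l) k0 lhN bN fl (Usmall2 Us) _ nfP).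
  apply: (not_fine_cut M2 k2 ke e2 _ _ (erefl l) k0 _ _ flz _ _ nfz) => //.
  - by rewrite subn0 mulnK.
  - by apply: leq_trans lhN; rewrite leq_add2l -hzh leq_addr.
  - have -> : (N - (l + hz) = N - (l + h) + k.-1)%N by move: lhN hzh; clear; lia.
    by rewrite expnD -ltn_divLR // bzb.
  (* The uncovered vertices could all lie in the small block, where their density is M^(k - 1) times
     larger; [E >= e + k] leaves room for this. *)
  - rewrite -(leq_pmul2r (Mn_gt0 k.-1)) -[leqRHS]expnD -(addnA l) hzh; apply: leq_trans Us.
    rewrite -!mulnA; apply: leq_mul.
      apply/subset_leq_card/finset.setSI/fintype.subsetP => x; rewrite !inE.
      by move=> /eqP xz; rewrite -hzh addnA blk_ancestor xz bzb.
    apply: (@leq_trans (M ^ e * (M ^ 1 * M ^ k.-1))); first by rewrite leq_mul2l leq_mul2r M2 !orbT.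
    by rewrite -!expnD leq_exp2l //; move: Ee k2; clear; lia.
apply: le_trans (Pr_or p01 _ _) _; apply: lerD; last first.
  exact: (@Pr_two_cuts R M N e k M2 k2 ke p J Lam p01 pJ Lam0 l h HJ l0 lhN b bz hz k.-1 s bN hzh bzb s01 ts).
apply: le_trans (Pr_or p01 _ _) _; apply: lerD; last first.
  apply: (@le_trans _ _ (\sum_(q < M ^ h) \sum_(i < k) F * (2 ^+ (M ^ h) * expR (- (K ^+ 2 * Lam * 2^-1))))); last first.
    by rewrite !sumr_const !card_ord [leRHS]mulr_natl mulr_natl.
  apply: (@le_trans _ _ (\sum_(q < M ^ h) Pr p (fun w => [exists i, kept q i w]))).
    by apply: le_trans (Pr_exists p01 _ _); apply: Pr_le => // w /existsP[q oq]; apply/existsP; exists q.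
  apply: ler_sum => q _; apply: (@le_trans _ _ (\sum_(i < k) Pr p (kept q i))).
    by apply: le_trans (Pr_exists p01 _ _); apply: Pr_le => // w /existsP[i oq]; apply/existsP; exists i.
  apply: ler_sum => i _; have ih : (i <= h)%N by apply: leq_trans kh; exact: ltnW.
  apply: le_trans (@Pr_keep R M N e k M2 k2 ke p J Lam p01 pJ Lam0 l h HJ l0 lhN b i (Aj q i) bN (ltn_ord i)
    ih (lfj q ih) (fun w => ~~ fine e l w (lf q)) _) _.
    apply: dep_A ih (lfj q ih) _ => w w' ww'; congr (~~ _); apply: dep_fine => c cq; apply: ww'.
    exact: inb_sub.
  by rewrite -mulrA ler_wpM2r // FP.
apply: le_trans (Pr_or p01 _ _) _; apply: lerD; last first.
  apply: (@le_trans _ _ (\sum_(q < M ^ h) H * (2 ^+ (M ^ h) * expR (- (K ^+ 2 * Lam / (M ^ (2 * h))%:R))))); last first.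
    by rewrite sumr_const card_ord -[leLHS]mulr_natl.
  apply: (@le_trans _ _ (\sum_(q < M ^ h) Pr p (lost q))).
    by apply: le_trans (Pr_exists p01 _ _); apply: Pr_le => // w /existsP[q oq]; apply/existsP; exists q.
  apply: ler_sum => q _.
  apply: le_trans (@Pr_lost R M N e k M2 k2 ke p J Lam p01 pJ Lam0 l h HJ l0 lhN b k.-1 (Aj q k.-1) bN kk
    k1h (lfj q k1h) (NF e k l ^~ (lf q)) _) _.
    apply: dep_A k1h (lfj q k1h) _ => w w' ww'; exact: (dep_NF e k0).
  by rewrite -mulrA ler_wpM2r // HP.
by apply: le_trans (Pr_or p01 _ _) _; apply: lerD.
Qed.

End OneStep.

(** * Simultaneous induction on the level *)

Section Induction.
Variables (R : realType) (M N e k : nat).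
Hypothesis M2 : (2 <= M)%N.
Hypothesis k2 : (2 <= k)%N.
Hypothesis ke : (2 * k <= e)%N.

Local Notation V := 'I_(M ^ N).
Local Notation config := {ffun (V * V) -> bool}.
Implicit Types (w : config) (x y : V).

Let Mn_gt0 n : (0 < M ^ n)%N. Proof. by rewrite expn_gt0 (ltnW M2). Qed.
Let k0 : (0 < k)%N. Proof. exact: ltnW k2. Qed.

Variables (p : V * V -> R) (J : V -> V -> R).
Hypothesis p01 : forall c, 0 <= p c <= 1.
Hypothesis pJ : forall x y, x != y -> 1 - p (bond_of x y) <= expR (- J x y).

(** If all sites and bonds of the block are open, it is a complete graph; the rest is a union bound
    over coordinates. *)
Lemma Pr_not_fine_base (delta : R) n b : (n <= N)%N -> (b < M ^ (N - n))%N ->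
  (forall x y, (x %/ M ^ n = y %/ M ^ n)%N -> 1 - p (bond_of x y) <= delta) ->
  Pr p (fun w => ~~ fine e n w b) <= (M ^ (2 * n))%:R * delta.
Proof.
move=> nN bN pd; pose B := blk M N n b.
apply: (@le_trans _ _ (\sum_(c in finset.setX B B) Pr p (fun w => ~~ w (bond_of c.1 c.2)))).
  apply: le_trans (Pr_exists p01 _ _); apply: Pr_le => // w; apply: contraNT => nex.
  have op x y : x \in B -> y \in B -> w (bond_of x y).
    move=> xB yB; apply: contraNT nex => wxy; apply/existsP; exists (x, y).
    by rewrite finset.in_setX /= xB yB.
  have [x xB] : exists x, x \in B.
    by apply/set0Pn; rewrite -card_gt0 card_blk.
  have xb : (x %/ M ^ n = b)%N by move: xB; rewrite inE => /eqP.
  apply/existsP; exists x; rewrite xb eqxx /= /big.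
  have -> : cl n w x = B.
    apply/setP => y; apply/idP/idP => [/cl_blk yx|yB].
      by rewrite inE yx xb.
    have [->|xy] := eqVneq x y; first exact: cl_refl.
    have yb : (y %/ M ^ n = b)%N by move: yB; rewrite inE => /eqP.
    apply: cl_adj; last by rewrite xb yb.
    have ox z : z \in B -> w (z, z).
      by move=> zB; have := op _ _ zB zB; rewrite /bond_of ltnn.
    by rewrite /adj xy !ox // op.
  by rewrite card_blk // leq_addr.
apply: (@le_trans _ _ (\sum_(c in finset.setX B B) delta)); last first.
  by rewrite sumr_const cardsX card_blk // -[leLHS]mulr_natl mul2n -addnn expnD.
apply: ler_sum => -[x y]; rewrite finset.in_setX !inE => /andP[/eqP xb /eqP yb] /=.
apply: le_trans (pd x y _); last by rewrite xb yb.
have := Pr_closed p [set bond_of x y]%SET; rewrite finset.big_set1 => <-.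
apply: Pr_le => // w wxy; apply/forall_inP => c; rewrite inE => /eqP -> //.
Qed.

Variables (h g n1 : nat) (kk : nat -> nat) (alpha beta theta eta s : R).
Hypothesis ge : (e + k + 2 <= g)%N.
Hypothesis gh : (g <= h)%N.
Hypothesis n1h : (4 * (h + k + g) <= n1)%N.
Hypothesis kkg : forall T, (n1 < T)%N -> (g <= kk T)%N.
Hypothesis kkT : forall T, (n1 < T)%N -> (4 * kk T <= T)%N.
Hypothesis a0 : 0 <= alpha.
Hypothesis b0 : 0 <= beta.
Hypothesis th0 : 0 <= theta.
Hypothesis s01 : 0 <= s <= 1.
Hypothesis ts : 1 <= (k.-1)%:R * (s / 2).

Definition hb n : R := if (n <= n1)%N then eta else n%:R `^ (- alpha).
Definition fb n : R := if (n <= n1)%N then eta else n%:R `^ (- beta).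
(** Chosen so that rho^(M^(t - g)) cancels the factor 2^(M^t) of the union bound and still leaves
    2^-(M^(t - g)). *)
Definition rho : R := (2 ^+ (M ^ g).+1)^-1.
(** The exponent of a cut of weight 1: such a cut has probability at most T^-gam. *)
Definition gam : R := kap R M e k ^+ 2 * theta.
(** At most [kk T] levels are late, and a leaf has at most M^(kk T + k) sub-blocks of each. These
    levels are at least T / 2, whence the factor 2^alpha. *)
Definition lamT T : R := (kk T)%:R * ((M ^ (kk T + k))%:R * (2 `^ alpha * T%:R `^ (- alpha))).

Hypothesis hb_le : forall n, (0 < n)%N -> hb n <= n%:R `^ (- alpha).
Hypothesis fb_le : forall n, (0 < n)%N -> fb n <= n%:R `^ (- beta).
Hypothesis hb_sum : forall n, (M ^ g)%:R * \sum_(1 <= m' < n) hb m' <= rho.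

Definition ubT T : R := (2 ^+ (M ^ (kk T - g)))^-1 + (M ^ (2 * h))%:R * lamT T ^+ 2.

Definition stepf T : R := ubT T + (M ^ (2 * h))%:R * (2 `^ beta * T%:R `^ (- beta)) ^+ 2 +
  (M ^ h)%:R * (2 `^ beta * T%:R `^ (- beta) * (2 ^+ (M ^ h) * T%:R `^ (- (gam / (M ^ (2 * h))%:R)))) +
  2 ^+ (M ^ h) * T%:R `^ (- (gam * 2^-1)).

Definition steph T : R := ubT T + (M ^ (2 * h))%:R * (2 `^ beta * T%:R `^ (- beta)) ^+ 2 +
  (M ^ h)%:R * (2 `^ alpha * T%:R `^ (- alpha) * (2 ^+ (M ^ h) * T%:R `^ (- (gam / (M ^ (2 * h))%:R)))) +
  (M ^ h)%:R * (k%:R * (2 `^ beta * T%:R `^ (- beta) * (2 ^+ (M ^ h) * T%:R `^ (- (gam * 2^-1))))) +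
  2 ^+ (M ^ h) * 2 ^+ (M ^ h) * T%:R `^ (- (gam * (1 - s))).

Hypothesis Nf : forall T, (n1 < T)%N -> stepf T <= T%:R `^ (- beta).
Hypothesis Nh : forall T, (n1 < T)%N -> steph T <= T%:R `^ (- alpha).

Hypothesis HJ : forall T j x y, (n1 < T <= N)%N -> (T - h <= j < T)%N ->
  (x %/ M ^ j != y %/ M ^ j)%N -> (x %/ M ^ j.+1 = y %/ M ^ j.+1)%N ->
  theta * ln T%:R * M%:R / (M ^ (2 * j.+1))%:R <= J x y.

Variable delta : R.
Hypothesis base : forall x y, (x %/ M ^ n1 = y %/ M ^ n1)%N -> 1 - p (bond_of x y) <= delta.
Hypothesis deltaP : (M ^ (2 * n1))%:R * delta <= eta.

Let delta0 : 0 <= delta.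
Proof.
have x0 : V by exact: (Ordinal (Mn_gt0 N)).
apply: le_trans (base (erefl (x0 %/ M ^ n1)%N)).
by rewrite subr_ge0; case/andP: (p01 (bond_of x0 x0)).
Qed.

Let powR_half (c : R) T n : 0 <= c -> (0 < n)%N -> (T <= 2 * n)%N -> (0 < T)%N ->
  n%:R `^ (- c) <= 2 `^ c * T%:R `^ (- c).
Proof.
move=> c0 n0 Tn T0; rewrite !powRN ler_pdivlMr ?powR_gt0 ?ltr0n // mulrC.
rewrite ler_pdivrMr ?powR_gt0 ?ltr0n // -powRM ?ler0n //.
by apply: ge0_ler_powR; rewrite ?nnegrE ?mulr_ge0 ?ler0n // -natrM ler_nat.
Qed.

Let expR_powR (c : R) T : (0 < T)%N ->
  expR (- (kap R M e k ^+ 2 * (theta * ln T%:R) * c)) = T%:R `^ (- (gam * c)).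
Proof.
move=> T0; rewrite /powR pnatr_eq0 (gtn_eqF T0); congr expR.
by rewrite /gam; ring.
Qed.

Let rho_pow t : (g <= t)%N -> 2 ^+ (M ^ t) * rho ^+ (M ^ (t - g)) = (2 ^+ (M ^ (t - g)))^-1.
Proof.
move=> gt; rewrite -{1}(subnK gt) expnD mulnC exprM -exprMn_comm; last exact: mulrC.
by rewrite /rho exprS invfM mulrCA mulfV ?mulr1 ?exprVn.
Qed.

Lemma Pr_uncovered_step T m b : (n1 < T <= N)%N -> (m + k.-1 + h = T)%N ->
  (b < M ^ (N - T))%N ->
  (forall m' c, (0 < m' <= m)%N -> (c < M ^ (N - m'))%N ->
     Pr p (fun w => NF e k m' w c) <= hb m') ->
  Pr p (fun w => ~~ (#|blk M N T b :&: uncovered e k m w| * M ^ (e + k) <= M ^ T)%N)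
  <= ubT T.
Proof.
case/andP=> nT TN mT bN IH; have kg := kkg nT; have k4 := kkT nT.
rewrite /ubT -(rho_pow kg).
have gv : (g <= m + k.-1 + h - kk T)%N by rewrite mT; move: k4 n1h nT; clear; lia.
have vk : (m + k.-1 + h - kk T + kk T = m + k.-1 + h)%N.
  by rewrite subnK // mT; move: k4; clear; lia.
have Eh : (e + k + 1 <= h)%N by move: ge gh; clear; lia.
have rho1 : rho <= 1 by rewrite invf_le1 ?exprn_gt0 // exprn_ege1 // ler1n.
have lhN : (m + k.-1 + h <= N)%N by rewrite mT.
have bN' : (b < M ^ (N - (m + k.-1 + h)))%N by rewrite mT.
have := @Pr_uncovered R M N e k M2 k2 ke p p01 m h b _ (kk T) g (e + k) lhN bN' vk gv kg ge Eh hb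
  rho (lamT T) IH (hb_sum m.+1) rho1.
rewrite !mT; apply.
pose u := (T - kk T - k.-1)%N.
rewrite (eq_bigl (fun i => true && (u.+1 <= i)%N)); last first.
  by move=> i; rewrite /u /=; move: k4 n1h nT k2; clear; lia.
rewrite -(big_nat_widenl u.+1 1) //.
have um : (m.+1 - u.+1 <= kk T)%N by rewrite /u; move: mT k4 n1h nT k2; clear; lia.
apply: (@le_trans _ _ (\sum_(u.+1 <= i < m.+1) ((M ^ (kk T + k))%:R * (2 `^ alpha * T%:R `^ (- alpha))))).
  rewrite big_nat [leRHS]big_nat; apply: ler_sum => i /andP[ui im].
  apply: ler_pM => //.
  - apply: le_trans (Pr_ge0 p01 _) (IH i 0 _ _); last exact: Mn_gt0.
    by move: ui im; clear; lia.
  - by rewrite ler_nat leq_exp2l //; move: ui im mT nT k4; rewrite /u; clear; lia.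
  - apply: le_trans (hb_le _) _; first by move: ui; clear; lia.
    by apply: powR_half => //; move: ui k4 n1h nT k2; rewrite /u; clear; lia.
by rewrite sumr_const_nat -[leLHS]mulr_natl ler_wpM2r ?ler_nat // !mulr_ge0 ?powR_ge0.
Qed.

(** For [fine] the tree has its root at level [n]; for [NF] it has its root at the last of the k
    ancestors, level T = n + k - 1. As [h] exceeds [k], the leaves at level T - h are still below
    [n], within reach of the induction hypothesis. *)
Theorem finite_bounds n b : (0 < n <= N)%N -> (b < M ^ (N - n))%N ->
  Pr p (fun w => ~~ fine e n w b) <= fb n /\
  ((n + k.-1 <= N)%N -> Pr p (fun w => NF e k n w b) <= hb n).
Proof.
have [q] := ubnP n; elim: q n b => // q IH n b nq /andP[n0 nN] bN.
have fineb : (n <= n1)%N -> Pr p (fun w => ~~ fine e n w b) <= eta.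
  move=> nn1; apply: le_trans deltaP; apply: le_trans (Pr_not_fine_base (delta := delta) nN bN _) _.
    by move=> x y /leq_div_blk xy; apply: base; exact: xy.
  by rewrite ler_wpM2r // ler_nat leq_exp2l // leq_mul2l nn1 orbT.
have IHf n' c : (0 < n' < n)%N -> (c < M ^ (N - n'))%N -> Pr p (fun w => ~~ fine e n' w c) <= fb n'.
  case/andP => n'0 n'n cN; apply: (IH n' c _ _ cN).1; first exact: leq_trans n'n _.
  by rewrite n'0 (leq_trans (ltnW n'n)).
have IHh n' c : (0 < n' < n)%N -> (n' + k.-1 <= N)%N -> (c < M ^ (N - n'))%N ->
    Pr p (fun w => NF e k n' w c) <= hb n'.
  case/andP => n'0 n'n n'N cN; apply: (IH n' c _ _ cN).2 => //; first exact: leq_trans n'n _.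
  by rewrite n'0 (leq_trans (ltnW n'n)).
have he : (e + k <= h)%N by move: ge gh; clear; lia.
case: (leqP n n1) => [nn1|n1n].
  rewrite /fb /hb nn1; split=> [|_]; first exact: fineb.
  apply: le_trans (fineb nn1); apply: Pr_le => // w /forallP/(_ (Ordinal k0)).
  by rewrite /= addn0 expn0 divn1.
rewrite /fb /hb leqNgt n1n /=; split=> [|nkN].
  apply: le_trans (Nf n1n); rewrite /stepf.
  pose m := (n - h - k.-1)%N.
  have mT : (m + k.-1 + h = n)%N by rewrite /m; move: n1h n1n k2; clear; lia.
  have mN : (m + k.-1 + h <= N)%N by rewrite mT.
  have HJ' i x y : (i < h)%N -> (x %/ M ^ (m + k.-1 + i) != y %/ M ^ (m + k.-1 + i))%N ->
      (x %/ M ^ (m + k.-1 + i.+1) = y %/ M ^ (m + k.-1 + i.+1))%N ->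
      theta * ln n%:R * M%:R / (M ^ (2 * (m + k.-1 + i.+1)))%:R <= J x y.
    move=> ih xy xy'; rewrite addnS; apply: HJ => //; rewrite -?addnS ?n1n //.
    by move: mT ih; clear; lia.
  have L0 : 0 <= theta * ln n%:R by rewrite mulr_ge0 // ln_ge0 // ler1n.
  have bN' : (b < M ^ (N - (m + k.-1 + h)))%N by rewrite mT.
  have UB : Pr p (fun w => ~~ (#|blk M N (m + k.-1 + h) b :&: uncovered e k m w| * M ^ (e + k)
      <= M ^ (m + k.-1 + h))%N) <= ubT n.
    rewrite mT; apply: Pr_uncovered_step => //; first by rewrite n1n.
    move=> m' c m'm; apply: IHh; first by move: m'm mT k2; clear; lia.
    by move: m'm mN; clear; lia.
  have FP c : (c < M ^ (N - (m + k.-1)))%N ->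
      Pr p (fun w => ~~ fine e (m + k.-1) w c) <= 2 `^ beta * n%:R `^ (- beta).
    move=> cN; apply: le_trans (IHf _ _ _ cN) _; first by move: mT n1h n1n k2 he; clear; lia.
    apply: le_trans (fb_le _) _; first by move: k2; clear; lia.
    by apply: powR_half => //; move: mT n1h n1n k2; clear; lia.
  have := Pr_not_fine_step M2 k2 ke p01 pJ L0 HJ' mN bN' (leqnn _) he UB FP.
  by rewrite mT !expR_powR.
pose T := (n + k.-1)%N; pose m := (n - h)%N; pose hz := (h - k.-1)%N.
have n1T : (n1 < T)%N by apply: leq_trans n1n _; exact: leq_addr.
have T0 : (0 < T)%N by exact: leq_trans n1T.
apply: (@le_trans _ _ (T%:R `^ (- alpha))); last first.
  rewrite !powRN lef_pV2 ?posrE ?powR_gt0 ?ltr0n //.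
  by apply: ge0_ler_powR; rewrite ?nnegrE // ler_nat leq_addr.
apply: le_trans (Nh n1T); rewrite /steph.
have mT : (m + k.-1 + h = T)%N by rewrite /m /T; move: n1h n1n k2; clear; lia.
have hzh : (hz + k.-1 = h)%N by rewrite /hz; move: he; clear; lia.
have nl : (m + k.-1 + hz = n)%N by move: mT hzh; rewrite /T; clear; lia.
have mN : (m + k.-1 + h <= N)%N by rewrite mT.
have HJ' i x y : (i < h)%N -> (x %/ M ^ (m + k.-1 + i) != y %/ M ^ (m + k.-1 + i))%N ->
    (x %/ M ^ (m + k.-1 + i.+1) = y %/ M ^ (m + k.-1 + i.+1))%N ->
    theta * ln T%:R * M%:R / (M ^ (2 * (m + k.-1 + i.+1)))%:R <= J x y.
  move=> ih xy xy'; rewrite addnS; apply: HJ => //; rewrite -?addnS ?n1T //.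
  by move: mT ih; clear; lia.
have L0 : 0 <= theta * ln T%:R by rewrite mulr_ge0 // ln_ge0 // ler1n.
have bN' : (b %/ M ^ k.-1 < M ^ (N - (m + k.-1 + h)))%N by rewrite mT; apply: ancestor_lt.
have UB : Pr p (fun w => ~~ (#|blk M N (m + k.-1 + h) (b %/ M ^ k.-1) :&: uncovered e k m w| * M ^ (e + k)
    <= M ^ (m + k.-1 + h))%N) <= ubT T.
  rewrite mT; apply: Pr_uncovered_step => //.
  - by rewrite n1T.
  - by rewrite -mT.
  - move=> m' c m'm; apply: IHh; first by move: m'm n1h n1n k2 he; rewrite /m; clear; lia.
    by move: m'm mN; clear; lia.
have FP c : (c < M ^ (N - (m + k.-1)))%N ->
    Pr p (fun w => ~~ fine e (m + k.-1) w c) <= 2 `^ beta * T%:R `^ (- beta).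
  move=> cN; apply: le_trans (IHf _ _ _ cN) _.
    by move: mT n1h n1n k2 he; rewrite /T; clear; lia.
  apply: le_trans (fb_le _) _; first by move: k2; clear; lia.
  by apply: powR_half => //; move: mT n1h n1T k2; clear; lia.
have HP c : (c < M ^ (N - (m + k.-1)))%N ->
    Pr p (fun w => NF e k (m + k.-1) w c) <= 2 `^ alpha * T%:R `^ (- alpha).
  move=> cN; apply: le_trans (IHh _ _ _ _ cN) _.
  - by move: mT n1h n1n k2 he; rewrite /T; clear; lia.
  - by apply: leq_trans mN; move: he; clear; lia.
  apply: le_trans (hb_le _) _; first by move: k2; clear; lia.
  by apply: powR_half => //; move: mT n1h n1T k2; clear; lia.
have := Pr_NF_step M2 k2 ke p01 pJ L0 HJ' mN bN' (leqnn _) he UB FP HP hzh (erefl _) s01 ts.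
rewrite nl !expR_powR // => /le_trans; apply; rewrite lerD2l ler_wpM2r ?powR_ge0 //.
rewrite ler_wpM2l ?exprn_ge0 // ler_eXn2l ?ltr1n // leq_exp2l //.
by rewrite /hz leq_subr.
Qed.

End Induction.

(** * Choice of the constants *)

Section Asymptotics.
Variable R : realType.
Implicit Types (c C : R) (T n M : nat).

Lemma powRN_eventually C c : 0 <= C -> 0 < c ->
  exists n0, forall n, (n0 < n)%N -> C * n%:R `^ (- c) <= 1.
Proof.
move=> C0 c0; exists (Num.truncn (C `^ c^-1)) => n n0n.
have n0 : (0 < n)%N by apply: leq_trans n0n.
rewrite powRN ler_pdivrMr ?powR_gt0 ?ltr0n // mul1r.
have -> : C = (C `^ c^-1) `^ c by rewrite -powRrM mulVf ?gt_eqF // powRr1.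
apply: ge0_ler_powR; rewrite ?nnegrE ?powR_ge0 ?(ltW c0) //.
apply: (le_trans (ltW (truncnS_gt _))); by rewrite ler_nat.
Qed.

Lemma powRN_le T c c' : (0 < T)%N -> c <= c' -> T%:R `^ (- c') <= T%:R `^ (- c) :> R.
Proof. by move=> T0 cc; apply: ler_powR; rewrite ?ler1n // lerN2. Qed.

Lemma powRN_D T c c' : (0 < T)%N ->
  T%:R `^ (- (c + c')) = T%:R `^ (- c) * T%:R `^ (- c') :> R.
Proof.
by move=> T0; rewrite opprD powRD // pnatr_eq0 (gtn_eqF T0) implybT.
Qed.

(** Comparison with the integral of x^-(1 + c). With t = n + 1 it reads (1 - 1/t)^-c >= 1 + c/t,
    which follows from exp y >= 1 + y and ln (1 - 1/t) <= - 1/t. *)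
Lemma powRN_telescope c n : 0 < c -> (0 < n)%N ->
  n.+1%:R `^ (- (1 + c)) <= (n%:R `^ (- c) - n.+1%:R `^ (- c)) / c.
Proof.
move=> c0 n0; rewrite ler_pdivlMr // powRN_D // powRN powRr1 //.
have t0 : 0 < n.+1%:R :> R by rewrite ltr0n.
have nt : n%:R = n.+1%:R * (1 + - n.+1%:R^-1) :> R.
  by rewrite mulrDr mulr1 mulrN mulfV ?gt_eqF // -natr1 addrK.
have t1 : 0 <= 1 + - n.+1%:R^-1 :> R.
  by rewrite subr_ge0 invf_le1 // ler1n.
rewrite nt powRM ?(ltW t0) // -[X in _ - X]mulr1 -mulrBr mulrAC mulrC.
rewrite ler_pM2l ?powR_gt0 // lerBrDr.
have x0 : 0 < 1 + - n.+1%:R^-1 :> R by rewrite subr_gt0 invf_lt1 // ltr1n.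
rewrite /powR gt_eqF //; apply: le_trans (expR_ge1Dx _); rewrite addrC lerD2l mulNr.
rewrite -mulrN mulrC ler_pM2l // lerNr; apply: le_ln1Dx.
by rewrite ltrN2 invf_lt1 // ltr1n.
Qed.

Lemma sum_powRN_le c n1 i : 0 < c -> (0 < n1)%N ->
  \sum_(n1.+1 <= m < n1.+1 + i) m%:R `^ (- (1 + c)) <= n1%:R `^ (- c) / c.
Proof.
move=> c0 n10; suff : \sum_(n1.+1 <= m < n1.+1 + i) m%:R `^ (- (1 + c)) <=
    (n1%:R `^ (- c) - (n1 + i)%:R `^ (- c)) / c.
  move=> /le_trans; apply; rewrite ler_pM2r ?invr_gt0 // gerBl; exact: powR_ge0.
elim: i => [|i IH]; first by rewrite !addn0 big_geq // subrr mul0r.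
rewrite addnS big_nat_recr ?leq_addr //= addSn addnS.
apply: le_trans (lerD IH (powRN_telescope c0 _)) _; first by rewrite addn_gt0 n10.
by rewrite -mulrDl addrA subrK.
Qed.

(** Applied with [y] of order T^(1/4): the power 12 turns the large deviation bound 2^-y into
    T^-3. *)
Lemma expn12_le_exp2 y : (y ^ 12 <= 12 ^ 12 * 2 ^ y)%N.
Proof.
have yq : (y <= 12 * 2 ^ (y %/ 12))%N.
  apply: ltnW; apply: (@leq_trans (12 * (y %/ 12).+1)).
    by rewrite {1}(divn_eq y 12) mulnC mulnS addnC ltn_add2r ltn_pmod.
  by rewrite leq_mul2l /= ltn_expl.
apply: (@leq_trans ((12 * 2 ^ (y %/ 12)) ^ 12)); first by rewrite leq_exp2r.
rewrite expnMn leq_mul2l -expnM leq_exp2l // leq_trunc_div.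
by rewrite orbT.
Qed.

Section Steps.
Variables (M k e h g : nat) (s theta sigma : R).
Hypothesis M2 : (2 <= M)%N.
Hypothesis sig0 : 0 < sigma.
Hypothesis sig1 : sigma <= 4^-1.
Hypothesis s0 : 0 <= s.
Hypothesis th0 : 0 < theta.
Hypothesis kap0 : 0 < kap R M e k.
Hypothesis gam_s : 1 + 4 * sigma <= gam M e k theta * (1 - s).

Let Mn_gt0 n : (0 < M ^ n)%N. Proof. by rewrite expn_gt0 (ltnW M2). Qed.

Let sig3 : 1 + 4 * sigma <= 3.
Proof. by have := sig1; move=> ?; lra. Qed.

(** The exponents satisfy alpha0 < 2 beta0 < 1 + 4 sigma <= gam (1 - s), and beta0 lies below gam /
    2; every gap is a multiple of sigma. *)
Definition alpha0 : R := 1 + 2 * sigma.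
Definition beta0 : R := (1 + 3 * sigma) / 2.
(** About T^(1/4) sub-blocks: enough for the large deviation bound to decay faster than any power of
    T, and few enough for the square of the late term to stay below T^-alpha0. *)
Definition kk0 T := (trunc_log M T %/ 4)%N.

Lemma kk0_lower T : (0 < T)%N -> (M ^ (4 * kk0 T) <= T)%N.
Proof.
move=> T0; apply: leq_trans (trunc_logP M2 T0); rewrite leq_exp2l //.
by rewrite mulnC leq_trunc_div.
Qed.

Lemma kk0_upper T : (0 < T)%N -> (T <= M ^ (4 * (kk0 T).+1))%N.
Proof.
move=> T0; apply: (ltnW (leq_trans (trunc_log_ltn T M2) _)); rewrite leq_exp2l //.
by rewrite {1}(divn_eq (trunc_log M T) 4) mulnC mulnS addnC ltn_add2r ltn_pmod.
Qed.

Lemma kk0_le T : (0 < T)%N -> (4 * kk0 T <= T)%N.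
Proof. by move=> T0; apply: ltnW; apply: leq_trans (kk0_lower T0); exact: ltn_expl. Qed.

Lemma kk0_ge T : (M ^ (4 * g) <= T)%N -> (g <= kk0 T)%N.
Proof.
move=> gT; rewrite /kk0 leq_divRL // mulnC -(leq_exp2l _ _ M2).
by rewrite leq_exp2l // -ltnS -(ltn_exp2l _ _ M2) (leq_ltn_trans gT) // trunc_log_ltn.
Qed.

Local Notation gm := (gam M e k theta).
Let eta1 := gm / (M ^ (2 * h))%:R.
(** The spare power of T by which each term beats its target, used to absorb constants; [eta1] is
    the gain of the crude cut after a leaf is dropped. *)
Let zeta := Num.min (sigma / 2) eta1.

Let gm0 : 0 < gm. Proof. by rewrite mulr_gt0 // exprn_gt0. Qed.

Let zeta0 : 0 < zeta.
Proof. by rewrite lt_min !divr_gt0 // ltr0n. Qed.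

Let gm_half : (1 + 4 * sigma) / 2 <= gm * 2^-1.
Proof.
rewrite ler_pM2r ?invr_gt0 //; apply: (le_trans gam_s).
by rewrite -[leRHS]mulr1 ler_pM2l // gerBl.
Qed.

Let C1 : R := (12 ^ 12 * M ^ (12 * g.+1))%:R.
Let C2 : R := (M ^ (2 * k))%:R * (2 `^ alpha0) ^+ 2.

Let tail_kk T : (0 < T)%N -> (g <= kk0 T)%N ->
  (2 ^+ (M ^ (kk0 T - g)))^-1 <= C1 * T%:R `^ (- 3).
Proof.
move=> T0 gT; have t0 : 0 < T%:R :> R by rewrite ltr0n.
rewrite powR_invn ?ler0n // ler_pdivlMr ?exprn_gt0 // mulrC ler_pdivrMr ?exprn_gt0 //.
rewrite -!natrX -natrM ler_nat.
set y := (M ^ (kk0 T - g))%N.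
have Ty : (T <= (y * M ^ g.+1) ^ 4)%N.
  apply: leq_trans (kk0_upper T0) _; rewrite -expnD -expnM leq_exp2l // mulnC leq_mul2r /=.
  by rewrite addnS subnK.
apply: (@leq_trans (((y * M ^ g.+1) ^ 4) ^ 3)); first by rewrite leq_exp2r.
have e12 : (4 * 3 = 12)%N by [].
rewrite -expnM e12 expnMn -expnM (mulnC g.+1 12) [leqRHS]mulnAC leq_mul2r.
by rewrite expn12_le_exp2 orbT.
Qed.

(** Bounding [kk0 T] by M^(kk0 T) costs a second factor of order T^(1/4). After squaring, M^(4 kk0
    T) <= T leaves the exponent 2 alpha0 - 1 = 1 + 4 sigma. *)
Let lam_bound T : (0 < T)%N ->
  lamT M k kk0 alpha0 T ^+ 2 <= C2 * T%:R `^ (- (1 + 4 * sigma)).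
Proof.
move=> T0; have t0 : 0 < T%:R :> R by rewrite ltr0n.
apply: (@le_trans _ _ (((M ^ (2 * kk0 T))%:R * ((M ^ k)%:R * (2 `^ alpha0 * T%:R `^ (- alpha0)))) ^+ 2)).
  rewrite ler_sqr ?nnegrE ?mulr_ge0 ?powR_ge0 // /lamT expnD natrM -mulrA mulrA.
  rewrite ler_wpM2r ?mulr_ge0 ?powR_ge0 // -natrM ler_nat mul2n -addnn expnD leq_mul2r.
  by rewrite (ltnW (ltn_expl _ M2)) orbT.
have -> : ((M ^ (2 * kk0 T))%:R * ((M ^ k)%:R * (2 `^ alpha0 * T%:R `^ (- alpha0)))) ^+ 2 =
   C2 * ((M ^ (4 * kk0 T))%:R * (T%:R `^ (- alpha0) * T%:R `^ (- alpha0))) :> R.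
  have -> : (4 * kk0 T = 2 * kk0 T + 2 * kk0 T)%N by rewrite -mulnDl.
  rewrite /C2 (mul2n k) -addnn !expnD !natrM; ring.
rewrite -powRN_D // ler_wpM2l ?mulr_ge0 ?sqr_ge0 //.
apply: (@le_trans _ _ (T%:R * T%:R `^ (- (alpha0 + alpha0)))).
  by rewrite ler_wpM2r ?powR_ge0 // ler_nat kk0_lower.
have -> : alpha0 + alpha0 = 1 + (1 + 4 * sigma) by rewrite /alpha0; ring.
by rewrite (powRN_D 1) // powRN powRr1 ?ler0n // mulrA mulfV ?gt_eqF // mul1r.
Qed.

Let ub_bound T c : (0 < T)%N -> (g <= kk0 T)%N -> c <= 1 + 4 * sigma ->
  ubT M k h g kk0 alpha0 T <= (C1 + (M ^ (2 * h))%:R * C2) * T%:R `^ (- c).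
Proof.
move=> T0 gT c4; rewrite /ubT mulrDl lerD //.
  apply: le_trans (tail_kk T0 gT) _; rewrite ler_wpM2l ?ler0n // powRN_le //.
  exact: le_trans c4 sig3.
rewrite -mulrA ler_wpM2l //; apply: le_trans (lam_bound T0) _.
by rewrite ler_wpM2l ?powRN_le // mulr_ge0 ?sqr_ge0.
Qed.

Let ub_bound_ex : exists2 D, 0 <= D & forall T c, (0 < T)%N -> (g <= kk0 T)%N ->
  c <= 1 + 4 * sigma -> ubT M k h g kk0 alpha0 T <= D * T%:R `^ (- c).
Proof.
exists (C1 + (M ^ (2 * h))%:R * C2); last exact: ub_bound.
apply: addr_ge0; first exact: ler0n.
by apply: mulr_ge0; [exact: ler0n | apply: mulr_ge0; [exact: ler0n | exact: sqr_ge0]].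
Qed.

Let Cb : R := 2 `^ beta0.
Let Ca : R := 2 `^ alpha0.
Let B : R := 2 ^+ (M ^ h).
Let Cb0 : 0 <= Cb. Proof. exact: powR_ge0. Qed.
Let Ca0 : 0 <= Ca. Proof. exact: powR_ge0. Qed.
Let B0 : 0 <= B. Proof. exact: exprn_ge0. Qed.

Let zeta_sig : zeta <= sigma / 2. Proof. by rewrite ge_min lexx. Qed.
Let zeta_eta : zeta <= eta1. Proof. by rewrite ge_min lexx orbT. Qed.

Lemma step_eventually : exists n0, forall T, (n0 < T)%N ->
  stepf M e k h g kk0 alpha0 beta0 theta T <= T%:R `^ (- beta0) /\
  steph M e k h g kk0 alpha0 beta0 theta s T <= T%:R `^ (- alpha0).
Proof.
have [D D0 ubD] := ub_bound_ex.
pose H2 : R := (M ^ (2 * h))%:R; pose H1 : R := (M ^ h)%:R.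
have H20 : 0 <= H2 by []. have H10 : 0 <= H1 by [].
pose Cf := D + H2 * Cb ^+ 2 + H1 * (Cb * B) + B.
pose Ch := D + H2 * Cb ^+ 2 + H1 * (Ca * B) + H1 * (k%:R * (Cb * B)) + B * B.
have Cf0 : 0 <= Cf by rewrite !addr_ge0 ?mulr_ge0 ?sqr_ge0.
have Ch0 : 0 <= Ch by rewrite !addr_ge0 ?mulr_ge0 ?sqr_ge0.
have [nf nfP] := powRN_eventually Cf0 zeta0.
have [nh nhP] := powRN_eventually Ch0 zeta0.
exists (nf + nh + M ^ (4 * g))%N => T nT.
have T0 : (0 < T)%N by exact: leq_trans nT.
have gT : (g <= kk0 T)%N by apply: kk0_ge; move: nT; clear; lia.
have fT := nfP T (leq_ltn_trans _ nT); have hT := nhP T (leq_ltn_trans _ nT).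
have z (c c' : R) (C : R) : 0 <= C -> c + zeta <= c' ->
    C * T%:R `^ (- c') <= C * T%:R `^ (- zeta) * T%:R `^ (- c).
  move=> C0 cc; rewrite -mulrA ler_wpM2l // -powRN_D // powRN_le //.
  by rewrite addrC.
split.
  apply: (@le_trans _ _ (Cf * T%:R `^ (- zeta) * T%:R `^ (- beta0))); last first.
    rewrite -[leRHS]mul1r ler_wpM2r ?powR_ge0 //; apply: fT.
    by rewrite -addnA leq_addr.
  rewrite /stepf -/Cb -/B -/H2 -/H1 /Cf !mulrDl; apply: lerD; last first.
    by apply: z => //; apply: le_trans gm_half; move: sig0 zeta_sig; rewrite /beta0; lra.
  apply: lerD; last first.
    apply: le_trans (z beta0 (beta0 + eta1) _ _ _); rewrite ?mulr_ge0 ?lerD2l //.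
    rewrite powRN_D // /eta1 le_eqVlt; apply/orP; left; apply/eqP; ring.
  apply: lerD; last first.
    apply: le_trans (z beta0 (beta0 + beta0) _ _ _); rewrite ?mulr_ge0 ?sqr_ge0 ?lerD2l //.
      by rewrite powRN_D // le_eqVlt; apply/orP; left; apply/eqP; ring.
    by apply: (le_trans zeta_sig); move: sig0; rewrite /beta0; lra.
  apply: le_trans (z _ (beta0 + zeta) _ _ _) => //.
  by apply: ubD => //; move: sig0 zeta_sig; rewrite /beta0; lra.
apply: (@le_trans _ _ (Ch * T%:R `^ (- zeta) * T%:R `^ (- alpha0))); last first.
  rewrite -[leRHS]mul1r ler_wpM2r ?powR_ge0 //; apply: hT.
  by rewrite addnAC leq_addl.
rewrite /steph -/Cb -/Ca -/B -/H2 -/H1 /Ch !mulrDl; apply: lerD; last first.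
  apply: z; rewrite ?mulr_ge0 //; apply: le_trans gam_s.
  by move: sig0 zeta_sig; rewrite /alpha0; lra.
apply: lerD; last first.
  apply: le_trans (z alpha0 (beta0 + gm * 2^-1) _ _ _); rewrite ?mulr_ge0 //.
    by rewrite powRN_D // le_eqVlt; apply/orP; left; apply/eqP; ring.
  by move: sig0 zeta_sig gm_half; rewrite /alpha0 /beta0; lra.
apply: lerD; last first.
  apply: le_trans (z alpha0 (alpha0 + eta1) _ _ _); rewrite ?mulr_ge0 ?lerD2l //.
  by rewrite powRN_D // /eta1 le_eqVlt; apply/orP; left; apply/eqP; ring.
apply: lerD; last first.
  apply: le_trans (z alpha0 (beta0 + beta0) _ _ _); rewrite ?mulr_ge0 ?sqr_ge0 //.
    by rewrite powRN_D // le_eqVlt; apply/orP; left; apply/eqP; ring.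
  by move: sig0 zeta_sig; rewrite /beta0 /alpha0; lra.
apply: le_trans (z _ (alpha0 + zeta) _ _ _) => //.
by apply: ubD => //; move: sig0 zeta_sig; rewrite /alpha0; lra.
Qed.

End Steps.
End Asymptotics.

(** * Large clusters in finite blocks, uniformly in the level *)

Section FinitePercolation.
Variable R : realType.

Theorem finite_percolation (M : nat) (theta : R) : (2 <= M)%N -> 1 < theta <= 2 ->
  exists k h : nat, forall nmin : nat, exists n1 : nat, exists eta : R,
  [/\ (nmin <= n1)%N, 0 < eta &
    forall (N : nat) (p : 'I_(M ^ N) * 'I_(M ^ N) -> R) (J : 'I_(M ^ N) -> 'I_(M ^ N) -> R)
      (delta : R) (x0 : 'I_(M ^ N)),
    (k <= N)%N ->
    (forall c, 0 <= p c <= 1) ->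
    (forall x y, x != y -> 1 - p (bond_of x y) <= expR (- J x y)) ->
    (forall T j (x y : 'I_(M ^ N)), (n1 < T <= N)%N -> (T - h <= j < T)%N ->
       (x %/ M ^ j != y %/ M ^ j)%N -> (x %/ M ^ j.+1 = y %/ M ^ j.+1)%N ->
       theta * ln T%:R * M%:R / (M ^ (2 * j.+1))%:R <= J x y) ->
    (forall x y : 'I_(M ^ N), (x %/ M ^ n1 = y %/ M ^ n1)%N -> 1 - p (bond_of x y) <= delta) ->
    (M ^ (2 * n1))%:R * delta <= eta ->
    2^-1 <= Pr p (fun w => (M ^ (N - k) <= #|cl N w x0|)%N)].
Proof.
move=> M2 /andP[th1 th2]; have Mn_gt0 n : (0 < M ^ n)%N by rewrite expn_gt0 (ltnW M2).
have th0 : 0 < theta by lra.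
(* [x] bounds the loss 1 - kap and also serves as [s]: (1 - x)^3 theta >= theta - 3 x theta = (1 +
   theta) / 2 = 1 + 4 sigma. *)
pose x := (theta - 1) / (6 * theta); pose sigma := (theta - 1) / 8.
have xth : x * (6 * theta) = theta - 1 by rewrite /x divfK // gt_eqF //; lra.
have x0 : 0 < x by rewrite divr_gt0 //; lra.
have x1 : x <= 1 by nra.
(* [k - 1 > 2 / x] lets the gains of [ct_ancestor] reach 1, and [e] makes M^(e - k) at least 1 /
   x. *)
pose k := (Num.truncn (2 / x)).+3; pose e := (2 * k + (Num.truncn (1 / x)).+1)%N.
pose g := (e + k + 2)%N; pose h := g.
have k2 : (2 <= k)%N by [].
have ke : (2 * k <= e)%N by exact: leq_addr.
have ts : 1 <= (k.-1)%:R * (x / 2).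
  have : 2 / x < k.-1%:R by apply: lt_le_trans (truncnS_gt _) _; rewrite ler_nat.
  by rewrite ltr_pdivrMr // => ?; lra.
have kapx : 1 - x <= kap R M e k.
  rewrite lerD2l lerN2; have : 1 / x <= (M ^ (e - k))%:R.
    apply: (le_trans (ltW (truncnS_gt _))); rewrite ler_nat /e.
    apply: ltnW; apply: leq_trans (ltn_expl _ M2) _; rewrite leq_exp2l //.
    by move: (Num.truncn _) => t; clear; lia.
  rewrite mul1r => xM; rewrite -[leRHS]invrK lef_pV2 // posrE ?invr_gt0 //.
  by rewrite ltr0n.
have x1' : x < 1 by nra.
have kap0 : 0 < kap R M e k by apply: lt_le_trans kapx; lra.
have gam_s : 1 + 4 * sigma <= gam M e k theta * (1 - x).
  have kk2 : (1 - x) ^+ 2 <= kap R M e k ^+ 2.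
    by rewrite ler_sqr ?nnegrE ?(ltW kap0) //; lra.
  apply: (@le_trans _ _ ((1 - x) ^+ 2 * theta * (1 - x))).
    rewrite /sigma; have : 0 <= theta * (x ^+ 2 * (3 - x)).
      by apply: mulr_ge0; [exact: ltW | apply: mulr_ge0; [exact: sqr_ge0 | lra]].
    have -> : (1 - x) ^+ 2 * theta * (1 - x) =
        theta - x * (6 * theta) / 2 + theta * (x ^+ 2 * (3 - x)) by field.
    by rewrite xth => ?; lra.
  by rewrite /gam ler_wpM2r ?ler_wpM2r ?(ltW th0) //; lra.
have sig0 : 0 < sigma by rewrite divr_gt0 //; lra.
have sig1 : sigma <= 4^-1 by rewrite /sigma; lra.
have [ns nsP] := @step_eventually R M k e h g x theta sigma M2 sig0 sig1 (ltW x0) th0 kap0 gam_s.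
have r0 : 0 < rho R M g by rewrite invr_gt0 exprn_gt0.
have Mg0 : 0 < (M ^ g)%:R :> R by rewrite ltr0n.
have Ct0 : 0 <= (M ^ g)%:R * 2 / (2 * sigma * rho R M g).
  apply/ltW/divr_gt0; first by apply: mulr_gt0 Mg0 _; lra.
  by apply: mulr_gt0 _ r0; lra.
have sig20 : 0 < 2 * sigma by rewrite mulr_gt0.
have [nt ntP] := powRN_eventually Ct0 sig20.
exists k, h => nmin.
pose n1 := (nmin + ns + nt + 4 * (h + k + g) + M ^ (4 * g)).+1.
have n10 : (0 < n1)%N by [].
have t0 : 0 < n1%:R :> R by rewrite ltr0n.
pose alpha := alpha0 sigma; pose beta := beta0 sigma.
have a0 : 0 <= alpha by rewrite /alpha /alpha0; lra.
have b0 : 0 <= beta by rewrite /beta /beta0; lra.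
(* The first two entries make the base bound compatible with the powers for n <= n1; the third keeps
   the first n1 terms of the sum of [hb] below half of [rho]. *)
pose eta := Num.min (n1%:R `^ (- alpha)) (Num.min (n1%:R `^ (- beta))
  (rho R M g / (2 * (M ^ g)%:R * n1%:R))).
have eta0 : 0 < eta.
  by rewrite !lt_min !powR_gt0 // divr_gt0 // !mulr_gt0.
exists n1, eta; split=> //; first by rewrite /n1; move: (M ^ _)%N => ?; clear; lia.
move=> N p J delta v kN p01 pJ HJ base deltaP.
have kkg T : (n1 < T)%N -> (g <= kk0 M T)%N.
  by move=> nT; apply: kk0_ge => //; move: nT; rewrite /n1; move: (M ^ _)%N => ?; clear; lia.
have kkT T : (n1 < T)%N -> (4 * kk0 M T <= T)%N.
  by move=> nT; apply: kk0_le => //; apply: leq_trans nT.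
have n1h : (4 * (h + k + g) <= n1)%N by rewrite /n1; move: (M ^ _)%N (4 * _)%N => ? ?; clear; lia.
have powle (c : R) n : 0 <= c -> (0 < n <= n1)%N -> n1%:R `^ (- c) <= n%:R `^ (- c).
  move=> c0 /andP[n0 nn1]; rewrite !powRN lef_pV2 ?posrE ?powR_gt0 ?ltr0n //.
  by apply: ge0_ler_powR; rewrite ?nnegrE // ler_nat.
have hb_le n : (0 < n)%N -> hb n1 alpha eta n <= n%:R `^ (- alpha).
  move=> n0; rewrite /hb; case: leqP => // nn1.
  apply: le_trans (powle _ _ a0 _); last by rewrite n0.
  by rewrite /eta ge_min lexx.
have fb_le n : (0 < n)%N -> fb n1 beta eta n <= n%:R `^ (- beta).
  move=> n0; rewrite /fb; case: leqP => // nn1.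
  apply: le_trans (powle _ _ b0 _); last by rewrite n0.
  by rewrite /eta !ge_min lexx orbT.
have hb_ge0 n : 0 <= hb n1 alpha eta n.
  by rewrite /hb; case: leqP => _; [exact: ltW | exact: powR_ge0].
(* Levels up to [n1] and the tail each take half of [rho]; the tail converges because alpha > 1. *)
have hb_sum n : (M ^ g)%:R * \sum_(1 <= m' < n) hb n1 alpha eta m' <= rho R M g.
  apply: (@le_trans _ _ ((M ^ g)%:R * \sum_(1 <= m' < n1.+1 + n) hb n1 alpha eta m')).
    rewrite ler_wpM2l ?(ltW Mg0) //; case: (leqP 1 n) => n0; last first.
      by rewrite [leLHS]big_geq ?(ltnW n0) //; apply: sumr_ge0 => i _; exact: hb_ge0.
    by rewrite (@big_cat_nat _ _ _ n 1 (n1.+1 + n)) ?leq_addl //= lerDl; apply: sumr_ge0 => i _; exact: hb_ge0.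
  rewrite (@big_cat_nat _ _ _ n1.+1 1) ?leq_addr //= mulrDr.
  have s1 : (M ^ g)%:R * \sum_(1 <= m' < n1.+1) hb n1 alpha eta m' <= rho R M g / 2.
    apply: (@le_trans _ _ ((M ^ g)%:R * \sum_(1 <= m' < n1.+1) (rho R M g / (2 * (M ^ g)%:R * n1%:R)))).
      rewrite ler_wpM2l ?(ltW Mg0) // big_nat [leRHS]big_nat; apply: ler_sum => i /andP[_ ii].
      by rewrite /hb -ltnS ii /eta !ge_min lexx !orbT.
    rewrite sumr_const_nat subSS subn0 -[X in _ * X]mulr_natl le_eqVlt; apply/orP; left; apply/eqP.
    by field; rewrite !gt_eqF.
  have s2 : (M ^ g)%:R * \sum_(n1.+1 <= m' < n1.+1 + n) hb n1 alpha eta m' <= rho R M g / 2.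
    apply: (@le_trans _ _ ((M ^ g)%:R * (n1%:R `^ (- (2 * sigma)) / (2 * sigma)))).
      rewrite ler_wpM2l ?(ltW Mg0) //; apply: le_trans (sum_powRN_le n sig20 n10).
      rewrite big_nat [leRHS]big_nat; apply: ler_sum => i /andP[ii _].
      by rewrite /hb leqNgt ii.
    have ntn : (M ^ g)%:R * 2 / (2 * sigma * rho R M g) * n1%:R `^ (- (2 * sigma)) <= 1.
      by apply: ntP; rewrite /n1; move: (M ^ _)%N (4 * _)%N => ? ?; clear; lia.
    have -> : (M ^ g)%:R * (n1%:R `^ (- (2 * sigma)) / (2 * sigma)) =
       (M ^ g)%:R * 2 / (2 * sigma * rho R M g) * n1%:R `^ (- (2 * sigma)) * (rho R M g / 2).
      by field; rewrite !gt_eqF.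
    by rewrite -[leRHS]mul1r ler_wpM2r // ltW // divr_gt0.
  by rewrite [leRHS](splitr (rho R M g)) lerD.
have s01 : 0 <= x <= 1 by rewrite (ltW x0) x1.
have Nf T : (n1 < T)%N -> stepf M e k h g (kk0 M) alpha beta theta T <= T%:R `^ (- beta).
  move=> nT; apply: (nsP T _).1; apply: leq_ltn_trans nT; rewrite /n1.
  by move: (M ^ _)%N (4 * _)%N => ? ?; clear; lia.
have Nh T : (n1 < T)%N -> steph M e k h g (kk0 M) alpha beta theta x T <= T%:R `^ (- alpha).
  move=> nT; apply: (nsP T _).2; apply: leq_ltn_trans nT; rewrite /n1.
  by move: (M ^ _)%N (4 * _)%N => ? ?; clear; lia.
have bounds n b := @finite_bounds R M N e k M2 k2 ke p J p01 pJ h g n1 (kk0 M) alpha beta theta eta x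
  (leqnn _) (leqnn _) n1h kkg kkT a0 b0 (ltW th0) s01 ts hb_le fb_le hb_sum Nf Nh HJ delta base deltaP n b.
(* The last level whose k ancestors all fit below [N]. *)
pose mm := (N - k.-1)%N.
pose chain_bad (w : {ffun 'I_(M ^ N) * 'I_(M ^ N) -> bool}) :=
  [exists m' : 'I_mm.+1, (0 < m')%N && NF e k m' w (v %/ M ^ m')%N].
have bad : Pr p chain_bad <= 2^-1.
  apply: (@le_trans _ _ (\sum_(m' < mm.+1 | (0 < m')%N) hb n1 alpha eta m')).
    apply: le_trans (Pr_exists p01 _ _) _; apply: ler_sum => m' m0.
    have m'm : (m' <= mm)%N by rewrite -ltnS.
    have m'N : (m' <= N)%N by apply: leq_trans m'm _; exact: leq_subr.
    apply: (bounds _ _ _ _).2; rewrite ?m0 ?blk_lt //.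
    by move: m'm kN k2; rewrite /mm; clear; lia.
  have -> : \sum_(m' < mm.+1 | (0 < m')%N) hb n1 alpha eta m' =
      \sum_(1 <= m' < mm.+1) hb n1 alpha eta m'.
    by rewrite big_mkcond big_ord_recl /= add0r big_add1 /= big_mkord.
  have := hb_sum mm.+1; set S := \sum_(_ <= _ < _) _ => Sr.
  have S0 : 0 <= S by apply: sumr_ge0 => i _; exact: hb_ge0.
  have M1 : 1 <= (M ^ g)%:R :> R by rewrite ler1n.
  apply: (@le_trans _ _ (rho R M g)).
    by apply: le_trans Sr; rewrite -[leLHS]mul1r ler_wpM2r.
  (* [rho] is at most 1/2, so the sum required by the induction also bounds the final failure
     probability. *)
  rewrite /rho exprS invfM -[leRHS]mulr1 ler_wpM2l ?invr_ge0 //.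
  by rewrite invf_le1 ?exprn_gt0 // exprn_ege1 // ler1n.
apply: (@le_trans _ _ (Pr p (fun w => ~~ chain_bad w))).
  by rewrite Pr_compl //; lra.
apply: Pr_le => // w nbad.
have e2 : (2 <= e)%N by apply: leq_trans ke; move: k2; clear; lia.
have /existsP[j bj] : [exists j : 'I_k, big e (mm + j) w v].
  apply: NF_chain => //; first by move: kN k2; rewrite /mm; clear; lia.
  move=> m' /andP[m0 m'm]; apply: contra nbad => nf.
  have m'm1 : (m' < mm.+1)%N by [].
  by apply/existsP; exists (Ordinal m'm1); rewrite /= m0.
have jN : (mm + j <= N)%N by have := ltn_ord j; move: kN k2; rewrite /mm; clear; lia.
apply: leq_trans (subset_leq_card (cl_mono w v jN)).
(* A big cluster of level mm + j has at least M^(mm + j - 1) vertices, and mm + j - 1 >= N - k. *)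
apply: (@leq_trans (M ^ (mm + j).-1)).
  by rewrite leq_exp2l //; move: kN k2; rewrite /mm; clear; lia.
have mmj : (mm + j = (mm + j).-1.+1)%N.
  by rewrite prednK //; move: kN k2; rewrite /mm; clear; lia.
have M4 : (2 <= M ^ e)%N.
  by apply: (@leq_trans (M ^ 1)); [rewrite expn1 | rewrite leq_exp2l // ltnW].
move: bj; rewrite mmj /big expnS /= => bj; rewrite -(leq_pmul2r (Mn_gt0 e)).
move: (Mn_gt0 (mm + j).-1) M2 M4 bj.
rewrite -mmj; move: (M ^ (mm + j).-1)%N (M ^ e)%N #|_| => A E c A0 M2' E2 bj.
have : (M * A <= A * E * M.-1)%N.
  rewrite mulnC -mulnA leq_mul2l; apply/orP; right.
  by apply: (@leq_trans (2 * M.-1)); [move: M2'; clear; lia | rewrite leq_mul2r E2 orbT].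
have : (M * A * E = A * E * M.-1 + A * E)%N.
  by rewrite -mulnSr prednK ?(ltnW M2') // -mulnA mulnC.
by move: bj; move: (M * A * E)%N (A * E * M.-1)%N (A * E)%N (c * E)%N (M * A)%N => p0 p1 p2 p3 p4; clear; lia.
Qed.

End FinitePercolation.

(** * Transfer to the hierarchical lattice *)

Section Encoding.
Variables (L d : nat).
Hypothesis L2 : (2 <= L)%N.
Hypothesis d1 : (1 <= d)%N.
Local Open Scope nat_scope.

Definition digit_block (c : nat) : seq nat := [seq (c %/ L ^ i) %% L | i <- iota 0 d].

Let L0 : 0 < L. Proof. exact: ltnW L2. Qed.
Let M := L ^ d.

Lemma leq2_expn : 2 <= M.
Proof. by apply: (@leq_trans (L ^ 1)); [rewrite expn1 | rewrite /M leq_exp2l]. Qed.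
Let M2 := leq2_expn.
Let M0 : 0 < M. Proof. exact: ltnW M2. Qed.

Lemma digits_inj n c c' : c < L ^ n -> c' < L ^ n ->
  [seq (c %/ L ^ i) %% L | i <- iota 0 n] = [seq (c' %/ L ^ i) %% L | i <- iota 0 n] -> c = c'.
Proof.
elim: n c c' => [|n IH] c c'; first by rewrite expn0; case: c c' => [|?] [|?].
rewrite expnSr => cn c'n.
have E b : [seq (b %/ L ^ i) %% L | i <- iota 0 n.+1] =
    b %% L :: [seq (b %/ L %/ L ^ i) %% L | i <- iota 0 n].
  rewrite /= expn0 divn1; congr cons; rewrite (iotaDl 1 0) -map_comp.
  by apply: eq_map => i /=; rewrite expnS divnMA.
rewrite !E => -[c0 /IH cc']; rewrite (divn_eq c L) (divn_eq c' L) c0 cc' //.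
  by rewrite ltn_divLR.
by rewrite ltn_divLR.
Qed.

Lemma digit_block0 : digit_block 0 = nseq d 0.
Proof.
rewrite /digit_block -{2}(size_iota 0 d); elim: (iota 0 d) => //= i s ->.
by rewrite div0n mod0n.
Qed.

Definition digit (x i : nat) := x %/ M ^ i %% M.
Definition ndigits x := if x == 0 then 0 else (trunc_log M x).+1.
Definition enc_seq x := [seq digit_block (digit x i) | i <- iota 0 (ndigits x)].

Lemma ndigits_lt x : x < M ^ ndigits x.
Proof. by rewrite /ndigits; case: eqP => [->|_] //; exact: trunc_log_ltn. Qed.

Lemma digit_gt x i : ndigits x <= i -> digit x i = 0.
Proof.
move=> xi; rewrite /digit divn_small ?mod0n //.
by apply: leq_trans (ndigits_lt x) _; rewrite leq_exp2l.
Qed.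

Lemma enc_hwf x : hwf L d (enc_seq x).
Proof.
apply/andP; split.
  apply/allP => b /mapP[i _ ->]; rewrite size_map size_iota eqxx /=.
  by apply/allP => c /mapP[j _ ->]; rewrite ltn_pmod.
rewrite /enc_seq /ndigits; have [->//|x0] := eqVneq x 0.
apply/orP; right; rewrite -addn1 iotaD map_cat last_cat add0n /=.
set t := trunc_log M x; rewrite -digit_block0; apply/eqP => /digits_inj.
rewrite ltn_pmod // expn_gt0 L0 => /(_ isT isT).
have /andP[tx xt] : M ^ t <= x < M ^ t.+1 by apply: trunc_log_bounds; rewrite // lt0n.
rewrite /digit modn_small; last by rewrite ltn_divLR ?expn_gt0 ?M0 ?L0 // -expnS.
move=> xt0; have : 0 < x %/ M ^ t by rewrite divn_gt0 // expn_gt0 M0.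
by rewrite xt0.
Qed.

(** Base M digits are the coordinates of the vertex, each spelled out in base L as a block of d
    numbers. The numbers below M^N thus become the block of level N around the origin, and levels
    become equality of quotients. *)
Definition enc (x : nat) : hvert L d := exist _ (enc_seq x) (enc_hwf x).

Lemma enc0 : enc 0 = horigin L d.
Proof. exact: val_inj. Qed.

Lemma hblock_enc x i : hblock (enc x) i = digit_block (digit x i).
Proof.
rewrite /hblock /=; case: (ltnP i (ndigits x)) => xi.
  by rewrite (nth_map 0) ?size_iota // nth_iota.
by rewrite nth_default ?size_map ?size_iota // digit_gt // digit_block0.
Qed.

Lemma digits_quotient x y j : (forall i, j <= i -> digit x i = digit y i) ->
  x %/ M ^ j = y %/ M ^ j.
Proof.
move=> xy; have : x %/ M ^ (maxn (ndigits x) (ndigits y) + j) = y %/ M ^ (maxn (ndigits x) (ndigits y) + j).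
  rewrite !divn_small //; [apply: leq_trans (ndigits_lt y) _|apply: leq_trans (ndigits_lt x) _];
    by rewrite leq_exp2l // (leq_trans _ (leq_addr _ _)) // ?leq_maxr ?leq_maxl.
elim: (maxn _ _) => [//|n IH]; rewrite addSn => En; apply: IH.
rewrite (divn_eq (x %/ _) M) (divn_eq (y %/ _) M) -!divnMA -!expnSr En.
by congr (_ + _); apply: xy; rewrite leq_addl.
Qed.

Lemma hlevel_enc_le x y j : (hlevel (enc x) (enc y) <= j) = (x %/ M ^ j == y %/ M ^ j).
Proof.
apply/idP/eqP => [hj|xy].
  apply: digits_quotient => i ji; apply: contraTeq hj => xyi; rewrite -ltnNge.
  have bi : hblock (enc x) i != hblock (enc y) i.
    rewrite !hblock_enc; apply: contra xyi => /eqP /digits_inj ->; rewrite ?eqxx //.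
      by rewrite ltn_pmod.
    by rewrite ltn_pmod.
  have ilt : i < maxn (size (proj1_sig (enc x))) (size (proj1_sig (enc y))).
    rewrite ltnNge; apply: contra bi; rewrite geq_max => /andP[xi yi].
    by rewrite /hblock !nth_default.
  apply: (@leq_trans i.+1) => //; rewrite /hlevel.
  exact: (@leq_bigmax_cond _ (fun i : 'I_(maxn _ _) => hblock (enc x) i != hblock (enc y) i)
    (fun i => i.+1) (Ordinal ilt)).
apply/bigmax_leqP => i; apply: contraNT; rewrite -leqNgt => ji.
rewrite !hblock_enc /digit; apply/eqP; congr (digit_block (_ %% _)).
by rewrite -(subnKC ji) expnD !divnMA xy.
Qed.

Lemma hlevel_enc x y j : x %/ M ^ j != y %/ M ^ j -> x %/ M ^ j.+1 = y %/ M ^ j.+1 ->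
  hlevel (enc x) (enc y) = j.+1.
Proof.
rewrite -hlevel_enc_le -ltnNge => h1 /eqP; rewrite -hlevel_enc_le => h2.
by apply/eqP; rewrite eqn_leq h2 h1.
Qed.

Lemma hlevel_refl (v : hvert L d) : hlevel v v = 0.
Proof. by apply/eqP; rewrite -leqn0; apply/bigmax_leqP => i; rewrite eqxx. Qed.

Lemma hlevel_sym (u v : hvert L d) : hlevel u v = hlevel v u.
Proof.
rewrite /hlevel maxnC; apply: eq_bigl => i; by rewrite eq_sym.
Qed.

Lemma enc_inj : injective enc.
Proof.
move=> x y xy; have := hlevel_enc_le x y 0; rewrite xy hlevel_refl leqnn expn0 !divn1.
by move/esym/eqP.
Qed.

Lemma hedge_default_subproof : #|` [fset enc 0; enc 1]%fset| == 2.
Proof. by rewrite cardfs2; case: eqP => // /enc_inj. Qed.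

(** The default edge only makes the function total; it is the value when [x = y]. *)
Definition hedge_of (x y : nat) : hedge L d :=
  insubd (exist _ [fset enc 0; enc 1]%fset hedge_default_subproof : hedge L d)
    [fset enc x; enc y]%fset.

Lemma hedge_of_val x y : x != y -> proj1_sig (hedge_of x y) = [fset enc x; enc y]%fset.
Proof.
move=> xy; rewrite -[proj1_sig _]/(val (hedge_of x y)) insubdK // unfold_in.
by rewrite cardfs2 (inj_eq enc_inj) xy.
Qed.

Lemma hedge_len_of x y : x != y -> hedge_len (hedge_of x y) = L ^ hlevel (enc x) (enc y).
Proof.
move=> xy; rewrite /hedge_len hedge_of_val //; set s := enum_fset _.
have ms u : (u \in s) = (u == enc x) || (u == enc y) by rewrite /s -/(_ \in _) in_fset2.
apply/eqP; rewrite eqn_leq; apply/andP; split.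
  apply/bigmax_leqP_seq => u; rewrite ms => us _; apply/bigmax_leqP_seq => v; rewrite ms => vs _.
  rewrite /hnorm; case/orP: us => /eqP ->; case/orP: vs => /eqP ->;
    by rewrite ?hlevel_refl ?expn0 ?expn_gt0 ?L0 // hlevel_sym.
apply: (@leq_trans (\max_(v <- s) hnorm (enc x) v)).
  by apply: leq_bigmax_seq; rewrite // ms eqxx orbT.
by apply: (@leq_bigmax_seq _ s xpredT (fun u => \max_(v <- s) hnorm u v)); rewrite // ms eqxx.
Qed.

Lemma hedge_of_inj x y x' y' : x < y -> x' < y' -> hedge_of x y = hedge_of x' y' ->
  (x, y) = (x', y').
Proof.
move=> xy x'y' /(congr1 (@proj1_sig _ _)); rewrite !hedge_of_val ?ltn_eqF // => /fsetP E.
have mem z : ((z == x) || (z == y)) = ((z == x') || (z == y')).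
  by have := E (enc z); rewrite !in_fset2 !(inj_eq enc_inj).
have := mem x; have := mem y; have := mem x'; have := mem y'; rewrite !eqxx !orbT /=.
by move: xy x'y'; clear; move=> *; congr pair; lia.
Qed.

End Encoding.

(** * The law of the model restricted to a finite block *)

Section FiniteMarginal.
Local Open Scope classical_set_scope.
Variables (R : realType) (L d : nat).
Hypothesis L2 : (2 <= L)%N.
Hypothesis d1 : (1 <= d)%N.
Variables (dT : measure_display) (T : measurableType dT) (P : probability T R).
Variables (q : R) (J : hedge L d -> R).
Variables (site : hvert L d -> set T) (bond : hedge L d -> set T).
Hypothesis model : site_bond_model P q J site bond.
Variable N : nat.

Local Notation V := 'I_((L ^ d) ^ N).
Local Notation C := (V * V)%type.
Local Notation en := (enc L2 d1).
Local Notation hed := (hedge_of L2 d1).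

(* The unused coordinates [c.2 < c.1] carry the sure event. *)
Definition coord_event (c : C) : set T :=
  if c.1 == c.2 then site (en c.1)
  else if (c.1 < c.2)%N then bond (hed c.1 c.2) else setT.

Definition coord_prob (c : C) : R :=
  if c.1 == c.2 then q
  else if (c.1 < c.2)%N then 1 - expR (- J (hed c.1 c.2)) else 1.

Definition cfg (t : T) : {ffun C -> bool} := [ffun c => `[< coord_event c t >]].

Let idx (c : C) : (hvert L d + hedge L d)%type :=
  if c.1 == c.2 then inl (en c.1) else inr (hed c.1 c.2).
Let A (i : (hvert L d + hedge L d)%type) : set T :=
  match i with inl x => site x | inr e => bond e end.

Lemma coord_event_measurable c : measurable (coord_event c).
Proof.
case: model => ms mb _ _ _; rewrite /coord_event; case: ifP => _; first exact: ms.
by case: ifP => _; [exact: mb | exact: measurableT].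
Qed.

Let signed (w : {ffun C -> bool}) c := if w c then coord_event c else ~` coord_event c.

Let signed_measurable w c : measurable (signed w c).
Proof.
by rewrite /signed; case: (w c); [|apply: measurableC]; exact: coord_event_measurable.
Qed.

Let P_positive (s : seq C) : uniq s ->
  P (\big[setI/setT]_(c <- s) coord_event c) = (\prod_(c <- s) coord_prob c)%:E.
Proof.
move=> us; case: model => _ _ ps pb indep.
pose nd (c : C) := (c.1 <= c.2)%N.
have inlI (u v : hvert L d) : inl u = inl v :> (hvert L d + hedge L d)%type -> u = v by case.
have inrI (u v : hedge L d) : inr u = inr v :> (hvert L d + hedge L d)%type -> u = v by case.
have evA c : nd c -> coord_event c = A (idx c).
  rewrite /nd /coord_event /idx leq_eqVlt val_eqE; case: eqP => //= _ ->.
  by [].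
have PA c : nd c -> P (A (idx c)) = (coord_prob c)%:E.
  rewrite /nd /coord_prob /idx leq_eqVlt val_eqE; case: eqP => /= _; first by rewrite ps.
  by move=> ->; rewrite pb.
have evT c : ~~ nd c -> coord_event c = setT /\ coord_prob c = 1.
  rewrite /nd /coord_event /coord_prob -ltnNge => c21.
  have -> : (c.1 == c.2) = false by apply/eqP => c12; rewrite c12 ltnn in c21.
  by rewrite ltnNge (ltnW c21).
have -> : \big[setI/setT]_(c <- s) coord_event c =
    \big[setI/setT]_(i <- [seq idx c | c <- s & nd c]) A i.
  rewrite big_map big_filter [RHS]big_mkcond; apply: eq_bigr => c _.
  by case: ifP => [/evA //|/negbT/evT[]].
rewrite -bigcap_seq indep; last first.
  rewrite map_inj_in_uniq ?filter_uniq // => -[x y] [x' y'].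
  rewrite !mem_filter /nd /idx /= => /andP[xy _] /andP[x'y' _].
  case: eqP => [xy1|/eqP xy1]; case: eqP => [xy2|/eqP xy2] //.
    by move=> /inlI /enc_inj /val_inj xx'; rewrite -xy1 -xy2 xx'.
  move=> /inrI /hedge_of_inj H.
  have : ((x : nat, y : nat) = (x' : nat, y' : nat)).
    by apply: H; rewrite ltn_neqAle ?xy ?x'y' ?val_eqE ?xy1 ?xy2.
  by case=> /val_inj -> /val_inj ->.
rewrite big_map big_filter big_mkcond /= -prodEFin; apply: eq_bigr => c _.
by case: ifP => [/PA //|/negbT/evT[_ ->]].
Qed.

(** Independence is given for the events themselves. Complements are introduced one coordinate at a
    time, by subtracting the probability with the event from the one without it. *)
Let P_signed w (s1 s2 : seq C) : uniq (s1 ++ s2) ->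
  P (\big[setI/setT]_(c <- s2) coord_event c `&` \big[setI/setT]_(c <- s1) signed w c) =
  (\prod_(c <- s2) coord_prob c *
   \prod_(c <- s1) (if w c then coord_prob c else 1 - coord_prob c))%:E.
Proof.
elim: s1 s2 => [|c s1 IH] s2 us.
  by rewrite !big_nil setIT mulr1 P_positive.
have us2 : uniq (s1 ++ s2) by case/andP: us.
have ucs2 : uniq (s1 ++ c :: s2).
  by rewrite -(cat1s c s2) uniq_catCA.
have := IH _ us2; have := IH _ ucs2; rewrite !big_cons.
set B := \big[_/_]_(_ <- s2) _; set D := \big[_/_]_(_ <- s1) _.
set pB := \prod_(_ <- s2) _; set pD := \prod_(_ <- s1) _ => IH1 IH2.
have mB : measurable B by apply: bigsetI_measurable => i _; exact: coord_event_measurable.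
have mD : measurable D by apply: bigsetI_measurable => i _; exact: signed_measurable.
rewrite /signed; case: ifP => wc.
  by rewrite setICA setIA IH1 mulrCA mulrA.
have -> : B `&` (~` coord_event c `&` D) = (B `&` D) `\` coord_event c.
  by rewrite setDE setIAC -setIA.
rewrite measureD //; last 3 first.
- exact: measurableI.
- exact: coord_event_measurable.
- by rewrite ltey_eq fin_num_measure //; exact: measurableI.
have -> : B `&` D `&` coord_event c = coord_event c `&` B `&` D.
  by rewrite [LHS]setIC setIA.
by rewrite /= IH1 IH2 -EFinB; congr EFin; ring.
Qed.

Lemma cfg_eqE w : [set t | cfg t = w] = \big[setI/setT]_(c <- enum {: C}) signed w c.
Proof.
rewrite -bigcap_seq; apply/seteqP; split=> t /=.
  by move=> <- c _; rewrite /signed /cfg ffunE; case: asboolP.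
move=> H; apply/ffunP => c; have := H c; rewrite /= mem_enum inE => /(_ isT).
by rewrite /signed /cfg ffunE; case: (w c) => h; apply/asboolP.
Qed.

Lemma cfg_measurable w : measurable [set t | cfg t = w].
Proof. by rewrite cfg_eqE; apply: bigsetI_measurable => c _; exact: signed_measurable. Qed.

Lemma P_cfg_eq w : P [set t | cfg t = w] = (wt coord_prob w)%:E.
Proof.
rewrite cfg_eqE; have := @P_signed w (enum {: C}) [::].
rewrite cats0 enum_uniq !big_nil setTI mul1r => -> //.
by rewrite /wt big_enum.
Qed.

Let cfg_set (E : pred {ffun C -> bool}) : [set t | E (cfg t)] =
  \big[setU/set0]_(w <- enum E) [set t | cfg t = w].
Proof.
rewrite -bigcup_seq; apply/seteqP; split=> t /= => [Et|[w /=]].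
  by exists (cfg t) => //=; rewrite mem_enum.
by rewrite mem_enum => Ew ->.
Qed.

Lemma cfg_pred_measurable (E : pred {ffun C -> bool}) : measurable [set t | E (cfg t)].
Proof. by rewrite cfg_set; apply: bigsetU_measurable => w _; exact: cfg_measurable. Qed.

Lemma P_cfg (E : pred {ffun C -> bool}) : P [set t | E (cfg t)] = (Pr coord_prob E)%:E.
Proof.
rewrite cfg_set /Pr -big_enum /=; have := enum_uniq E.
elim: (enum E) => [_|w s IH /= /andP[ws us]]; first by rewrite !big_nil measure0.
rewrite !big_cons measureU; last 3 first.
- exact: cfg_measurable.
- by apply: bigsetU_measurable => w' _; exact: cfg_measurable.
- rewrite -bigcup_seq; apply/seteqP; split=> t //= [tw [w' /= w's tw']].
  by move: ws; rewrite -tw tw' w's.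
by rewrite /= IH // P_cfg_eq EFinD.
Qed.

End FiniteMarginal.

(** * Measurability and size of the cluster of the origin *)

Section InfiniteCluster.
Local Open Scope classical_set_scope.
Variables (L d : nat) (dT : measure_display) (T : measurableType dT).
Variables (site : hvert L d -> set T) (bond : hedge L d -> set T).
Hypothesis site_measurable : forall x, measurable (site x).
Hypothesis bond_measurable : forall e, measurable (bond e).

(** Explicit paths range over a countable type, which presents connection as a countable union of
    measurable events. *)
Fixpoint open_path (t : T) (x : hvert L d) (s : seq (hvert L d)) (y : hvert L d) : Prop :=
  if s is z :: s' then open_adj site bond t x z /\ open_path t z s' y else x = y.

Lemma open_pathP t x y :
  @clos_refl_trans _ (open_adj site bond t) x y <-> exists s, open_path t x s y.
Proof.
split=> [|[s]].
  elim=> [u v uv|u|u v z _ [s1 h1] _ [s2 h2]]; first by exists [:: v].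
    by exists [::].
  exists (s1 ++ s2); elim: s1 u h1 => [u ->//|b s1 IH u /= [ub bv]].
  by split=> //; exact: IH.
elim: s x => [x ->|z s IH x /= [xz zy]]; first exact: rt_refl.
by apply: rt_trans (IH _ zy); exact: rt_step.
Qed.

Lemma open_adj_measurable x y : measurable [set t | open_adj site bond t x y].
Proof.
pose F (e : hedge L d) : set T :=
  if [&& x \in proj1_sig e, y \in proj1_sig e & x != y]
  then site x `&` site y `&` bond e else set0.
have -> : [set t | open_adj site bond t x y] = \bigcup_e F e.
  apply/seteqP; split=> t /=.
    move=> [e [xe ye xy [sx sy] be]]; exists e => //.
    by rewrite /F xe ye xy.
  move=> [e _]; rewrite /F; case: ifP => // /and3P[xe ye xy] [[sx sy] be].
  by exists e; split.
apply: countable_bigcupT_measurable => [|e]; first exact: countableP.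
rewrite /F; case: ifP => _; last exact: measurable0.
by apply: measurableI => //; apply: measurableI.
Qed.

Lemma open_path_measurable x s y : measurable [set t | open_path t x s y].
Proof.
elim: s x => [x|z s IH x] /=.
  have [->|xy] := eqVneq x y.
    by rewrite (_ : [set _ | _] = setT) //; apply/seteqP; split.
  rewrite (_ : [set _ | _] = set0) //; apply/seteqP; split=> t //= xy'.
  by rewrite xy' eqxx in xy.
rewrite (_ : [set _ | _] = [set t | open_adj site bond t x z] `&` [set t | open_path t z s y]) //.
by apply: measurableI => //; exact: open_adj_measurable.
Qed.

Lemma in_cluster0_measurable y : measurable [set t | cluster0 site bond t y].
Proof.
rewrite (_ : [set _ | _] = site (horigin L d) `&`
    \bigcup_s [set t | open_path t (horigin L d) s y]); last first.
  apply/seteqP; split=> t /= [st].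
    by move=> /open_pathP[s hs]; split=> //; exists s.
  by move=> [s _ hs]; split=> //; apply/open_pathP; exists s.
apply: measurableI => //; apply: countable_bigcupT_measurable => [|s]; first exact: countableP.
exact: open_path_measurable.
Qed.

(** A set of vertices is infinite exactly when it has members of arbitrarily large code, a countable
    condition. *)
Lemma infinite_cluster0E : [set t | ~ finite_set (cluster0 site bond t)] =
  \bigcap_n \bigcup_y (if (n <= choice.pickle y)%N then [set t | cluster0 site bond t y] else set0).
Proof.
apply/seteqP; split=> t /=.
  move=> inf n _; apply: contrapT => nex; apply: inf.
  apply: (@sub_finite_set _ _ [set y : hvert L d | (choice.pickle y < n)%N]).
    move=> y yc /=; rewrite ltnNge; apply/negP => ny; apply: nex.
    by exists y => //; rewrite ny.
  have : finite_set ((fun i => odflt (horigin L d) (choice.unpickle i)) @` `I_n).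
    by apply: finite_image; exact: finite_II.
  apply: sub_finite_set => y /= yn; exists (choice.pickle y) => //.
  by rewrite choice.pickleK.
move=> big_pickle /finite_seqP[s sE].
have [y _] := big_pickle (\max_(y <- s) choice.pickle y).+1 I.
case: ifP => // hy yc; have : y \in s.
  by move: yc; rewrite /= sE.
by move=> ys; have := leq_trans hy (leq_bigmax_seq _ ys isT); rewrite ltnn.
Qed.

Lemma infinite_cluster0_measurable : measurable [set t | ~ finite_set (cluster0 site bond t)].
Proof.
rewrite infinite_cluster0E; apply: bigcapT_measurable => n.
apply: countable_bigcupT_measurable => [|y]; first exact: countableP.
by case: ifP => _; [exact: in_cluster0_measurable | exact: measurable0].
Qed.

Hypothesis L2 : (2 <= L)%N.
Hypothesis d1 : (1 <= d)%N.
Variable N : nat.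
Local Notation V := 'I_((L ^ d) ^ N).
Local Notation cf := (@cfg L d L2 d1 dT T site bond N).

Lemma adj_open t (x y : V) : adj (cf t) x y ->
  open_adj site bond t (enc L2 d1 x) (enc L2 d1 y).
Proof.
case/and4P => xy; rewrite /cfg !ffunE => /asboolP + /asboolP + /asboolP.
rewrite /coord_event !eqxx /= => sx sy bxy.
exists (hedge_of L2 d1 (bond_of x y).1 (bond_of x y).2).
have nb : ((bond_of x y).1 : nat) != (bond_of x y).2.
  by rewrite /bond_of; case: ifP => _ /=; rewrite ?val_eqE // eq_sym.
have lb : ((bond_of x y).1 < (bond_of x y).2)%N.
  rewrite /bond_of; case: ifP => //= /negbT; rewrite -leqNgt leq_eqVlt val_eqE eq_sym.
  by rewrite (negbTE xy).
rewrite hedge_of_val //; split => //.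
- by rewrite in_fset2 /bond_of; case: ifP => _ /=; rewrite eqxx ?orbT.
- by rewrite in_fset2 /bond_of; case: ifP => _ /=; rewrite eqxx ?orbT.
- by rewrite (inj_eq (@enc_inj _ _ L2 d1)).
- by move: bxy; rewrite lb -val_eqE (negbTE nb).
Qed.

(** A closed origin also belongs to its own [cl]; a second vertex in the cluster forces the origin
    to be open. *)
Lemma cl_cluster0 t (x0 y : V) : x0 = 0%N :> nat -> (1 < #|cl N (cf t) x0|)%N ->
  y \in cl N (cf t) x0 -> cluster0 site bond t (enc L2 d1 y).
Proof.
move=> x00 big0 yc.
have conn : forall u v, connect (adjn N (cf t)) u v ->
    @clos_refl_trans _ (open_adj site bond t) (enc L2 d1 u) (enc L2 d1 v).
  move=> u v /connectP[p]; elim: p u => [u _ -> |z p IH u /= /andP[/andP[_ uz] zp] vp].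
    exact: rt_refl.
  by apply: rt_trans (IH _ zp vp); apply: rt_step; exact: adj_open.
split; last by rewrite -(@enc0 L d L2 d1) -x00; apply: conn; move: yc; rewrite inE.
have /set0Pn[z /setD1P[zx]] : cl N (cf t) x0 :\ x0 != finset.set0.
  by rewrite -card_gt0; move: big0; rewrite (cardsD1 x0) cl_refl.
rewrite inE => /connectP[[|u p] /=]; first by move=> _ zx'; rewrite zx' eqxx in zx.
case/andP => /andP[_ /adj_open[e [_ _ _ [sx _] _]]] _ _.
by rewrite -(@enc0 L d L2 d1) -x00.
Qed.

Lemma cluster0_large t (x0 : V) (n : nat) : x0 = 0%N :> nat -> (1 < n)%N ->
  (n <= #|cl N (cf t) x0|)%N ->
  exists s : seq (hvert L d), [/\ uniq s, (n <= size s)%N &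
    forall y, y \in s -> cluster0 site bond t y].
Proof.
move=> x00 n1 nc; exists [seq enc L2 d1 (y : V) | y <- enum (cl N (cf t) x0)]; split.
- by rewrite map_inj_uniq ?enum_uniq // => u v /enc_inj /val_inj.
- by rewrite size_map -cardE.
- move=> y /mapP[z]; rewrite mem_enum => zc ->.
  by apply: cl_cluster0 zc => //; exact: leq_trans nc.
Qed.

End InfiniteCluster.

(** * Lower bounds for the kernel *)

Section Kernel.
Variables (R : realType) (L d : nat).
Hypothesis L2 : (2 <= L)%N.
Hypothesis d1 : (1 <= d)%N.

Lemma kernel15_hedge_of (a : R) N0 N1 (x y : nat) : x != y ->
  kernel15 a N0 N1 (hedge_of L2 d1 x y) =
  if (N1 <= L ^ hlevel (enc L2 d1 x) (enc L2 d1 y))%N then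
    a * (L ^ d)%:R * ln (ln (L ^ hlevel (enc L2 d1 x) (enc L2 d1 y))%:R) /
      ((L ^ d) ^ (2 * hlevel (enc L2 d1 x) (enc L2 d1 y)))%:R
  else N0%:R.
Proof.
move=> xy; rewrite /kernel15 hedge_len_of //; set l := hlevel _ _.
by rewrite -(expnM L l) -(expnM L d) mulnCA [in RHS]mulnCA (mulnC d).
Qed.

Lemma ln_expn_ge (l T : nat) : (T <= 2 * l)%N ->
  T%:R * (ln 2 / 2) <= ln (L ^ l)%:R :> R.
Proof.
move=> Tl; have ln2 : 0 <= ln 2 :> R by rewrite ln_ge0 // ler1n.
apply: (@le_trans _ _ (l%:R * ln 2)).
  have : T%:R <= 2 * l%:R :> R by rewrite -natrM ler_nat.
  by move=> ?; nra.
rewrite natrX lnXn ?ltr0n ?(ltnW L2) // -[leRHS]mulr_natl ler_wpM2l //.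
by rewrite ler_ln ?posrE ?ltr0n ?(ltnW L2) // ler_nat.
Qed.

(** For T <= 2 l, ln (ln L^l) is at least ln T plus the constant ln c0, and the gap between [a] and
    [theta] absorbs this constant for large [T]. *)
Lemma lnln_eventually (a theta : R) : 0 < theta -> theta < a ->
  exists n0, forall T l, (n0 < T)%N -> (T <= 2 * l)%N ->
    theta * ln T%:R <= a * ln (ln (L ^ l)%:R).
Proof.
move=> th0 tha; pose c0 : R := ln 2 / 2.
have c00 : 0 < c0 by rewrite divr_gt0 // ln_gt0 // ltr1n.
have a0 : 0 < a by exact: lt_trans tha.
have ath : 0 < a - theta by rewrite subr_gt0.
exists (Num.truncn (expR (a * - ln c0 / (a - theta)))) => T l nT Tl.
have T0 : (0 < T)%N by exact: leq_trans nT.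
have t0 : 0 < T%:R :> R by rewrite ltr0n.
have lnT : a * - ln c0 / (a - theta) <= ln T%:R.
  rewrite -ler_expR lnK ?posrE //; apply: (le_trans (ltW (truncnS_gt _))).
  by rewrite ler_nat.
rewrite ler_pdivrMr // in lnT.
apply: (@le_trans _ _ (a * ln (T%:R * c0))).
  rewrite lnM ?posrE // mulrDr; move: lnT; rewrite mulrN; lra.
have Tc : 0 < T%:R * c0 by rewrite mulr_gt0.
have cl := ln_expn_ge Tl.
by rewrite ler_pM2l // ler_ln ?posrE // (lt_le_trans Tc).
Qed.

Lemma kernel15_ge0 (a : R) N0 N1 (e : hedge L d) : 0 <= a -> expR 1 <= N1%:R :> R ->
  0 <= kernel15 a N0 N1 e.
Proof.
move=> a0 eN; rewrite /kernel15; case: ifP => // Ne.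
have ln1 : 1 <= ln (hedge_len e)%:R :> R.
  have e1 : expR 1 <= (hedge_len e)%:R :> R by apply: le_trans eN _; rewrite ler_nat.
  by rewrite -ler_expR lnK // posrE; apply: lt_le_trans e1; exact: expR_gt0.
by rewrite divr_ge0 // !mulr_ge0 // ln_ge0.
Qed.

End Kernel.

(** * Percolation on the hierarchical lattice *)

Unset Implicit Arguments.
Set Strict Implicit.
Set Printing Implicit Defensive.
Local Open Scope classical_set_scope.
Local Open Scope ring_scope.

Theorem theorem1p5 (R : realType) (L d : nat) (a : R) :
  (2 <= L)%N -> (1 <= d)%N -> 1 < a ->
  exists (q : R) (N0 N1 : nat),
    [/\ 0 < q, q < 1,
        (forall e : hedge L d, 0 <= kernel15 a N0 N1 e) &
        forall (dT : measure_display) (T : measurableType dT)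
               (P : probability T R)
               (site : hvert L d -> set T) (bond : hedge L d -> set T),
          site_bond_model P q (kernel15 a N0 N1) site bond ->
          (0 < P [set t | ~ finite_set (cluster0 site bond t)])%E].
Proof.
move=> L2 d1 a1.
pose M := (L ^ d)%N; have M2 : (2 <= M)%N := leq2_expn L2 d1.
pose theta := Num.min ((1 + a) / 2) 2.
have th12 : 1 < theta <= 2.
  by rewrite /theta lt_min ge_min lexx orbT andbT; apply/andP; split; lra.
have tha : theta < a by rewrite /theta gt_min; apply/orP; left; lra.
have a0 : 0 <= a by lra.
have th0 : 0 < theta by case/andP: th12 => ? _; lra.
have [k [h main]] := finite_percolation M2 th12.
have [nl nlP] := lnln_eventually L2 th0 tha.
have [n1 [eta [n1min eta0 {}main]]] := main (nl + 2 * h + (Num.truncn (expR 1 : R)).+1)%N.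
(* The closing probability of a site and the bound for that of a short bond. *)
pose delta := Num.min (eta / (M ^ (2 * n1))%:R) 2^-1.
have Mn1 : 0 < (M ^ (2 * n1))%:R :> R by rewrite ltr0n expn_gt0 (ltnW M2).
have delta0 : 0 < delta by rewrite lt_min divr_gt0 //= invr_gt0.
have delta1 : delta <= 2^-1 by rewrite ge_min lexx orbT.
have deltaP : (M ^ (2 * n1))%:R * delta <= eta.
  by rewrite mulrC -ler_pdivlMr // ge_min lexx.
(* Edges inside a block of level [n1] are exactly those with the constant weight [N0]. *)
pose N1 := (L ^ n1.+1)%N.
(* The second summand makes short bonds closed with probability at most [delta]. The first serves
   the trees with root level T > n1 that reach down to short edges: these have T <= n1 + h. *)
pose N0 := ((Num.truncn (theta * ln (n1 + h)%:R)).+1 + (Num.truncn (- ln delta)).+1)%N.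
have N1e : expR 1 <= N1%:R :> R.
  apply: (le_trans (ltW (truncnS_gt _))); rewrite ler_nat.
  apply: (@leq_trans n1); last by apply: leq_trans (leqnSn _) (ltnW (ltn_expl _ L2)).
  by apply: leq_trans n1min; exact: leq_addl.
have Jge0 (e : hedge L d) : 0 <= kernel15 a N0 N1 e by exact: kernel15_ge0.
exists (1 - delta), N0, N1; split=> //; [lra | lra |].
move=> dT T P site bond model.
have [ms mb _ _ _] := model.
pose pN N := @coord_prob R L d L2 d1 (1 - delta) (kernel15 a N0 N1) N.
pose JN N (x y : 'I_(M ^ N)) : R :=
  kernel15 a N0 N1 (hedge_of L2 d1 (bond_of x y).1 (bond_of x y).2).
have bond_lt N (x y : 'I_(M ^ N)) : x != y -> ((bond_of x y).1 < (bond_of x y).2)%N.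
  rewrite /bond_of => xy; case: ifP => //= /negbT; rewrite -leqNgt leq_eqVlt val_eqE eq_sym.
  by rewrite (negbTE xy).
have JNE N (x y : 'I_(M ^ N)) : x != y -> JN N x y =
    if (N1 <= L ^ hlevel (enc L2 d1 x) (enc L2 d1 y))%N then
      a * M%:R * ln (ln (L ^ hlevel (enc L2 d1 x) (enc L2 d1 y))%:R) /
      (M ^ (2 * hlevel (enc L2 d1 x) (enc L2 d1 y)))%:R
    else N0%:R.
  move=> xy; have bneq : ((bond_of x y).1 : nat) != (bond_of x y).2.
    by rewrite ltn_eqF // bond_lt.
  have E : hlevel (enc L2 d1 (bond_of x y).1) (enc L2 d1 (bond_of x y).2) =
      hlevel (enc L2 d1 x) (enc L2 d1 y).
    by rewrite /bond_of; case: ifP => _ //; exact: hlevel_sym.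
  by rewrite /JN kernel15_hedge_of // E.
have p01 N c : 0 <= pN N c <= 1.
  rewrite /pN /coord_prob; case: ifP => _; first by apply/andP; split; lra.
  case: ifP => _; last by rewrite ler01 lexx.
  by rewrite subr_ge0 expR_le1 oppr_le0 Jge0 /= gerBl expR_ge0.
have pJ N (x y : 'I_(M ^ N)) : x != y -> 1 - pN N (bond_of x y) <= expR (- JN N x y).
  move=> xy; rewrite /pN /coord_prob; have blt := bond_lt _ _ _ xy.
  by rewrite -val_eqE (ltn_eqF blt) blt subKr.
have HJ N T' j (x y : 'I_(M ^ N)) : (n1 < T' <= N)%N -> (T' - h <= j < T')%N ->
    (x %/ M ^ j != y %/ M ^ j)%N -> (x %/ M ^ j.+1 = y %/ M ^ j.+1)%N ->
    theta * ln T'%:R * M%:R / (M ^ (2 * j.+1))%:R <= JN N x y.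
  move=> /andP[nT _] /andP[Tj jT] xyj xyj'.
  have xy : x != y by apply: contraNneq xyj => ->.
  have Mj : 0 < (M ^ (2 * j.+1))%:R :> R by rewrite ltr0n expn_gt0 (ltnW M2).
  rewrite JNE // (hlevel_enc L2 d1 xyj xyj'); case: ifP => [_|/negbT].
    rewrite ler_pM2r ?invr_gt0 // -!mulrA [M%:R * _]mulrC !mulrA ler_wpM2r //.
    by apply: nlP; move: n1min nT Tj; clear; lia.
  rewrite leq_exp2l // -ltnNge => jn1.
  apply: (@le_trans _ _ (theta * ln (n1 + h)%:R)); last first.
    by apply: (le_trans (ltW (truncnS_gt _))); rewrite ler_nat leq_addr.
  have T0 : (0 < T')%N by exact: leq_trans nT.
  have lnT0 : 0 <= theta * ln T'%:R by rewrite mulr_ge0 ?(ltW th0) // ln_ge0 // ler1n.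
  apply: (@le_trans _ _ (theta * ln T'%:R)).
    rewrite -mulrA ler_piMr // ler_pdivrMr // mul1r ler_nat -{1}(expn1 M) leq_exp2l //.
  rewrite ler_pM2l // ler_ln ?posrE ?ltr0n ?ler_nat //; move: nT Tj jn1; clear; lia.
have base N (x y : 'I_(M ^ N)) : (x %/ M ^ n1 = y %/ M ^ n1)%N -> 1 - pN N (bond_of x y) <= delta.
  move=> xyn; have [->|xy] := eqVneq x y.
    by rewrite /pN /coord_prob /bond_of ltnn eqxx subKr.
  apply: (le_trans (pJ _ _ _ xy)); rewrite JNE // leqNgt.
  have -> : (L ^ hlevel (enc L2 d1 x) (enc L2 d1 y) < N1)%N.
    by rewrite ltn_exp2l // ltnS hlevel_enc_le; apply/eqP.
  rewrite /= -[leRHS]lnK ?posrE // ler_expR lerNl.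
  by apply: (le_trans (ltW (truncnS_gt _))); rewrite ler_nat leq_addl.
have MN N : (0 < M ^ N)%N by rewrite expn_gt0 (ltnW M2).
pose Ev N (w : {ffun 'I_(M ^ N) * 'I_(M ^ N) -> bool}) :=
  (M ^ (N - k) <= #|cl N w (Ordinal (MN N))|)%N.
(* In the block of level i + k + 1 the guaranteed size is M^(i + 1), which exceeds 1 and tends to
   infinity. *)
pose F i := [set t | Ev (i + k + 1)%N (@cfg L d L2 d1 dT T site bond (i + k + 1) t)].
have mF i : measurable (F i) by exact: (cfg_pred_measurable L2 d1 model (Ev _)).
have PF i : (2^-1%:E <= P (F i))%E.
  rewrite /F (P_cfg L2 d1 model (Ev _)) lee_fin.
  apply: (main _ (pN _) (JN _) delta (Ordinal (MN _)) _ (p01 _) (@pJ _) (@HJ _) (@base _) deltaP).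
  by rewrite -addnA addnCA leq_addr.
have ik i : (i + k + 1 - k = i + 1)%N by rewrite addnAC addnK.
have sub : lim_sup_set F `<=` [set t | ~ finite_set (cluster0 site bond t)].
  move=> t Ft /finite_seqP[s sE].
  have [i /= si] := Ft (size s) I.
  rewrite /F /Ev /= ik; case/cluster0_large => //.
    by rewrite addn1 expnS (leq_trans M2) // leq_pmulr.
  move=> s' [us' ss' s'c]; have : (size s' <= size s)%N.
    by apply: uniq_leq_size => // y /s'c; rewrite sE.
  apply/negP; rewrite -ltnNge; apply: leq_trans ss'; apply: leq_ltn_trans si _.
  by rewrite (leq_trans (ltn_expl i M2)) // leq_exp2l // leq_addr.
have mS : measurable (lim_sup_set F).
  by apply: bigcapT_measurable => n; apply: bigcup_measurable.
(* The events [F i] need not be nested, but the tail unions decrease to the limit superior and each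
   has probability at least one half. *)
have PS : (2^-1%:E <= P (lim_sup_set F))%E.
  have := lim_sup_set_cvg P F mF; rewrite -ge0_fin_numE // => /(_ _) cv.
  apply: (cvge_ge _ (cv _)); last by apply: fin_num_measure; apply: bigcup_measurable.
  near=> n; apply: (le_trans (PF n)); apply: le_measure; rewrite ?inE //.
    by apply: bigcup_measurable.
  by move=> t Ft; exists n => /=.
apply: lt_le_trans (le_trans PS _); first by rewrite lte_fin invr_gt0.
apply: le_measure => //; rewrite inE //; exact: infinite_cluster0_measurable.
Unshelve. all: by end_near.
Qed.
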